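(* There exists a constant $C_2>0$ such that for every sufficiently large integer $n$ the following holds. Suppose that $p\ge \frac{C_2\ln n}{n}$. Then in the $p$-random-turn Hamiltonicity game played on $E(K_n)$, Maker has a polynomial-time randomized strategy which is w.h.p. a winning strategy.
   Context: In a $p$-random-turn Maker-Breaker game ($0\le p=p(n)\le 1$) played on the edge set $E(K_n)$ of the complete graph, two players, Maker and Breaker, claim previously unclaimed edges. Before each turn a biased coin is tossed, independently of all other turns: with probability $p$ Maker plays this turn, and with probability $1-p$ Breaker plays it; the chosen player claims exactly one unclaimed edge. The game lasts until all edges are claimed. In the Hamiltonicity game Maker wins if the edges he claimed contain all edges of some Hamilton cycle of $K_n$; otherwise Breaker wins. A strategy of a player prescribes (possibly using randomization) his next move on the basis of the history of the game so far; it is polynomial-time if each move can be computed in time polynomial in $n$. ''W.h.p.'' means with probability tending to $1$ as $n\to\infty$ (over the coin tosses and any randomness of the strategy), against any strategy of the opponent. *)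

(* Defs.v *)
From mathcomp Require Import all_boot all_order all_algebra.
From mathcomp Require Import reals.

Set Implicit Arguments.
Unset Strict Implicit.
Unset Printing Implicit Defensive.

Import Order.TTheory GRing.Theory Num.Theory.

(** * A machine model for running times *)

(** Jones's WHILE language over binary trees ("Computability and Complexity
    from a Programming Perspective"), with unit cost per elementary operation.
    Its polynomial-time functions are those of Turing machines: [t] steps create
    [O(t)] nodes, and as there is no equality test on trees, subtrees can be
    stored shared. *)
Inductive tree : Type := Nil | Cons of tree & tree.

Definition hd (t : tree) : tree := if t is Cons u _ then u else Nil.
Definition tl (t : tree) : tree := if t is Cons _ v then v else Nil.
Definition is_nil (t : tree) : bool := if t is Nil then true else false.

Inductive expr : Type :=
| EVar of nat
| ENil
| ECons of expr & expr
| EHd of expr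
| ETl of expr.

Inductive cmd : Type :=
| CAssign of nat & expr
| CSeq of cmd & cmd
| CIf of expr & cmd & cmd
| CWhile of expr & cmd.

Definition store : Type := nat -> tree.

Definition update (s : store) (x : nat) (t : tree) : store :=
  fun y => if y == x then t else s y.

Fixpoint eval (e : expr) (s : store) : tree :=
  match e with
  | EVar x => s x
  | ENil => Nil
  | ECons e1 e2 => Cons (eval e1 s) (eval e2 s)
  | EHd e1 => hd (eval e1 s)
  | ETl e1 => tl (eval e1 s)
  end.

Fixpoint expr_cost (e : expr) : nat :=
  match e with
  | EVar _ | ENil => 1
  | ECons e1 e2 => (expr_cost e1 + expr_cost e2).+1
  | EHd e1 | ETl e1 => (expr_cost e1).+1
  end.

(** [exec c s t s'] : started in store [s], the command [c] halts in store [s']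
    after exactly [t] time units. *)
Inductive exec : cmd -> store -> nat -> store -> Prop :=
| ExecAssign x e s :
    exec (CAssign x e) s (expr_cost e).+1 (update s x (eval e s))
| ExecSeq c1 c2 s s1 s2 t1 t2 :
    exec c1 s t1 s1 -> exec c2 s1 t2 s2 -> exec (CSeq c1 c2) s (t1 + t2) s2
| ExecIfTrue e c1 c2 s s' t :
    ~~ is_nil (eval e s) -> exec c1 s t s' ->
    exec (CIf e c1 c2) s ((expr_cost e).+1 + t) s'
| ExecIfFalse e c1 c2 s s' t :
    is_nil (eval e s) -> exec c2 s t s' ->
    exec (CIf e c1 c2) s ((expr_cost e).+1 + t) s'
| ExecWhileTrue e c s s1 s2 t1 t2 :
    ~~ is_nil (eval e s) -> exec c s t1 s1 -> exec (CWhile e c) s1 t2 s2 ->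
    exec (CWhile e c) s ((expr_cost e).+1 + t1 + t2) s2
| ExecWhileFalse e c s :
    is_nil (eval e s) -> exec (CWhile e c) s (expr_cost e).+1 s.

(** Variable 0 holds the input at the start and the output at the end. *)
Definition computes_within (c : cmd) (input : tree) (T : nat) (output : tree) :
    Prop :=
  exists t (s : store),
    [/\ exec c (update (fun=> Nil) 0 input) t s, s 0 = output & t <= T].

Definition enc_seq (A : Type) (enc : A -> tree) (s : seq A) : tree :=
  foldr (fun a t => Cons (enc a) t) Nil s.

Definition enc_bool (b : bool) : tree := if b then Cons Nil Nil else Nil.

(** Unary, so that "polynomial in [n]" is "polynomial in the input size". *)
Definition enc_nat (m : nat) : tree := iter m (Cons Nil) Nil.

(** * The random-turn game on [E(K_n)] *)

Section Game.

Variable n : nat.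

Definition Kn_edges : {set {set 'I_n}} := [set e : {set 'I_n} | #|e| == 2].

(** The moves in chronological order; [(true, e)] records that Maker claimed
    [e], and [(false, e)] that Breaker did. *)
Definition history : Type := seq (bool * {set 'I_n}).

Definition claimed (h : history) : seq {set 'I_n} := [seq x.2 | x <- h].

Definition valid (h : history) : bool :=
  uniq (claimed h) && all (mem Kn_edges) (claimed h).

Definition unclaimed (h : history) : {set {set 'I_n}} :=
  [set e in Kn_edges | e \notin claimed h].

Definition strategy : Type := history -> {set 'I_n}.

Definition legal (s : strategy) : Prop :=
  forall h, valid h -> unclaimed h != set0 -> s h \in unclaimed h.

Definition play (maker breaker : strategy) (turns : seq bool) : history :=
  foldl (fun h b => rcons h (b, if b then maker h else breaker h)) [::] turns.

Definition maker_edges (h : history) : {set {set 'I_n}} :=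
  [set e | (true, e) \in h].

(** For [n = 2] the closed walk along a single edge is not a cycle. *)
Definition hamiltonian (G : {set {set 'I_n}}) : bool :=
  (2 < n) &&
  [exists c : n.-tuple 'I_n, uniq c && cycle (fun x y => [set x; y] \in G) c].

End Game.

Local Open Scope ring_scope.

(** The private randomness of a player is drawn once, before the game: a
    randomized strategy is a probability distribution on strategies. *)
Record rstrategy (R : realType) (n : nat) : Type := RStrategy {
  seed : finType;
  weight : seed -> R;
  weight_ge0 : forall s, 0 <= weight s;
  weight_sum1 : \sum_s weight s = 1;
  act : seed -> strategy n;
  act_legal : forall s, legal (act s)
}.

Definition turns_prob (R : realType) (p : R) (N : nat) (w : N.-tuple bool) : R :=
  \prod_(b <- w) (if b then p else 1 - p).

Definition maker_win_prob (R : realType) (p : R) (n : nat)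
    (M B : rstrategy R n) : R :=
  \sum_(w : #|Kn_edges n|.-tuple bool) \sum_(s : seed M) \sum_(r : seed B)
    turns_prob p w * weight s * weight r *
    (hamiltonian (maker_edges (play (act s) (act r) w)))%:R.

Definition enc_edge (n : nat) (e : {set 'I_n}) : tree :=
  enc_seq enc_nat [seq val i | i <- enum e].

Definition enc_history (n : nat) (h : history n) : tree :=
  enc_seq (fun x => Cons (enc_bool x.1) (enc_edge x.2)) h.

Definition enc_input (n : nat) (h : history n) (coins : seq bool) : tree :=
  Cons (enc_nat n) (Cons (enc_history h) (enc_seq enc_bool coins)).

(** One program serves all [n]. Polynomially many fair coins determine the seed
    through [f], with the right distribution, and from [n], the history and the
    coins the program computes the prescribed move in polynomial time. A single
    polynomial [a * n ^ k + a] bounds the time and is the number of coins. *)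
Definition poly_time (R : realType) (S : forall n, rstrategy R n) : Prop :=
  exists (c : cmd) (a k : nat), forall n, let b := (a * n ^ k + a)%N in
  exists f : b.-tuple bool -> seed (S n),
    (forall s, weight s = #|[set r | f r == s]|%:R / 2 ^+ b) /\
    forall (r : b.-tuple bool) (h : history n),
      valid h -> unclaimed h != set0 ->
      computes_within c (enc_input h r) b (enc_edge (act (f r) h)).

(* Main.v *)
Require Import Defs.
From mathcomp Require Import all_boot all_order all_algebra.
From mathcomp Require Import all_classical all_reals all_analysis.
From mathcomp Require Import ring lra zify.
Import Order.TTheory GRing.Theory Num.Theory.

Set Implicit Arguments.
Unset Strict Implicit.
Unset Printing Implicit Defensive.

(** Maker keeps a cyclic order of the vertices. A consecutive pair that he does not
    own is a gap, and he has won when no gap is left. A 2-opt move at a gap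
    [(x, x')] takes a consecutive pair [(v, z)], claims [xv] and reverses a segment,
    so that [(x', z)] is the only possible new gap. If some end of a gap has degree
    at least [n / 25] in the graph of claimed edges, Maker moves at an end of
    maximal degree; otherwise he closes a gap if he can, and else he rotates, to a
    new end [z] of small degree that is joined to few of the ends by claimed edges.

    With [m] gaps, a rotation creates about [m] edges each of which closes a gap, so
    Breaker must spend about [m] turns before the next rotation, and on each of
    these turns Maker closes a gap with probability [p]. Summing over [m] (a
    harmonic sum), he needs [O(n)] turns in all, for which [O(n^2 / ln n)] turns of
    the game suffice; in that time few vertices acquire a large degree, and the box
    game argument, with weight [(1 + q / 8) ^ degree] on the ends of the gaps,
    protects the ends.

    All this is expressed by a single function of the position, the sum [pot] of
    three exponential supermartingales: it is [O(1 / n)] at the start, and at the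
    end it is at least 1 unless Maker has won. It only uses a lower bound
    [q = C ln n / n] for [p], and the strategy, which is deterministic, does not
    use even that. *)

(** * Polynomial time in the WHILE language *)

(** The harmonic sum arises as follows. A rotation at [m] gaps yields at least [(m + 4) / 8]
    threats, so Breaker needs about that many turns to remove them, and each turn is Maker's with
    probability at least [q]. Hence about [8 / (q * (m + 4))] rotations are expected before a gap
    closes, and the sum over [m] has order [ln n / q], which is [O(n)] just because [q] has order
    [ln n / n].

    Two obstacles shape the proof. Good rotations exist only while few edges are claimed and all gap
    ends have moderate degree, and these events depend on the play. No conditioning or stopping time
    is used: where the potential is at least 1 it bounds the loss trivially, and where it is below 1
    both conditions follow. Secondly, the time bound is circular: moves at crowded ends prolong the
    game, and a longer game crowds more vertices. The constant [200 * 200] breaks the circle.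

    Expectations would not be enough, since the potential must reach 1 in every bad position
    although it starts at [O(1 / n)]. Hence the exponentials: with exponents on the scale [q], a
    deviation of order [ln n / q = O(n)] already outweighs any fixed power of [n]. *)

Structure encType := EncType { enc_sort :> Type; encode : enc_sort -> tree }.

Canonical nat_encType := EncType enc_nat.
Canonical bool_encType := EncType enc_bool.
Canonical unit_encType := EncType (fun _ : unit => Defs.Nil).
Canonical seq_encType (A : encType) :=
  @EncType (seq A) (enc_seq (@encode A)).
Canonical prod_encType (A B : encType) :=
  @EncType (A * B) (fun x => Defs.Cons (encode x.1) (encode x.2)).

(** * Sizes of encoded data and polynomial bounds *)

Fixpoint tsize (t : tree) : nat :=
  if t is Defs.Cons u v then (tsize u + tsize v).+1 else 1.

Definition sz (A : encType) (x : A) : nat := tsize (encode x).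

Lemma sz_gt0 (A : encType) (x : A) : 0 < sz x.
Proof. by rewrite /sz; case: (encode x). Qed.

Lemma sz_pair (A B : encType) (x : A) (y : B) :
  sz (x, y) = (sz x + sz y).+1.
Proof. by []. Qed.

Lemma sz_cons (A : encType) (a : A) (l : seq A) :
  sz (a :: l) = (sz a + sz l).+1.
Proof. by []. Qed.

Lemma sz_nil (A : encType) : sz (nil : seq A) = 1.
Proof. by []. Qed.

Lemma sz_cat (A : encType) (l1 l2 : seq A) :
  (sz (l1 ++ l2)).+1 = sz l1 + sz l2.
Proof.
elim: l1 => [|a l1 IH]; first by rewrite sz_nil.
by rewrite cat_cons !sz_cons -[RHS]/((sz a + sz l1 + sz l2).+1) -addnA -IH addnS.
Qed.

Lemma size_lt_sz (A : encType) (l : seq A) : size l < sz l.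
Proof.
elim: l => [|a l IH] //=; rewrite sz_cons ltnS; apply: (leq_trans IH).
exact: leq_addl.
Qed.

Lemma sz_nat (m : nat) : sz m = m.*2.+1.
Proof.
elim: m => // m IH.
have -> : sz m.+1 = (sz m).+2 by [].
by rewrite IH.
Qed.

Lemma sz_bool (b : bool) : sz b <= 3.
Proof. by case: b. Qed.

(** As [sz x] is at least 1, monomials dominate all polynomials and are closed under sums and
    products up to a larger monomial. *)
Definition pb (X : encType) (P : X -> nat) : Prop :=
  exists a k, forall x, P x <= a * sz x ^ k.

Section PolynomialBounds.

Variables (X : encType).

Lemma pb_le (P Q : X -> nat) : (forall x, P x <= Q x) -> pb Q -> pb P.
Proof.
by move=> PQ [a [k hQ]]; exists a, k => x; apply: leq_trans (PQ x) (hQ x).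
Qed.

Lemma pb_const (c : nat) : pb (fun _ : X => c).
Proof. by exists c, 0 => x; rewrite expn0 muln1. Qed.

Lemma pb_sz : pb (fun x : X => sz x).
Proof. by exists 1, 1 => x; rewrite mul1n expn1. Qed.

Lemma pb_add (P Q : X -> nat) : pb P -> pb Q -> pb (fun x => P x + Q x).
Proof.
move=> [a [k hP]] [b [j hQ]]; exists (a + b), (k + j) => x.
rewrite mulnDl; apply: leq_add.
  apply: leq_trans (hP x) _; rewrite leq_mul2l leq_pexp2l ?sz_gt0 ?orbT //.
  exact: leq_addr.
apply: leq_trans (hQ x) _; rewrite leq_mul2l leq_pexp2l ?sz_gt0 ?orbT //.
exact: leq_addl.
Qed.

Lemma pb_mul (P Q : X -> nat) : pb P -> pb Q -> pb (fun x => P x * Q x).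
Proof.
move=> [a [k hP]] [b [j hQ]]; exists (a * b), (k + j) => x.
by apply: leq_trans (leq_mul (hP x) (hQ x)) _; rewrite expnD mulnACA.
Qed.

Lemma pb_exp (P : X -> nat) k : pb P -> pb (fun x => P x ^ k).
Proof.
move=> hP; elim: k => [|k IH].
  by apply: pb_le (pb_const 1) => x; rewrite expn0.
by apply: pb_le (pb_mul hP IH) => x; rewrite expnS.
Qed.

End PolynomialBounds.

Arguments pb_const {X} c.
Arguments pb_sz {X}.

Lemma pb_comp (X Y : encType) (f : X -> Y) (P : Y -> nat) :
  pb (fun x => sz (f x)) -> pb P -> pb (fun x => P (f x)).
Proof.
move=> hf [a [k hP]].
have := pb_mul (pb_const a) (pb_exp k hf); apply: pb_le => x; exact: hP.
Qed.

(** The last conjunct but one is a frame property: it lets a caller keep its own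
    data in the registers from [w] on. *)
Definition runs (X Y : encType) (c : cmd) (w : nat)
    (T : X -> nat) (f : X -> Y) : Prop :=
  forall x s, s 0 = encode x -> exists t s',
    [/\ exec c s t s', s' 0 = encode (f x),
        forall y, w <= y -> s' y = s y & t <= T x].

Lemma update_neq s x t y : y != x -> update s x t y = s y.
Proof. by rewrite /update => /negPf ->. Qed.

(** The output size is bounded separately because the running time does not control it:
    [ECons (EVar 0) (EVar 0)] more than doubles a tree at constant cost, so a loop could build
    exponentially large trees. Composition needs the size of the intermediate value. *)
Definition ptime (X Y : encType) (f : X -> Y) : Prop :=
  pb (fun x => sz (f x)) /\
  exists c w (T : X -> nat), [/\ 0 < w, pb T & runs c w T f].

Lemma ptime_ext (X Y : encType) (f g : X -> Y) :
  f =1 g -> ptime f -> ptime g.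
Proof.
move=> fg [hs [c [w [T [w0 hT hr]]]]]; split.
  by apply: pb_le hs => x; rewrite fg.
by exists c, w, T; split => // x s /hr; rewrite -fg.
Qed.

Lemma pb_ptime (X Y : encType) (f : X -> Y) (P : Y -> nat) :
  ptime f -> pb P -> pb (fun x => P (f x)).
Proof. by move=> [hf _]; apply: pb_comp. Qed.

(** * Straight-line programs, composition, pairing and branching *)

Lemma ptime_expr (X Y : encType) (f : X -> Y) (e : expr) :
  pb (fun x => sz (f x)) ->
  (forall x s, s 0 = encode x -> Defs.eval e s = encode (f x)) -> ptime f.
Proof.
move=> hf he; split => //.
exists (CAssign 0 e), 1, (fun=> (expr_cost e).+1); split => //.
  exact: pb_const.
move=> x s /he hs; exists (expr_cost e).+1, (update s 0 (Defs.eval e s)).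
by split => //; [exact: ExecAssign | case].
Qed.

Lemma ptime_id (X : encType) : ptime (fun x : X => x).
Proof. by apply: (@ptime_expr _ _ _ (EVar 0)) => //; apply: pb_sz. Qed.

Fixpoint tree_expr (t : tree) : expr :=
  if t is Defs.Cons u v then ECons (tree_expr u) (tree_expr v) else ENil.

Lemma ptime_const (X Y : encType) (y : Y) :
  ptime (fun _ : X => y).
Proof.
apply: (@ptime_expr _ _ _ (tree_expr (encode y))); first exact: pb_const.
by move=> _ s _; elim: (encode y) => //= u -> v ->.
Qed.

Arguments ptime_id {X}.
Arguments ptime_const {X Y} y.

Lemma ptime_comp (X Y Z : encType)
    (f : X -> Y) (g : Y -> Z) :
  ptime f -> ptime g -> ptime (fun x => g (f x)).
Proof.
move=> hf hg; split; first exact: (pb_ptime hf hg.1).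
move: (hf) (hg) => [sf [cf [wf [Tf [wf0 hTf rf]]]]].
move=> [_ [cg [wg [Tg [wg0 hTg rg]]]]].
exists (CSeq cf cg), (maxn wf wg), (fun x => Tf x + Tg (f x)); split.
- by rewrite leq_max wf0.
- by apply: pb_add => //; apply: pb_comp hTg.
move=> x s /rf [t1 [s1 [e1 v1 fr1 l1]]].
have [t2 [s2 [e2 v2 fr2 l2]]] := rg _ _ v1.
exists (t1 + t2), s2; split => //; [exact: ExecSeq e1 e2 | | exact: leq_add].
by move=> y; rewrite geq_max => /andP[h1 h2]; rewrite fr2 // fr1.
Qed.

Lemma ptime_pair (X Y Z : encType)
    (f : X -> Y) (g : X -> Z) :
  ptime f -> ptime g -> ptime (fun x => (f x, g x)).
Proof.
move=> [sf [cf [wf [Tf [wf0 hTf rf]]]]] [sg [cg [wg [Tg [wg0 hTg rg]]]]].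
split.
  apply: pb_le (pb_add (pb_add sf sg) (pb_const 1)) => x.
  by rewrite sz_pair addn1.
pose w := maxn wf wg.
have w0 : 0 < w by rewrite leq_max wf0.
exists (CSeq (CAssign w (EVar 0)) (CSeq cf (CSeq (CAssign w.+1 (EVar 0))
  (CSeq (CAssign 0 (EVar w)) (CSeq cg
  (CAssign 0 (ECons (EVar w.+1) (EVar 0)))))))), w.+2,
  (fun x => Tf x + Tg x + 10); split => //.
  by apply: pb_add; [apply: pb_add | apply: pb_const].
move=> x s hx.
have [t1 [s1 [e1 v1 fr1 l1]]] := rf x (update s w (encode x)) (etrans
  (ifN_eqC _ _ (lt0n_neq0 w0)) hx).
have s1w : s1 w = encode x by rewrite fr1 ?leq_maxl // /update eqxx.
have [t2 [s2 [e2 v2 fr2 l2]]] :=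
  rg x (update (update s1 w.+1 (encode (f x))) 0 (encode x)) erefl.
exists (2 + (t1 + (2 + (2 + (t2 + 4))))).
exists (update s2 0 (Defs.Cons (s2 w.+1) (s2 0))); split.
- apply: ExecSeq; first exact: ExecAssign.
  rewrite /= hx; apply: ExecSeq e1 _.
  apply: ExecSeq; first exact: ExecAssign.
  rewrite /= v1; apply: ExecSeq; first exact: ExecAssign.
  rewrite /= update_neq ?ltn_eqF // s1w.
  apply: ExecSeq e2 _; exact: ExecAssign.
- rewrite /update /= v2 fr2; last by rewrite (leq_trans (leq_maxr wf wg)).
  by rewrite /update /= eqxx.
- move=> y wy; rewrite /update gtn_eqF; last by apply: leq_trans wy.
  have le1 : wg <= y by rewrite (leq_trans (leq_maxr wf wg)) // ltnW // ltnW.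
  have le2 : wf <= y by rewrite (leq_trans (leq_maxl wf wg)) // ltnW // ltnW.
  rewrite fr2 // /update (gtn_eqF (leq_trans _ wy)) //.
  rewrite (gtn_eqF wy) fr1 // /update (gtn_eqF (leq_trans _ wy)) //.
by move: l1 l2; lia.
Qed.

Lemma ptime_if (X Y : encType) (b : X -> bool)
    (f g : X -> Y) :
  ptime b -> ptime f -> ptime g -> ptime (fun x => if b x then f x else g x).
Proof.
move=> [_ [cb [wb [Tb [wb0 hTb rb]]]]].
move=> [sf [cf [wf [Tf [wf0 hTf rf]]]]] [sg [cg [wg [Tg [wg0 hTg rg]]]]].
split.
  apply: pb_le (pb_add sf sg) => x.
  by case: (b x); [exact: leq_addr | exact: leq_addl].
pose w := maxn wb (maxn wf wg).
have w0 : 0 < w by rewrite leq_max wb0.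
have wwb : wb <= w by rewrite leq_maxl.
have wwf : wf <= w by rewrite /w; lia.
have wwg : wg <= w by rewrite /w; lia.
exists (CSeq (CAssign w (EVar 0)) (CSeq cb (CSeq (CAssign w.+1 (EVar 0))
  (CSeq (CAssign 0 (EVar w)) (CIf (EVar w.+1) cf cg))))), w.+2,
  (fun x => Tb x + Tf x + Tg x + 10); split => //.
  by do 2?[apply: pb_add]; [apply: pb_add| |apply: pb_const].
move=> x s hx.
have [t1 [s1 [e1 v1 fr1 l1]]] := rb x (update s w (encode x)) (etrans
  (ifN_eqC _ _ (lt0n_neq0 w0)) hx).
have s1w : s1 w = encode x by rewrite fr1 // /update eqxx.
pose (s2 := update (update s1 w.+1 (encode (b x))) 0 (encode x)).
have s2f y : w.+2 <= y -> s2 y = s y.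
  move=> wy; rewrite /s2 /update (gtn_eqF (leq_trans _ wy)) //.
  rewrite (gtn_eqF wy) fr1; last by lia.
  by rewrite /update gtn_eqF // ltnW.
have s2w : s2 w.+1 = encode (b x) by rewrite /s2 /update /= eqxx.
have pre t s' :
    exec (CIf (EVar w.+1) cf cg) s2 t s' ->
    exec (CSeq (CAssign w (EVar 0)) (CSeq cb (CSeq (CAssign w.+1 (EVar 0))
  (CSeq (CAssign 0 (EVar w)) (CIf (EVar w.+1) cf cg))))) s
     (2 + (t1 + (2 + (2 + t)))) s'.
  move=> h; apply: ExecSeq; first exact: ExecAssign.
  rewrite /= hx; apply: ExecSeq e1 _.
  apply: ExecSeq; first exact: ExecAssign.
  rewrite /= v1; apply: ExecSeq; first exact: ExecAssign.
  rewrite /= update_neq ?ltn_eqF // s1w; exact: h.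
case bx: (b x).
  have [t2 [s3 [e2 v2 fr2 l2]]] := rf x s2 erefl.
  exists (2 + (t1 + (2 + (2 + (2 + t2))))), s3; split => //.
  - by apply: pre; apply: ExecIfTrue => //=; rewrite s2w bx.
  - by move=> y wy; rewrite fr2 ?s2f //; lia.
  - by move: l1 l2; lia.
have [t2 [s3 [e2 v2 fr2 l2]]] := rg x s2 erefl.
exists (2 + (t1 + (2 + (2 + (2 + t2))))), s3; split => //.
- by apply: pre; apply: ExecIfFalse => //=; rewrite s2w bx.
- by move=> y wy; rewrite fr2 ?s2f //; lia.
by move: l1 l2; lia.
Qed.

(** * Loops over lists *)

Section Fold.

Variables (X A B : encType).
Variables (l : X -> seq A) (i : X -> B) (g : X -> A -> B -> B).

Let fold x s := foldl (fun b a => g x a b) (i x) s.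

(** Registers [w], [w.+1] and [w.+2] hold the parameter, the unread part of the list and the
    accumulator; register 0 passes arguments to [cg] and receives its result. *)
Let loop w cg := CWhile (EVar w.+1)
  (CSeq (CAssign 0 (ECons (EVar w) (ECons (EHd (EVar w.+1)) (EVar w.+2))))
  (CSeq cg (CSeq (CAssign w.+2 (EVar 0)) (CAssign w.+1 (ETl (EVar w.+1)))))).

Let loop_runs cg wg (T : X * (A * B) -> nat) w K x :
  wg <= w -> 0 < w -> runs cg wg T (fun y => g y.1 y.2.1 y.2.2) ->
  (forall s1 a s2, l x = s1 ++ a :: s2 -> T (x, (a, fold x s1)) <= K) ->
  forall s2 s1 s, l x = s1 ++ s2 ->
    s w = encode x -> s w.+1 = encode s2 -> s w.+2 = encode (fold x s1) ->
  exists t s', [/\ exec (loop w cg) s t s', s' w.+2 = encode (fold x (l x)),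
     forall y, w.+3 <= y -> s' y = s y & t <= size s2 * (K + 20) + 2].
Proof.
move=> ww w0 rg hK; elim=> [|a s2 IH] s1 s hl s_w s_w1 s_w2.
  exists 2, s; split => //; last by rewrite s_w2 hl cats0.
  by apply: ExecWhileFalse; rewrite /= s_w1.
pose (s3 := update s 0 (encode (x, (a, fold x s1)))).
have [t1 [s4 [e1 v1 fr1 l1]]] := rg (x, (a, fold x s1)) s3 erefl.
pose (s5 := update s4 w.+2 (encode (g x a (fold x s1)))).
pose (s6 := update s5 w.+1 (encode s2)).
have w2n : (w == w.+2) = false by rewrite ltn_eqF.
have w1n : (w == w.+1) = false by rewrite ltn_eqF.
have w21 : (w.+2 == w.+1) = false by rewrite gtn_eqF.
have w12 : (w.+1 == w.+2) = false by rewrite ltn_eqF.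
have wz : (w == 0) = false by rewrite gtn_eqF.
have s6w : s6 w = encode x.
  by rewrite /s6 /s5 /update w1n w2n fr1 // /s3 /update wz.
have s6w1 : s6 w.+1 = encode s2 by rewrite /s6 /update eqxx.
have s6w2 : s6 w.+2 = encode (fold x (rcons s1 a)).
  by rewrite /s6 /s5 /update w21 eqxx /fold foldl_rcons.
have hl' : l x = rcons s1 a ++ s2 by rewrite cat_rcons.
have [t2 [s7 [e2 v2 fr2 l2]]] := IH _ _ hl' s6w s6w1 s6w2.
exists (2 + (7 + (t1 + (2 + 3))) + t2), s7; split => //.
- apply: ExecWhileTrue e2; first by rewrite /= s_w1.
  apply: ExecSeq; first exact: ExecAssign.
  rewrite /= s_w s_w1 s_w2; apply: ExecSeq e1 _.
  apply: ExecSeq; first exact: ExecAssign.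
  rewrite /= v1.
  have -> : s6 = update s5 w.+1 (Defs.eval (ETl (EVar w.+1)) s5).
    rewrite /s6 /=; congr (update _ _ _).
    rewrite /s5 /update w12 fr1 //; last by lia.
    by rewrite /s3 /update /= s_w1.
  exact: ExecAssign.
- move=> y wy; rewrite fr2 // /s6 /s5 /update gtn_eqF; last by lia.
  rewrite gtn_eqF // fr1; last by lia.
  by rewrite /s3 /update gtn_eqF //; lia.
have h1 := leq_trans l1 (hK _ _ _ hl); move: h1 l2; rewrite [size (_ :: _)]/= mulSn; lia.
Qed.

(** A polynomial-time body is not enough, as a body that squares the size would compound. The bound
    [Q] is asked of every prefix because each intermediate accumulator is an input of the body. *)
Lemma ptime_foldl_gen :
  ptime l -> ptime i -> ptime (fun y : X * (A * B) => g y.1 y.2.1 y.2.2) ->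
  (exists2 Q : X -> nat, pb Q & forall x s1 s2, l x = s1 ++ s2 ->
    sz (foldl (fun b a => g x a b) (i x) s1) <= Q x) ->
  ptime (fun x => foldl (fun b a => g x a b) (i x) (l x)).
Proof.
move=> [sl [cl [wl [Tl [wl0 hTl rl]]]]] [si [ci [wi [Ti [wi0 hTi ri]]]]].
move=> [_ [cg [wg [Tg [wg0 [a0 [k0 hTg]] rg]]]]] [Q hQ foldQ]; split.
  by apply: pb_le hQ => x; apply: (foldQ x _ [::]); rewrite cats0.
pose w := maxn wl (maxn wi wg).
have w0 : 0 < w by rewrite leq_max wl0.
have wwl : wl <= w by rewrite leq_maxl.
have wwi : wi <= w by rewrite /w; lia.
have wwg : wg <= w by rewrite /w; lia.
pose (K := fun x => a0 * (sz x + sz (l x) + Q x + 2) ^ k0).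
exists (CSeq (CAssign w (EVar 0)) (CSeq cl (CSeq (CAssign w.+1 (EVar 0))
  (CSeq (CAssign 0 (EVar w)) (CSeq ci (CSeq (CAssign w.+2 (EVar 0))
  (CSeq (loop w cg) (CAssign 0 (EVar w.+2))))))))), w.+3,
  (fun x => Tl x + Ti x + sz (l x) * (K x + 20) + 20); split => //.
  apply: pb_add; last exact: pb_const.
  apply: pb_add; first exact: pb_add.
  apply: pb_mul => //; apply: pb_add; last exact: pb_const.
  apply: pb_mul; first exact: pb_const.
  apply: pb_exp; apply: pb_add; last exact: pb_const.
  by apply: pb_add => //; apply: pb_add => //; apply: pb_sz.
have hK x s1 a s2 : l x = s1 ++ a :: s2 -> Tg (x, (a, fold x s1)) <= K x.
  move=> hl; apply: leq_trans (hTg _) _; rewrite leq_mul2l; apply/orP; right.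
  set u := sz _; set v := (_ + 2); suff uv : u <= v by case: (k0) => [|k] //; rewrite leq_exp2r.
  rewrite /u /v.
  rewrite !sz_pair; have := foldQ x _ _ hl; rewrite -/(fold x s1).
  have : sz a <= sz (l x).
    have := sz_cat s1 (a :: s2); rewrite -hl (sz_cons a s2).
    have := sz_gt0 s1; have := sz_gt0 s2; lia.
  by lia.
move=> x s hx.
have [t1 [s1 [e1 v1 fr1 l1]]] := rl x (update s w (encode x)) (etrans
  (ifN_eqC _ _ (lt0n_neq0 w0)) hx).
have s1w : s1 w = encode x by rewrite fr1 // /update eqxx.
pose (s2 := update (update s1 w.+1 (encode (l x))) 0 (encode x)).
have [t2 [s3 [e2 v2 fr2 l2]]] := ri x s2 erefl.
pose (s4 := update s3 w.+2 (encode (i x))).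
have wz : (w == 0) = false by rewrite gtn_eqF.
have w2n : (w == w.+2) = false by rewrite ltn_eqF.
have w1n : (w == w.+1) = false by rewrite ltn_eqF.
have w12 : (w.+1 == w.+2) = false by rewrite ltn_eqF.
have s4w : s4 w = encode x.
  by rewrite /s4 /update w2n fr2 // /s2 /update wz w1n.
have s4w1 : s4 w.+1 = encode (l x).
  by rewrite /s4 /update w12 fr2 ?/s2 /update /= ?eqxx //; lia.
have s4w2 : s4 w.+2 = encode (fold x [::]) by rewrite /s4 /update eqxx.
have [t3 [s5 [e3 v3 fr3 l3]]] :=
  loop_runs wwg w0 rg (hK x) (erefl : l x = [::] ++ l x) s4w s4w1 s4w2.
exists (2 + (t1 + (2 + (2 + (t2 + (2 + (t3 + 2))))))).
exists (update s5 0 (encode (fold x (l x)))); split => //.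
- apply: ExecSeq; first exact: ExecAssign.
  rewrite /= hx; apply: ExecSeq e1 _.
  apply: ExecSeq; first exact: ExecAssign.
  rewrite /= v1; apply: ExecSeq; first exact: ExecAssign.
  rewrite /= update_neq ?w1n // s1w; apply: ExecSeq e2 _.
  apply: ExecSeq; first exact: ExecAssign.
  rewrite /= v2; apply: ExecSeq e3 _.
  rewrite -v3; exact: ExecAssign.
- move=> y wy; rewrite /update gtn_eqF; last by lia.
  rewrite fr3 // /s4 /update gtn_eqF // fr2; last by lia.
  rewrite /s2 /update gtn_eqF; last by lia.
  rewrite gtn_eqF; last by lia.
  rewrite fr1; last by lia.
  by rewrite /update gtn_eqF //; lia.
have : size (l x) * (K x + 20) <= sz (l x) * (K x + 20).
  by rewrite leq_mul2r ltnW ?orbT // size_lt_sz.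
by move: l1 l2 l3; lia.
Qed.

End Fold.

Section Foldl.

Variables (X A B : encType) (l : X -> seq A) (i : X -> B).
Variable g : X -> A -> B -> B.

(** An increment that does not depend on the accumulator merely adds up over the list, which gives
    the bound on all prefixes. *)
Lemma ptime_foldl :
  ptime l -> ptime i -> ptime (fun y : X * (A * B) => g y.1 y.2.1 y.2.2) ->
  (exists2 D : X * A -> nat, pb D &
    forall x a b, sz (g x a b) <= sz b + D (x, a)) ->
  ptime (fun x => foldl (fun b a => g x a b) (i x) (l x)).
Proof.
move=> hl hi hg [D [a0 [k0 hD]] gD]; apply: ptime_foldl_gen => //.
pose d x := a0 * (sz x + sz (l x) + 1) ^ k0.
exists (fun x => sz (i x) + sz (l x) * d x).
  apply: pb_add; first exact: hi.1.
  apply: pb_mul; first exact: hl.1.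
  apply: pb_mul; first exact: pb_const.
  apply: pb_exp; apply: pb_add; last exact: pb_const.
  by apply: pb_add; [exact: pb_sz | exact: hl.1].
move=> x s1 s2 hlx; suff: sz (foldl (fun b a => g x a b) (i x) s1)
    <= sz (i x) + size s1 * d x.
  have : size s1 * d x <= sz (l x) * d x.
    rewrite leq_mul2r; apply/orP; right; apply: leq_trans (ltnW (size_lt_sz _)).
    by rewrite hlx size_cat leq_addr.
  by lia.
elim/last_ind: s1 s2 hlx => [|s1 a IH] s2 hlx; first by rewrite /= addn0.
rewrite foldl_rcons size_rcons mulSn.
have hlx' : l x = s1 ++ a :: s2 by rewrite hlx cat_rcons.
suff : D (x, a) <= d x by have := gD x a (foldl (fun b a => g x a b) (i x) s1);
  have := IH _ hlx'; lia.
apply: leq_trans (hD _) _; rewrite leq_mul2l; apply/orP; right.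
have : sz (x, a) <= sz x + sz (l x) + 1.
  rewrite sz_pair; have := sz_cat s1 (a :: s2); rewrite -hlx' sz_cons.
  by have := sz_gt0 s1; have := sz_gt0 s2; lia.
by case: (k0) => [|k] //; rewrite leq_exp2r.
Qed.

End Foldl.

(** * Polynomial-time operations on pairs, booleans, lists and unary numbers *)

Section Basics.

Variables (X A B : encType).

Lemma ptime_comp_expr (Y Z : encType) (f : X -> Y) (g : Y -> Z) (e : expr) :
  ptime f -> (forall y s, s 0 = encode y -> Defs.eval e s = encode (g y)) ->
  (forall y, sz (g y) <= sz y + 3) -> ptime (fun x => g (f x)).
Proof.
move=> hf he hs; apply: (ptime_comp hf); apply: ptime_expr he.
by apply: pb_le (pb_add pb_sz (pb_const 3)).
Qed.

Lemma ptime_fst (f : X -> A * B) : ptime f -> ptime (fun x => (f x).1).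
Proof.
move=> hf; apply: (ptime_comp_expr (g := fun y => y.1) (e := EHd (EVar 0)) hf).
  by move=> [a b] s /= ->.
by move=> [a b] /=; rewrite sz_pair; lia.
Qed.

Lemma ptime_snd (f : X -> A * B) : ptime f -> ptime (fun x => (f x).2).
Proof.
move=> hf; apply: (ptime_comp_expr (g := fun y => y.2) (e := ETl (EVar 0)) hf).
  by move=> [a b] s /= ->.
by move=> [a b] /=; rewrite sz_pair; lia.
Qed.

Lemma ptime_cons (f : X -> A) (g : X -> seq A) :
  ptime f -> ptime g -> ptime (fun x => f x :: g x).
Proof.
move=> hf hg; have := ptime_pair hf hg.
move=> /(ptime_comp_expr (g := fun y => y.1 :: y.2) (e := EVar 0)); apply.
  by move=> [a b] s /= ->.
by move=> [a b] /=; rewrite sz_pair sz_cons; lia.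
Qed.

Lemma ptime_succ (f : X -> nat) : ptime f -> ptime (fun x => (f x).+1).
Proof.
move=> hf; apply: (ptime_comp_expr (g := succn) (e := ECons ENil (EVar 0)) hf).
  by move=> m s /= ->.
by move=> m; rewrite !sz_nat; lia.
Qed.

Lemma ptime_pred (f : X -> nat) : ptime f -> ptime (fun x => (f x).-1).
Proof.
move=> hf; apply: (ptime_comp_expr (g := predn) (e := ETl (EVar 0)) hf).
  by move=> [|m] s /= ->.
by move=> m; rewrite !sz_nat; lia.
Qed.

Lemma ptime_behead (f : X -> seq A) : ptime f -> ptime (fun x => behead (f x)).
Proof.
move=> hf; apply: (ptime_comp_expr (g := behead) (e := ETl (EVar 0)) hf).
  by move=> [|m l] s /= ->.
by move=> [|a l] //=; rewrite sz_cons; lia.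
Qed.

Lemma ptime_head0 (f : X -> seq nat) : ptime f -> ptime (fun x => head 0 (f x)).
Proof.
move=> hf; apply: (ptime_comp_expr (g := head 0) (e := EHd (EVar 0)) hf).
  by move=> [|m l] s /= ->.
by move=> [|a l] //=; rewrite sz_cons; lia.
Qed.

(** A unary number and the list of that many [tt] are encoded by the same tree, so a counter can
    drive a loop without conversion. *)
Lemma ptime_nseq (f : X -> nat) : ptime f -> ptime (fun x => nseq (f x) tt).
Proof.
have enc m : encode (nseq m tt) = encode m by elim: m => //= m ->.
move=> hf; apply: (ptime_comp_expr (g := nseq^~ tt) (e := EVar 0) hf).
  by move=> m s /= ->; rewrite enc.
by move=> m /=; rewrite /sz enc leq_addr.
Qed.

Lemma ptime_neg (b : X -> bool) : ptime b -> ptime (fun x => ~~ b x).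
Proof.
move=> hb; apply: ptime_ext (ptime_if hb (ptime_const false) (ptime_const true)).
by move=> x; case: (b x).
Qed.

Lemma ptime_and (b c : X -> bool) :
  ptime b -> ptime c -> ptime (fun x => b x && c x).
Proof.
move=> hb hc; apply: ptime_ext (ptime_if hb hc (ptime_const false)).
by move=> x; case: (b x).
Qed.

Lemma ptime_or (b c : X -> bool) :
  ptime b -> ptime c -> ptime (fun x => b x || c x).
Proof.
move=> hb hc; apply: ptime_ext (ptime_if hb (ptime_const true) hc).
by move=> x; case: (b x).
Qed.

Lemma ptime_nilp (f : X -> seq A) : ptime f -> ptime (fun x => nilp (f x)).
Proof.
move=> hf; apply: (ptime_comp hf); split.
  by apply: pb_le (pb_const 3) => x; exact: sz_bool.
exists (CIf (EVar 0) (CAssign 0 ENil) (CAssign 0 (ECons ENil ENil))), 1,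
  (fun=> 6); split => //; first exact: pb_const.
move=> [|a l] s hs.
  exists 6, (update s 0 (Defs.Cons Defs.Nil Defs.Nil)); split => //.
    by apply: (@ExecIfFalse _ _ _ _ _ 4); [rewrite /= hs | exact: ExecAssign].
  by case.
exists 4, (update s 0 Defs.Nil); split => //; last by case.
by apply: (@ExecIfTrue _ _ _ _ _ 2); [rewrite /= hs | exact: ExecAssign].
Qed.

End Basics.

Lemma ptime_eq0 (X : encType) (f : X -> nat) :
  ptime f -> ptime (fun x => f x == 0).
Proof.
move=> hf; apply: ptime_ext (ptime_nilp (ptime_nseq hf)) => x.
by rewrite /nilp size_nseq.
Qed.

Section Lists.

Variables (X A B : encType).

Lemma ptime_rev (f : X -> seq A) : ptime f -> ptime (fun x => rev (f x)).
Proof.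
move=> hf; apply: (@ptime_ext _ _ (fun x => foldl (fun b a => a :: b) [::] (f x))).
  by move=> x; rewrite -{1}[f x]revK foldl_rev; elim: (rev _) => //= a s ->.
apply: ptime_foldl => //; first exact: ptime_const.
  apply: ptime_cons; first by apply: ptime_fst; apply: ptime_snd; apply: ptime_id.
  by do 2!apply: ptime_snd; apply: ptime_id.
exists (fun y => sz y); first exact: pb_sz.
by move=> x a b; rewrite sz_pair sz_cons; lia.
Qed.

Lemma ptime_foldr (l : X -> seq A) (i : X -> B) (g : X -> A -> B -> B) :
  ptime l -> ptime i -> ptime (fun y : X * (A * B) => g y.1 y.2.1 y.2.2) ->
  (exists2 D : X * A -> nat, pb D &
    forall x a b, sz (g x a b) <= sz b + D (x, a)) ->
  ptime (fun x => foldr (g x) (i x) (l x)).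
Proof.
move=> hl hi hg hD.
apply: ptime_ext (ptime_foldl (ptime_rev hl) hi hg hD) => x.
by rewrite foldl_rev.
Qed.

End Lists.

Section ListFunctions.

Variables (X A B : encType).

Lemma ptime_map (f : X -> A -> B) (l : X -> seq A) :
  ptime (fun y : X * A => f y.1 y.2) -> ptime l ->
  ptime (fun x => [seq f x a | a <- l x]).
Proof.
move=> hf hl.
apply: (@ptime_ext _ _ (fun x => foldr (fun a b => f x a :: b) [::] (l x))).
  by move=> x; elim: (l x) => //= a s ->.
apply: ptime_foldr => //; first exact: ptime_const.
  apply: ptime_cons; last by do 2!apply: ptime_snd; apply: ptime_id.
  apply: (@ptime_comp _ _ _ (fun y => (y.1, y.2.1)) (fun y => f y.1 y.2)) => //.
  apply: ptime_pair; first by apply: ptime_fst; apply: ptime_id.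
  by apply: ptime_fst; apply: ptime_snd; apply: ptime_id.
exists (fun y => sz (f y.1 y.2) + 1).
  by apply: pb_add; [exact: hf.1 | exact: pb_const].
by move=> x a b; rewrite sz_cons /=; lia.
Qed.

Lemma ptime_filter (p : X -> A -> bool) (l : X -> seq A) :
  ptime (fun y : X * A => p y.1 y.2) -> ptime l ->
  ptime (fun x => [seq a <- l x | p x a]).
Proof.
move=> hp hl.
apply: (@ptime_ext _ _ (fun x =>
    foldr (fun a b => if p x a then a :: b else b) [::] (l x))) => //.
apply: ptime_foldr => //; first exact: ptime_const.
  apply: ptime_if.
  - apply: (@ptime_comp _ _ _ (fun y => (y.1, y.2.1)) (fun y => p y.1 y.2)) => //.
    apply: ptime_pair; first by apply: ptime_fst; apply: ptime_id.
    by apply: ptime_fst; apply: ptime_snd; apply: ptime_id.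
  - apply: ptime_cons; last by do 2!apply: ptime_snd; apply: ptime_id.
    by apply: ptime_fst; apply: ptime_snd; apply: ptime_id.
  - by do 2!apply: ptime_snd; apply: ptime_id.
exists (fun y => sz y); first exact: pb_sz.
by move=> x a b; rewrite sz_pair; case: (p x a); rewrite ?sz_cons; lia.
Qed.

Lemma ptime_count (p : X -> A -> bool) (l : X -> seq A) :
  ptime (fun y : X * A => p y.1 y.2) -> ptime l ->
  ptime (fun x => count (p x) (l x)).
Proof.
move=> hp hl.
apply: (@ptime_ext _ _ (fun x =>
    foldr (fun a b => if p x a then b.+1 else b) 0 (l x))).
  by move=> x; elim: (l x) => //= a s ->; case: (p x a).
apply: ptime_foldr => //; first exact: ptime_const.
  apply: ptime_if.
  - apply: (@ptime_comp _ _ _ (fun y => (y.1, y.2.1)) (fun y => p y.1 y.2)) => //.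
    apply: ptime_pair; first by apply: ptime_fst; apply: ptime_id.
    by apply: ptime_fst; apply: ptime_snd; apply: ptime_id.
  - by apply: ptime_succ; do 2!apply: ptime_snd; apply: ptime_id.
  - by do 2!apply: ptime_snd; apply: ptime_id.
exists (fun=> 2); first exact: pb_const.
by move=> x a b; rewrite !sz_nat; case: (p x a); lia.
Qed.

End ListFunctions.

Lemma ptime_cat (X A : encType) (f g : X -> seq A) :
  ptime f -> ptime g -> ptime (fun x => f x ++ g x).
Proof.
move=> hf hg.
apply: (@ptime_ext _ _ (fun x => foldr (fun a b => a :: b) (g x) (f x))).
  by move=> x; elim: (f x) => //= a s ->.
apply: ptime_foldr => //.
  apply: ptime_cons; last by do 2!apply: ptime_snd; apply: ptime_id.
  by apply: ptime_fst; apply: ptime_snd; apply: ptime_id.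
exists (fun y => sz y); first exact: pb_sz.
by move=> x a b; rewrite sz_pair sz_cons; lia.
Qed.

Lemma ptime_size (X A : encType) (f : X -> seq A) : ptime f -> ptime (fun x => size (f x)).
Proof.
move=> hf; apply: (@ptime_ext _ _ (fun x => count predT (f x))).
  by move=> x; rewrite count_predT.
by apply: ptime_count => //; exact: ptime_const.
Qed.

Lemma ptime_iter (X B : encType) (n : X -> nat) (g : X -> B -> B) (i : X -> B) :
  ptime n -> ptime (fun y : X * B => g y.1 y.2) -> ptime i ->
  (exists2 D : X -> nat, pb D & forall x b, sz (g x b) <= sz b + D x) ->
  ptime (fun x => iter (n x) (g x) (i x)).
Proof.
move=> hn hg hi [D hD gD].
apply: (@ptime_ext _ _ (fun x =>
    foldr (fun _ b => g x b) (i x) (nseq (n x) tt))).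
  by move=> x; elim: (n x) => //= m ->.
apply: ptime_foldr => //; first exact: ptime_nseq.
  apply: (@ptime_comp _ _ _ (fun y => (y.1, y.2.2)) (fun y => g y.1 y.2)) => //.
  apply: ptime_pair; first by apply: ptime_fst; apply: ptime_id.
  by do 2!apply: ptime_snd; apply: ptime_id.
exists (fun y => D y.1); last by [].
by apply: pb_ptime hD; apply: ptime_fst; apply: ptime_id.
Qed.

Lemma ptime_has (X A : encType) (p : X -> A -> bool) (l : X -> seq A) :
  ptime (fun y : X * A => p y.1 y.2) -> ptime l ->
  ptime (fun x => has (p x) (l x)).
Proof.
move=> hp hl; apply: ptime_ext (ptime_neg (ptime_eq0 (ptime_count hp hl))) => x.
by rewrite has_count lt0n.
Qed.

Lemma ptime_flatmap (X A B : encType) (f : X -> A -> seq B) (l : X -> seq A) :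
  ptime (fun y : X * A => f y.1 y.2) -> ptime l ->
  ptime (fun x => flatten [seq f x a | a <- l x]).
Proof.
move=> hf hl.
apply: (@ptime_ext _ _ (fun x => foldr (fun a b => f x a ++ b) [::] (l x))).
  by move=> x; elim: (l x) => //= a s ->.
apply: ptime_foldr => //; first exact: ptime_const.
  apply: ptime_cat; last by do 2!apply: ptime_snd; apply: ptime_id.
  apply: (@ptime_comp _ _ _ (fun y => (y.1, y.2.1)) (fun y => f y.1 y.2)) => //.
  apply: ptime_pair; first by apply: ptime_fst; apply: ptime_id.
  by apply: ptime_fst; apply: ptime_snd; apply: ptime_id.
exists (fun y => sz (f y.1 y.2)); first exact: hf.1.
by move=> x a b /=; have := sz_cat (f x a) b; lia.
Qed.

Section Arithmetic.

Variables (X A : encType).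

Lemma ptime_subn (f g : X -> nat) :
  ptime f -> ptime g -> ptime (fun x => f x - g x).
Proof.
move=> hf hg; apply: (@ptime_ext _ _ (fun x => iter (g x) predn (f x))).
  by move=> x; elim: (g x) => [|m IH] /=; rewrite ?subn0 // IH subnS.
apply: ptime_iter => //; first by apply: ptime_pred; apply: ptime_snd; apply: ptime_id.
by exists (fun=> 0) => [|_ b]; [exact: pb_const | rewrite !sz_nat; lia].
Qed.

Lemma ptime_addn (f g : X -> nat) :
  ptime f -> ptime g -> ptime (fun x => f x + g x).
Proof.
move=> hf hg; apply: (@ptime_ext _ _ (fun x => iter (g x) succn (f x))).
  by move=> x; rewrite iter_succn addnC.
apply: ptime_iter => //; first by apply: ptime_succ; apply: ptime_snd; apply: ptime_id.
by exists (fun=> 2) => [|_ b]; [exact: pb_const | rewrite !sz_nat; lia].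
Qed.

Lemma ptime_leq (f g : X -> nat) :
  ptime f -> ptime g -> ptime (fun x => f x <= g x).
Proof. by move=> hf hg; apply: ptime_eq0; apply: ptime_subn. Qed.

Lemma ptime_eqn (f g : X -> nat) :
  ptime f -> ptime g -> ptime (fun x => f x == g x).
Proof.
move=> hf hg.
apply: ptime_ext (ptime_and (ptime_leq hf hg) (ptime_leq hg hf)) => x.
by rewrite eqn_leq.
Qed.

Lemma ptime_drop (f : X -> nat) (l : X -> seq A) :
  ptime f -> ptime l -> ptime (fun x => drop (f x) (l x)).
Proof.
move=> hf hl; apply: (@ptime_ext _ _ (fun x => iter (f x) behead (l x))).
  move=> x; elim: (f x) => [|m IH] /=; first by rewrite drop0.
  by rewrite IH -!drop1 drop_drop add1n.
apply: ptime_iter => //; first by apply: ptime_behead; apply: ptime_snd; apply: ptime_id.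
exists (fun=> 0); first exact: pb_const.
by move=> _ [|a s] //; rewrite sz_cons /=; lia.
Qed.

(** Each round prepends the current length, so the growth depends on the accumulator and
    [ptime_foldl] does not apply. A quadratic bound on the size of all prefixes takes its place. *)
Lemma ptime_iota0 (f : X -> nat) : ptime f -> ptime (fun x => iota 0 (f x)).
Proof.
move=> hf.
apply: (@ptime_ext _ _ (fun x => rev (iter (f x) (fun s => size s :: s) [::]))).
  move=> x; suff h : iter (f x) (fun s => size s :: s) [::] = rev (iota 0 (f x)).
    by rewrite h revK.
  elim: (f x) => // m IH.
  by rewrite iterS IH -[in RHS]addn1 iotaD rev_cat size_rev size_iota.
apply: ptime_rev.
pose g (_ : X) (s : seq nat) := size s :: s.
have hg : ptime (fun y : X * seq nat => g y.1 y.2).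
  apply: ptime_cons; last by apply: ptime_snd; apply: ptime_id.
  by apply: ptime_size; apply: ptime_snd; apply: ptime_id.
apply: (@ptime_ext _ _ (fun x => foldl (fun b _ => g x b) [::] (nseq (f x) tt))).
  by move=> x; elim: (f x) [::] => // m IH s; rewrite iterSr -IH.
apply: (@ptime_foldl_gen _ _ _ _ _ (fun x _ b => g x b)).
- exact: ptime_nseq.
- exact: ptime_const.
- apply: (@ptime_comp _ _ _ (fun y => (y.1, y.2.2)) (fun y => g y.1 y.2)) => //.
  apply: ptime_pair; first by apply: ptime_fst; apply: ptime_id.
  by do 2!apply: ptime_snd; apply: ptime_id.
exists (fun x => (sz (f x) + 2) * (sz (f x) + 2)).
  by apply: pb_mul; apply: pb_add; rewrite ?hf.1 //; try exact: pb_const; exact: hf.1.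
move=> x s1 s2 hs; have hN : (size s1).*2 <= sz (f x).
  have := size_nseq (f x) tt; rewrite hs size_cat sz_nat => <-.
  by rewrite doubleD; apply: leqW; exact: leq_addr.
suff [h1 h2] : size (foldl (fun b _ => g x b) [::] s1) = size s1 /\
    sz (foldl (fun b _ => g x b) [::] s1) <= 1 + size s1 * (size s1).*2.+2.
  apply: leq_trans h2 _; move: hN; rewrite -mul2n; move: (sz _) => N; move: (size s1) => k; nia.
elim/last_ind: s1 {hs hN} => [|s1 a [IH1 IH2]]; first by split.
have gE b : g x b = size b :: b by [].
rewrite foldl_rcons size_rcons gE; split; first by rewrite /= IH1.
rewrite sz_cons IH1 sz_nat -!mul2n.
apply: (@leq_trans (2 * size s1 + 2 + (1 + size s1 * (size s1).*2.+2))).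
  by move: IH2; rewrite -!mul2n; lia.
by rewrite -!mul2n; nia.
Qed.

End Arithmetic.

Section Slices.

Variables (X A : encType).

Lemma ptime_take (f : X -> nat) (l : X -> seq A) :
  ptime f -> ptime l -> ptime (fun x => take (f x) (l x)).
Proof.
move=> hf hl.
apply: (@ptime_ext _ _ (fun x => rev (drop (size (l x) - f x) (rev (l x))))).
  by move=> x; rewrite -{3}[l x]revK take_rev size_rev.
apply: ptime_rev; apply: ptime_drop; last exact: ptime_rev.
by apply: ptime_subn => //; exact: ptime_size.
Qed.

Lemma ptime_rot (f : X -> nat) (l : X -> seq A) :
  ptime f -> ptime l -> ptime (fun x => rot (f x) (l x)).
Proof. by move=> hf hl; apply: ptime_cat; [apply: ptime_drop | apply: ptime_take]. Qed.

Lemma ptime_last0 (l : X -> seq nat) : ptime l -> ptime (fun x => last 0 (l x)).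
Proof.
move=> hl; apply: ptime_ext (ptime_head0 (ptime_rev hl)) => x.
by case/lastP: (l x) => // s a; rewrite rev_rcons last_rcons.
Qed.

End Slices.

(** * Maker's strategy *)

Definition mke (u v : nat) : nat * nat := if u <= v then (u, v) else (v, u).

Definition gap (mk : seq (nat * nat)) (u v : nat) : bool := mke u v \notin mk.

Definition cdeg (cl : seq (nat * nat)) (u : nat) : nat :=
  count (fun e => (e.1 == u) || (e.2 == u)) cl.

Definition rots (c : seq nat) : seq (seq nat) :=
  [seq rot i c | i <- iota 0 (size c)].

Definition views (c : seq nat) : seq (seq nat) := rots c ++ rots (rev c).

(** A candidate [(A, B)] is the current cycle [A ++ B], read from some vertex in
    some direction and cut in two. With [x = last B], [x' = head A], [v = last A]
    and [z = head B], Maker claims [xv] and passes to the cycle [rev A ++ B]: the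
    pairs [(x, x')] and [(v, z)] are replaced by [(x, v)] and [(x', z)]. *)
Notation cand := (seq nat * seq nat)%type.

Definition cands (c : seq nat) : seq cand :=
  flatten [seq [seq (take j.+1 L, drop j.+1 L) | j <- iota 0 (size L).-1]
          | L <- views c].

Definition feas (mk cl : seq (nat * nat)) (k : cand) : bool :=
  gap mk (last 0 k.2) (head 0 k.1) && (mke (last 0 k.2) (last 0 k.1) \notin cl).

(** The move closes a gap. *)
Definition prog (mk : seq (nat * nat)) (k : cand) : bool :=
  gap mk (last 0 k.1) (head 0 k.2) || ~~ gap mk (head 0 k.1) (head 0 k.2).

(** Degrees below [n / 25] all count as 0, so that ends below the threshold tie and the next digit
    of the score, [prog], decides. *)
Definition danger (n : nat) (cl : seq (nat * nat)) (u : nat) : nat :=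
  if n <= 25 * cdeg cl u then cdeg cl u else 0.

(** Half the threshold of [danger]: a low vertex that becomes a gap end is not counted by [hdeg] and
    has weight at most [lam ^+ cutoff] in [Phi]. *)
Definition low (n : nat) (cl : seq (nat * nat)) (u : nat) : bool :=
  50 * cdeg cl u < n.

(** Since [views] reads the cycle in both directions, each gap is met twice, once with each of its
    ends in last position. *)
Definition blocked (mk cl : seq (nat * nat)) (c : seq nat) (z : nat) : nat :=
  count (fun L => gap mk (last 0 L) (head 0 L) && (mke z (last 0 L) \in cl))
    (views c).

(** The lexicographic order on (danger, prog, low, - blocked), as [blocked] is at
    most [2 n]. *)
Definition score (n : nat) (cl mk : seq (nat * nat)) (c : seq nat) (k : cand) :
    nat :=
  ((danger n cl (last 0 k.2) * 2 + prog mk k) * 2 + low n cl (head 0 k.2))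
     * (2 * n + 1) + (2 * n - blocked mk cl c (head 0 k.2)).

(** Both parts of a candidate are nonempty, so the pair of empty lists can stand for the absence of
    a candidate. *)
Definition best (n : nat) (cl mk : seq (nat * nat)) (c : seq nat) : cand :=
  foldl (fun b k =>
      if nilp b.1 || (score n cl mk c b <= score n cl mk c k) then k else b)
    ([::], [::]) [seq k <- cands c | feas mk cl k].

Definition all_edges (n : nat) : seq (nat * nat) :=
  flatten [seq [seq (i, j) | j <- [seq j <- iota 0 n | i < j]] | i <- iota 0 n].

(** The fallback keeps the strategy legal in every position, for instance after Maker has won; the
    default [(0, 0)] does not occur while an edge is unclaimed. *)
Definition maker_move (n : nat) (cl mk : seq (nat * nat)) (c : seq nat) : nat * nat :=
  let k := best n cl mk c in
  if nilp k.1 then last (0, 0) [seq e <- all_edges n | e \notin cl]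
  else mke (last 0 k.2) (last 0 k.1).

Definition new_cycle (n : nat) (cl mk : seq (nat * nat)) (c : seq nat) :
    seq nat :=
  let k := best n cl mk c in if nilp k.1 then c else rev k.1 ++ k.2.

Notation gstate := (seq (nat * nat) * seq (nat * nat) * seq nat)%type.

Definition turn (n : nat) (s : gstate) (x : bool * (nat * nat)) : gstate :=
  (x.2 :: s.1.1, if x.1 then x.2 :: s.1.2 else s.1.2,
   if x.1 then new_cycle n s.1.1 s.1.2 s.2 else s.2).

(** A strategy sees only the history, so the cycle is recomputed at every move. It remains a
    permutation of the vertices even if the recorded Maker edges are not those of the strategy. *)
Definition replay (n : nat) (h : seq (bool * (nat * nat))) : gstate :=
  foldl (turn n) ([::], [::], iota 0 n) h.

Definition answer (x : nat * seq (bool * seq nat)) : seq nat :=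
  let s := replay x.1
    [seq (y.1, (head 0 y.2, head 0 (behead y.2))) | y <- x.2] in
  let e := maker_move x.1 s.1.1 s.1.2 s.2 in [:: e.1; e.2].

(** * The strategy is computable in polynomial time *)

Lemma ptime_mem (X : encType) (f : X -> nat * nat) (l : X -> seq (nat * nat)) :
  ptime f -> ptime l -> ptime (fun x => f x \in l x).
Proof.
move=> hf hl; apply: (@ptime_ext _ _ (fun x =>
    has (fun e => ((f x).1 == e.1) && ((f x).2 == e.2)) (l x))).
  move=> x; rewrite -has_pred1; apply: eq_has => -[a b] /=.
  by case: (f x) => u v; rewrite [RHS]eq_sym.
apply: ptime_has => //.
have h1 : ptime (fun y : X * (nat * nat) => f y.1).
  by apply: (ptime_comp (ptime_fst ptime_id) _).
apply: ptime_and; apply: ptime_eqn.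
- exact: ptime_fst.
- by apply: ptime_fst; apply: ptime_snd; apply: ptime_id.
- exact: ptime_snd.
- by apply: ptime_snd; apply: ptime_snd; apply: ptime_id.
Qed.

Lemma ptime_nat_of_bool (X : encType) (b : X -> bool) :
  ptime b -> ptime (fun x => nat_of_bool (b x)).
Proof.
move=> hb; apply: ptime_ext (ptime_if hb (ptime_const 1) (ptime_const 0)) => x.
by case: (b x).
Qed.

Lemma ptime_muln (X : encType) (f g : X -> nat) :
  ptime f -> ptime g -> ptime (fun x => f x * g x).
Proof.
move=> hf hg; apply: (@ptime_ext _ _ (fun x => iter (f x) (addn (g x)) 0)).
  by move=> x; rewrite iter_addn addn0 mulnC.
apply: ptime_iter => //; last 2 first.
- exact: ptime_const.
- exists (fun x => sz (g x)); first exact: hg.1.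
  by move=> x b; rewrite !sz_nat; lia.
apply: ptime_addn; last by apply: ptime_snd; apply: ptime_id.
by apply: (ptime_comp (ptime_fst ptime_id) _).
Qed.

Ltac pt_rule :=
  cbv beta;
  lazymatch goal with
  | |- ptime (fun x => x) => exact: ptime_id
  | |- ptime (fun _ => ?c) => exact: ptime_const
  | |- ptime (fun x => @?f x \in @?g x) => apply: ptime_mem
  | |- ptime (fun x => ~~ (@?f x)) => apply: ptime_neg
  | |- ptime (fun x => @?f x && @?g x) => apply: ptime_and
  | |- ptime (fun x => @?f x || @?g x) => apply: ptime_or
  | |- ptime (fun x => @?f x <= @?g x) => apply: ptime_leq
  | |- ptime (fun x => @?f x == @?g x) => apply: ptime_eqn
  | |- ptime (fun x => nilp (@?f x)) => apply: ptime_nilp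
  | |- ptime (fun x => nat_of_bool (@?f x)) => apply: ptime_nat_of_bool
  | |- ptime (fun x => (@?f x).+1) => apply: ptime_succ
  | |- ptime (fun x => (@?f x).-1) => apply: ptime_pred
  | |- ptime (fun x => @?f x + @?g x) => apply: ptime_addn
  | |- ptime (fun x => @?f x * @?g x) => apply: ptime_muln
  | |- ptime (fun x => @?f x - @?g x) => apply: ptime_subn
  | |- ptime (fun x => last 0 (@?f x)) => apply: ptime_last0
  | |- ptime (fun x => head 0 (@?f x)) => apply: ptime_head0
  | |- ptime (fun x => rot (@?f x) (@?g x)) => apply: ptime_rot
  | |- ptime (fun x => take (@?f x) (@?g x)) => apply: ptime_take
  | |- ptime (fun x => drop (@?f x) (@?g x)) => apply: ptime_drop
  | |- ptime (fun x => iota 0 (@?f x)) => apply: ptime_iota0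
  | |- ptime (fun x => @?f x ++ @?g x) => apply: ptime_cat
  | |- ptime (fun x => rev (@?f x)) => apply: ptime_rev
  | |- ptime (fun x => size (@?f x)) => apply: ptime_size
  | |- ptime (fun x => behead (@?f x)) => apply: ptime_behead
  | |- ptime (fun x => seq.filter (@?p x) (@?l x)) => apply: ptime_filter
  | |- ptime (fun x => flatten (map (@?p x) (@?l x))) => apply: ptime_flatmap
  | |- ptime (fun x => map (@?p x) (@?l x)) => apply: ptime_map
  | |- ptime (fun x => count (@?p x) (@?l x)) => apply: ptime_count
  | |- ptime (fun x => @?f x :: @?g x) => apply: ptime_cons
  | |- ptime (fun x => (@?f x, @?g x)) => apply: ptime_pair
  | |- ptime (fun x => (@?f x).1) => apply: ptime_fst
  | |- ptime (fun x => (@?f x).2) => apply: ptime_snd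
  | |- _ => apply: ptime_if
  end.
Ltac pt1 :=
  first [assumption | pt_rule
  | lazymatch goal with |- @ptime ?X ?Y ?f =>
      change (@ptime X Y (fun x => f x)); pt_rule end].
Ltac pt := repeat pt1.

Lemma ptime_gap (X : encType) (mk : X -> seq (nat * nat)) (f g : X -> nat) :
  ptime mk -> ptime f -> ptime g -> ptime (fun x => gap (mk x) (f x) (g x)).
Proof. by move=> *; rewrite /gap; pt. Qed.

Lemma ptime_uncurry2 (A B C : encType) (F : A -> B -> C) :
  ptime (fun x => F x.1 x.2) -> forall (X : encType) f g,
  ptime f -> ptime g -> ptime (fun x : X => F (f x) (g x)).
Proof. by move=> hF X f g hf hg; apply: (ptime_comp (ptime_pair hf hg) hF). Qed.

Lemma ptime_cdeg (X : encType) (cl : X -> seq (nat * nat)) (u : X -> nat) :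
  ptime cl -> ptime u -> ptime (fun x => cdeg (cl x) (u x)).
Proof.
move: X cl u; apply: ptime_uncurry2; rewrite /cdeg; pt.
Qed.

Lemma ptime_views (X : encType) (c : X -> seq nat) :
  ptime c -> ptime (fun x => views (c x)).
Proof.
move=> hc; apply: (ptime_comp hc (g := views)); rewrite /views /rots; pt.
Qed.

Lemma ptime_cands (X : encType) (c : X -> seq nat) :
  ptime c -> ptime (fun x => cands (c x)).
Proof.
move=> hc; apply: (ptime_comp hc (g := cands)); rewrite /cands.
apply: ptime_flatmap; last exact: ptime_views ptime_id.
by pt.
Qed.

Lemma ptime_danger (X : encType) (n : X -> nat) (cl : X -> seq (nat * nat))
    (u : X -> nat) :
  ptime n -> ptime cl -> ptime u -> ptime (fun x => danger (n x) (cl x) (u x)).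
Proof.
move=> hn hcl hu; have hd := ptime_cdeg hcl hu.
by rewrite /danger; pt.
Qed.

Lemma ptime_low (X : encType) (n : X -> nat) (cl : X -> seq (nat * nat))
    (u : X -> nat) :
  ptime n -> ptime cl -> ptime u -> ptime (fun x => low (n x) (cl x) (u x)).
Proof.
move=> hn hcl hu; have hd := ptime_cdeg hcl hu.
by rewrite /low; pt.
Qed.

Lemma ptime_blocked (X : encType) (mk cl : X -> seq (nat * nat))
    (c : X -> seq nat) (z : X -> nat) :
  ptime mk -> ptime cl -> ptime c -> ptime z ->
  ptime (fun x => blocked (mk x) (cl x) (c x) (z x)).
Proof.
move=> hmk hcl hc hz.
apply: (ptime_comp (ptime_pair (ptime_pair hmk hcl) (ptime_pair hc hz))
  (g := fun y => blocked y.1.1 y.1.2 y.2.1 y.2.2)).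
rewrite /blocked; apply: ptime_count; last by apply: ptime_views; pt.
apply: ptime_and; last by pt.
by apply: ptime_gap; pt.
Qed.

Lemma ptime_prog (X : encType) (mk : X -> seq (nat * nat)) (k : X -> cand) :
  ptime mk -> ptime k -> ptime (fun x => prog (mk x) (k x)).
Proof.
move=> hmk hk; rewrite /prog; apply: ptime_or; [|apply: ptime_neg];
  by apply: ptime_gap; pt.
Qed.

Lemma ptime_feas (X : encType) (mk cl : X -> seq (nat * nat)) (k : X -> cand) :
  ptime mk -> ptime cl -> ptime k -> ptime (fun x => feas (mk x) (cl x) (k x)).
Proof.
move=> hmk hcl hk; rewrite /feas; apply: ptime_and; last by pt.
by apply: ptime_gap; pt.
Qed.

Lemma ptime_score (X : encType) (n : X -> nat) (cl mk : X -> seq (nat * nat))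
    (c : X -> seq nat) (k : X -> cand) :
  ptime n -> ptime cl -> ptime mk -> ptime c -> ptime k ->
  ptime (fun x => score (n x) (cl x) (mk x) (c x) (k x)).
Proof.
move=> hn hcl hmk hc hk.
have hx : ptime (fun x => last 0 (k x).2) by pt.
have hz : ptime (fun x => head 0 (k x).2) by pt.
have hd := ptime_danger hn hcl hx; have hl := ptime_low hn hcl hz.
have hp := ptime_prog hmk hk; have hb := ptime_blocked hmk hcl hc hz.
by rewrite /score; pt.
Qed.

Lemma pb_snd (X A : encType) : pb (fun y : X * A => sz y.2).
Proof. by apply: pb_le pb_sz => -[x a]; rewrite sz_pair /=; lia. Qed.

Lemma ptime_best (X : encType) (n : X -> nat) (cl mk : X -> seq (nat * nat))
    (c : X -> seq nat) :
  ptime n -> ptime cl -> ptime mk -> ptime c ->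
  ptime (fun x => best (n x) (cl x) (mk x) (c x)).
Proof.
move=> hn hcl hmk hc.
apply: (ptime_comp (ptime_pair (ptime_pair hn hcl) (ptime_pair hmk hc))
  (g := fun y => best y.1.1 y.1.2 y.2.1 y.2.2)).
rewrite /best; apply: ptime_foldl.
- apply: ptime_filter; last by apply: ptime_cands; pt.
  by apply: ptime_feas; pt.
- exact: ptime_const.
- apply: ptime_if; [apply: ptime_or; first by pt | by pt..].
  by apply: ptime_leq; apply: ptime_score; pt.
- exists (fun y => sz y.2); first exact: pb_snd.
  by move=> x a b; case: ifP => _ /=; lia.
Qed.

Lemma ptime_all_edges (X : encType) (n : X -> nat) :
  ptime n -> ptime (fun x => all_edges (n x)).
Proof. by move=> hn; apply: (ptime_comp hn (g := all_edges)); rewrite /all_edges; pt. Qed.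

Lemma ptime_last (X A : encType) (d : A) (l : X -> seq A) :
  ptime l -> ptime (fun x => last d (l x)).
Proof.
move=> hl; apply: (@ptime_ext _ _ (fun x => foldl (fun _ a => a) d (l x))).
  by move=> x; elim: (l x) d => //=.
apply: ptime_foldl => //; [exact: ptime_const | by pt |].
exists (fun y => sz y.2); first exact: pb_snd.
by move=> x a b /=; lia.
Qed.

Lemma ptime_maker_move (X : encType) (n : X -> nat) (cl mk : X -> seq (nat * nat))
    (c : X -> seq nat) :
  ptime n -> ptime cl -> ptime mk -> ptime c ->
  ptime (fun x => maker_move (n x) (cl x) (mk x) (c x)).
Proof.
move=> hn hcl hmk hc; have hb := ptime_best hn hcl hmk hc.
have he := ptime_all_edges hn.
apply: ptime_if; [by pt | | by pt].
apply: ptime_last; apply: ptime_filter => //.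
by apply: ptime_neg; apply: ptime_mem; [by pt | apply: (ptime_comp (ptime_fst ptime_id))].
Qed.

Lemma ptime_new_cycle (X : encType) (n : X -> nat)
    (cl mk : X -> seq (nat * nat)) (c : X -> seq nat) :
  ptime n -> ptime cl -> ptime mk -> ptime c ->
  ptime (fun x => new_cycle (n x) (cl x) (mk x) (c x)).
Proof.
move=> hn hcl hmk hc; have hb := ptime_best hn hcl hmk hc.
by apply: ptime_if; pt.
Qed.

(** * Candidates and the maximality of the chosen one *)

Lemma candsP (c : seq nat) (k : cand) :
  reflect (exists2 L, L \in views c &
     [/\ k.1 != [::], k.2 != [::] & k.1 ++ k.2 = L]) (k \in cands c).
Proof.
apply: (iffP flatten_mapP) => [[L hL /mapP[j]]|[L hL [h1 h2 e]]].
  rewrite mem_iota add0n => /andP[_ hj] ->; exists L => //; split => /=.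
  - by rewrite -size_eq0 size_take; case: ifP => // _; apply: contraTneq hj => ->.
  - by rewrite -size_eq0 size_drop subn_eq0 -ltnNge -ltn_predRL.
  - exact: cat_take_drop.
exists L => //; apply/mapP; exists (size k.1).-1.
  rewrite mem_iota -e size_cat add0n; move: h1 h2; rewrite -!size_eq0 /=.
  by move: (size k.1) (size k.2) => u v; lia.
rewrite prednK -?e ?take_size_cat ?drop_size_cat //; first by case: k {h1 h2 e}.
by case: k.1 h1.
Qed.

Lemma mem_views (c L : seq nat) :
  L \in views c -> perm_eq L c.
Proof.
rewrite mem_cat => /orP[] /mapP[i _ ->].
  by rewrite perm_rot.
by rewrite perm_rot perm_rev.
Qed.

Lemma perm_cands (c : seq nat) (k : cand) :
  k \in cands c -> perm_eq (rev k.1 ++ k.2) c.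
Proof.
case/candsP => L /mem_views hL [_ _ e]; apply: perm_trans hL.
by rewrite -e perm_cat2r perm_rev.
Qed.

Lemma best_spec (n : nat) (cl mk : seq (nat * nat)) (c : seq nat) :
  let b := best n cl mk c in
  (nilp b.1 -> forall k, k \in cands c -> ~~ feas mk cl k) /\
  (~~ nilp b.1 -> [/\ b \in cands c, feas mk cl b &
    forall k, k \in cands c -> feas mk cl k ->
      score n cl mk c k <= score n cl mk c b]).
Proof.
set sc := score n cl mk c => /=; rewrite /best -/sc.
have h k : k \in [seq k <- cands c | feas mk cl k] -> ~~ nilp k.1.
  by rewrite mem_filter => /andP[_ /candsP[L _ [+ _ _]]]; case: k.1.
set s := [seq k <- cands c | feas mk cl k] in h *.
suff [h1 h2] : let b := foldl (fun b k =>
    if nilp b.1 || (sc b <= sc k) then k else b) ([::], [::]) s in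
    (nilp b.1 -> s = [::]) /\ (~~ nilp b.1 ->
    b \in s /\ forall k, k \in s -> sc k <= sc b).
  split => [/h1 s0 k hk|/h2 [bs hs]].
    apply/negP => fk; suff : k \in s by rewrite s0.
    by rewrite mem_filter fk.
  have := bs; rewrite mem_filter => /andP[fb cb]; split => // k ck fk.
  by apply: hs; rewrite mem_filter fk.
elim/last_ind: s h => [|s a IH] h //=.
have [|{}IH1 IH2] := IH; first by move=> k ks; apply: h; rewrite mem_rcons inE ks orbT.
rewrite foldl_rcons; set b := foldl _ _ s in IH1 IH2 *.
have ha : ~~ nilp a.1 by apply: h; rewrite mem_rcons inE eqxx.
case: ifP => [|/norP[nb lt]]; last first.
  have [bs hs] := IH2 nb; split; first by rewrite (negPf nb).
  move=> _; rewrite mem_rcons inE bs orbT; split => // k.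
  rewrite mem_rcons inE => /orP[/eqP->|]; last exact: hs.
  by apply: ltnW; rewrite ltnNge.
move=> hb; split; first by rewrite (negPf ha).
move=> _; rewrite mem_rcons inE eqxx; split => // k.
rewrite mem_rcons inE => /orP[/eqP-> //|ks].
have [nb|nb] := boolP (nilp b.1); first by move: ks; rewrite IH1.
have [_ /(_ _ ks) /leq_trans] := IH2 nb; apply.
by move: hb; rewrite (negPf nb).
Qed.

Lemma perm_new_cycle (n : nat) (cl mk : seq (nat * nat)) (c : seq nat) :
  perm_eq (new_cycle n cl mk c) c.
Proof.
rewrite /new_cycle; case: ifPn => // /(best_spec n cl mk c).2 [h _ _].
exact: perm_cands.
Qed.

(** Makes the growth in [ptime_replay] additive: the cycle is only permuted, so only the two edge
    lists grow. *)
Lemma sz_perm (c d : seq nat) : perm_eq c d -> sz c = sz d.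
Proof.
have e s : sz s = (\sum_(a <- s) (sz a).+1).+1.
  elim: s => [|a s IH]; first by rewrite big_nil.
  by rewrite sz_cons big_cons IH; lia.
by move=> h; rewrite !e (perm_big d).
Qed.

Lemma ptime_replay (X : encType) (n : X -> nat)
    (h : X -> seq (bool * (nat * nat))) :
  ptime n -> ptime h -> ptime (fun x => replay (n x) (h x)).
Proof.
move=> hn hh; apply: (ptime_foldl (g := fun x a s => turn (n x) s a)) => //.
- by pt.
- have hn' : ptime (fun y : X * (bool * (nat * nat) * gstate) => n y.1).
    by apply: (ptime_comp (ptime_fst ptime_id)).
  rewrite /turn; apply: ptime_pair; first by pt.
  apply: ptime_if; [by pt | | by pt].
  by apply: ptime_new_cycle; pt.
exists (fun y => sz y + sz y); first by apply: pb_add; exact: pb_sz.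
move=> x [b e] [[cl mk] c]; rewrite /turn /= !sz_pair.
have -> : sz (if b then new_cycle (n x) cl mk c else c) = sz c.
  by case: b => //; apply: sz_perm; exact: perm_new_cycle.
by case: b; rewrite !sz_cons; lia.
Qed.

Lemma ptime_answer : ptime answer.
Proof.
set h := fun x : nat * seq (bool * seq nat) =>
  [seq (y.1, (head 0 y.2, head 0 (behead y.2))) | y <- x.2].
have hh : ptime h by rewrite /h; pt.
have hr : ptime (fun x => replay x.1 (h x)) by apply: ptime_replay => //; pt.
have hm : ptime (fun x : nat * seq (bool * seq nat) =>
    let s := replay x.1 (h x) in maker_move x.1 s.1.1 s.1.2 s.2).
  by apply: ptime_maker_move; pt.
rewrite /answer; apply: ptime_cons; [exact: (ptime_fst hm) |].
by apply: ptime_cons; [exact: (ptime_snd hm) | exact: ptime_const].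
Qed.

(** * Two-opt moves *)

Section Cycles.

Implicit Types (e : nat * nat) (cl mk : seq (nat * nat)) (c L : seq nat) (a b u v x z n : nat).

(** Each consecutive pair of the closed cycle is the last and first entry of exactly one rotation,
    so a term of the sum belongs to an element of [views]. *)
Definition csum (g : nat -> nat -> nat) (c : seq nat) : nat :=
  \sum_(L <- rots c) g (last 0 L) (head 0 L).

Fixpoint psum (g : nat -> nat -> nat) (a : nat) (s : seq nat) : nat :=
  if s is b :: s' then g a b + psum g b s' else 0.

Lemma psum_nth g a s :
  psum g a s = \sum_(0 <= i < size s) g (nth 0 (a :: s) i) (nth 0 s i).
Proof.
elim: s a => [|b s IH] a /=; first by rewrite big_nil.
by rewrite big_nat_recl //= IH.
Qed.

Lemma psum_cat g a s b t :
  psum g a (s ++ b :: t) = psum g a s + g (last a s) b + psum g b t.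
Proof. by elim: s a => [|d s IH] a //=; rewrite IH !addnA. Qed.

Lemma rots_head_last c i : i.+1 < size c ->
  last 0 (rot i.+1 c) = nth 0 c i /\ head 0 (rot i.+1 c) = nth 0 c i.+1.
Proof.
move=> hi; rewrite /rot; split; last by rewrite (drop_nth 0).
by rewrite last_cat -nth_last (set_nth_default 0) ?size_take ?hi //= nth_take.
Qed.

Lemma csum_cons g a s : csum g (a :: s) = psum g a s + g (last a s) a.
Proof.
rewrite /csum /rots big_map [size _]/= -[iota 0 _]/(0 :: iota 1 (size s)) big_cons rot0 [LHS]addnC /=; congr addn.
have -> : iota 1 (size s) = index_iota 1 (size s).+1 by rewrite /index_iota subn1.
rewrite big_add1 psum_nth; apply: eq_big_nat => i /andP[_ hi].
by have [-> ->] := @rots_head_last (a :: s) i hi.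
Qed.

Definition pathsum (g : nat -> nat -> nat) (s : seq nat) : nat :=
  if s is a :: s' then psum g a s' else 0.

Lemma pathsum_cat g s t : s != [::] -> t != [::] ->
  pathsum g (s ++ t) = pathsum g s + g (last 0 s) (head 0 t) + pathsum g t.
Proof. by case: s t => [|a s] [|b t] //= _ _; rewrite psum_cat. Qed.

Lemma csumE g c : c != [::] ->
  csum g c = pathsum g c + g (last 0 c) (head 0 c).
Proof. by case: c => // a s _; rewrite csum_cons. Qed.

Lemma last_rev (s : seq nat) : last 0 (rev s) = head 0 s.
Proof. by case: s => // a s; rewrite rev_cons last_rcons. Qed.

Lemma head_rev (s : seq nat) : head 0 (rev s) = last 0 s.
Proof. by rewrite -last_rev revK. Qed.

Lemma rev_neq0 (s : seq nat) : (rev s != [::]) = (s != [::]).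
Proof. by rewrite -!size_eq0 size_rev. Qed.

Lemma pathsum_rev g s : pathsum g (rev s) = pathsum (fun a b => g b a) s.
Proof.
elim: s => // a s IH; case: (eqVneq s [::]) => [->//|s0].
rewrite rev_cons -cats1 pathsum_cat ?rev_neq0 // IH last_rev /=.
by case: s s0 {IH} => //= b s _; rewrite addn0 addnC.
Qed.

Lemma csum_rev g c : csum g (rev c) = csum (fun a b => g b a) c.
Proof.
case: (eqVneq c [::]) => [->|c0]; first by rewrite /csum !big_nil.
by rewrite !csumE ?rev_neq0 // pathsum_rev last_rev head_rev.
Qed.

Lemma csum_cat g s t : s != [::] -> t != [::] ->
  csum g (s ++ t) = pathsum g s + g (last 0 s) (head 0 t) + pathsum g t
                    + g (last 0 t) (head 0 s).
Proof.
move=> s0 t0; rewrite csumE; last by case: s s0.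
by rewrite pathsum_cat // last_cat; case: s t s0 t0 => [|a s] [|b t].
Qed.

Lemma csum_rot g i c : csum g (rot i c) = csum g c.
Proof.
rewrite /rot; case: (eqVneq (take i c) [::]) => [e|t0].
  by rewrite -[in RHS](cat_take_drop i c) e cats0.
case: (eqVneq (drop i c) [::]) => [e|d0].
  by rewrite -[in RHS](cat_take_drop i c) e cats0.
by rewrite csum_cat // -[in RHS](cat_take_drop i c) csum_cat //; lia.
Qed.

Definition sym2 (g : nat -> nat -> nat) := forall a b, g a b = g b a.

Lemma eq_csum g h c : (forall a b, g a b = h a b) -> csum g c = csum h c.
Proof. by move=> e; apply: eq_bigr => L _; apply: e. Qed.

Lemma csum_views g c L : sym2 g -> L \in views c -> csum g L = csum g c.
Proof.
move=> gC; rewrite mem_cat => /orP[] /mapP[i _ ->]; rewrite csum_rot //.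
by rewrite csum_rev; apply: eq_csum => a b; apply: gC.
Qed.

Lemma leq_csum g h c : (forall a b, g a b <= h a b) -> csum g c <= csum h c.
Proof. by move=> e; apply: leq_sum => L _; apply: e. Qed.

Lemma leq_pathsum g h s : (forall a b, g a b <= h a b) ->
  pathsum g s <= pathsum h s.
Proof.
move=> e; case: s => // a s /=; elim: s a => //= b s IH a.
exact: leq_add.
Qed.

(** The effect of a 2-opt step on a sum over the edges of the cycle; [h] may be
    smaller than [g] because Maker has gained an edge meanwhile. *)
Lemma csum_two_opt g h c (k : cand) :
  sym2 g -> sym2 h -> (forall a b, h a b <= g a b) -> k \in cands c ->
  h (last 0 k.2) (last 0 k.1) = 0 ->
  csum h (rev k.1 ++ k.2) + g (last 0 k.1) (head 0 k.2)
    + g (last 0 k.2) (head 0 k.1) <= csum g c + g (head 0 k.1) (head 0 k.2).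
Proof.
move=> gC hC hg /candsP[L hL [A0 B0 e]] h0.
rewrite -(csum_views gC hL) -e !csum_cat ?rev_neq0 // head_rev last_rev h0.
rewrite pathsum_rev.
have : pathsum (fun a b => h b a) k.1 <= pathsum g k.1.
  by apply: leq_pathsum => a b; rewrite hC.
have := leq_pathsum k.2 hg; have := hg (head 0 k.1) (head 0 k.2); lia.
Qed.

Lemma rots_heads (c : seq nat) : [seq head 0 L | L <- rots c] = c.
Proof.
rewrite -map_comp -[RHS](mkseq_nth 0) /mkseq; apply/eq_in_map => i.
rewrite mem_iota add0n => /andP[_ hi] /=.
by rewrite /rot (drop_nth 0).
Qed.

Lemma csum_heads (P : nat -> nat) c : csum (fun _ b => P b) c = \sum_(a <- c) P a.
Proof. by rewrite -[in RHS](rots_heads c) big_map. Qed.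

Lemma csum_lasts (P : nat -> nat) c : csum (fun a _ => P a) c = \sum_(a <- c) P a.
Proof. by rewrite -(csum_rev (fun _ b => P b)) csum_heads (perm_big c) ?perm_rev. Qed.

(** * Gaps and their ends *)

Lemma mkeC u v : mke u v = mke v u.
Proof. by rewrite /mke; case: (ltngtP u v) => // ->. Qed.

Lemma gapC mk u v : gap mk u v = gap mk v u.
Proof. by rewrite /gap mkeC. Qed.

Definition gaps (mk : seq (nat * nat)) (c : seq nat) : nat :=
  csum (fun a b => gap mk a b) c.

(** The number of cycle edges at [u] that Maker still lacks. *)
Definition need (mk : seq (nat * nat)) (c : seq nat) (u : nat) : nat :=
  csum (fun a b => gap mk a b * ((a == u) + (b == u))) c.

Lemma sum_need mk c n f : perm_eq c (iota 0 n) ->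
  \sum_(u <- iota 0 n) need mk c u * f u =
    csum (fun a b => gap mk a b * (f a + f b)) c.
Proof.
move=> pc; rewrite /need /csum.
under eq_bigr => u _ do rewrite big_distrl /=.
rewrite exchange_big /=; apply: eq_big_seq => L hL.
have {hL} hL : {subset L <= iota 0 n} /\ L != [::].
  case/mapP: hL => i hi ->; split; last first.
    by rewrite -size_eq0 size_rot; move: hi; rewrite mem_iota; case: size.
  by move=> u; rewrite mem_rot (perm_mem pc).
have h a : a \in L -> \sum_(u <- iota 0 n) (a == u) * f u = f a.
  move=> /(hL.1) ai; rewrite (bigD1_seq a) ?iota_uniq //= eqxx mul1n.
  by rewrite big1 ?addn0 // => u; rewrite eq_sym => /negPf ->.
have hl : last 0 L \in L by case: L hL {h} => [[]|a L _] //=; rewrite mem_last.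
have hh : head 0 L \in L by case: L hL {h hl} => [[]|a L _] //=; rewrite mem_head.
rewrite -(h _ hl) -(h _ hh) -big_split big_distrr /=.
by apply: eq_bigr => u _; rewrite -mulnA mulnDl.
Qed.

Lemma gaps_need mk c n : perm_eq c (iota 0 n) ->
  \sum_(u <- iota 0 n) need mk c u = 2 * gaps mk c.
Proof.
move=> pc; have := sum_need mk (fun=> 1) pc.
under eq_bigr do rewrite muln1.
move=> ->; rewrite /gaps /csum big_distrr /=.
by apply: eq_bigr => L _; rewrite mulnC.
Qed.

Lemma sum_bool (T : Type) (P : pred T) (s : seq T) :
  \sum_(a <- s) P a = count P s.
Proof. by rewrite -sum1_count [RHS]big_mkcond; apply: eq_bigr => a _; case: (P a). Qed.

Lemma views_neq0 c L : L \in views c -> L != [::].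
Proof.
rewrite mem_cat -size_eq0 => /orP[] /mapP[i hi ->]; rewrite size_rot -lt0n;
  by move: hi; rewrite mem_iota; case: size.
Qed.

Lemma leq_csum_view g c L : sym2 g -> L \in views c ->
  g (last 0 L) (head 0 L) <= csum g c.
Proof.
by move=> gC hL; rewrite -(csum_views gC hL) csumE ?(views_neq0 hL) // leq_addl.
Qed.

Lemma need_sym mk u :
  sym2 (fun a b => gap mk a b * ((a == u) + (b == u))).
Proof. by move=> a b; rewrite gapC addnC. Qed.

Lemma need_le2 mk c u : uniq c -> need mk c u <= 2.
Proof.
move=> uc; have hc : \sum_(a <- c) (a == u) <= 1.
  by rewrite sum_bool count_uniq_mem ?leq_b1.
apply: (@leq_trans (csum (fun a b => (a == u) + (b == u)) c)).
  by apply: leq_csum => a b; rewrite -[leqRHS]mul1n leq_mul2r leq_b1 orbT.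
rewrite /csum big_split /= -/(csum (fun a _ => a == u : nat) c).
rewrite -/(csum (fun _ a => a == u : nat) c) csum_lasts csum_heads.
exact: (leq_add hc).
Qed.

Lemma need_gap mk c L : L \in views c -> gap mk (last 0 L) (head 0 L) ->
  0 < need mk c (last 0 L) /\ 0 < need mk c (head 0 L).
Proof.
move=> hL hg; split; apply: leq_trans (leq_csum_view (need_sym _ _) hL);
  by rewrite hg eqxx; lia.
Qed.

Lemma gaps_gt0 mk c : 0 < gaps mk c ->
  exists2 L, L \in views c & gap mk (last 0 L) (head 0 L).
Proof.
rewrite lt0n sum_nat_seq_neq0 => /hasP[L hL /=]; rewrite eqb0 negbK => hg.
by exists L => //; rewrite mem_cat hL.
Qed.

(** If [u] is the head of its gap, the reversed reading puts it last; this is why [views] contains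
    both directions. *)
Lemma need_gt0 mk c u : 0 < need mk c u ->
  exists L, [/\ L \in views c, gap mk (last 0 L) (head 0 L) & last 0 L = u].
Proof.
rewrite lt0n sum_nat_seq_neq0 => /hasP[L hL /=]; rewrite muln_eq0 eqb0 negb_or negbK.
case/andP=> hg; rewrite addn_eq0 !eqb0 negb_and !negbK => /orP[]/eqP<-.
  by exists L; split => //; rewrite mem_cat hL.
exists (rev L); rewrite last_rev head_rev gapC; split => //.
case/mapP: hL => i; rewrite mem_iota add0n => /andP[_ hi] ->.
rewrite mem_cat; apply/orP; right.
(* The reduction modulo the length serves [i = 0], where rotating by the full length is the identity
   but is not listed in [rots]. *)
rewrite rev_rot /rotr; apply/mapP; exists ((size (rev c) - i) %% size c).
  by rewrite mem_iota add0n !size_rev ltn_mod; move: hi; case: size.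
rewrite !size_rev; case: i hi => [|i] hi; last first.
  by rewrite modn_small // ltn_subrL (leq_trans _ hi).
by rewrite subn0 modnn rot0 -(size_rev c) rot_size.
Qed.

Lemma blockedE mk cl c n z : perm_eq c (iota 0 n) ->
  blocked mk cl c z = \sum_(u <- iota 0 n) need mk c u * (mke z u \in cl).
Proof.
move=> pc; rewrite (sum_need mk (fun u => (mke z u \in cl) : nat) pc).
rewrite /blocked /views count_cat -!sum_bool.
have -> : \sum_(L <- rots (rev c))
    (gap mk (last 0 L) (head 0 L) && (mke z (last 0 L) \in cl)) =
  csum (fun a b => gap mk b a && (mke z b \in cl)) c.
  by rewrite -(csum_rev (fun a b => gap mk a b && (mke z a \in cl) : nat)).
rewrite /csum -big_split /=; apply: eq_bigr => L _.
rewrite [gap mk (head _ _) _]gapC.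
by case: (gap mk _ _); rewrite ?mul1n ?mul0n.
Qed.

Lemma size_rots c : size (rots c) = size c.
Proof. by rewrite size_map size_iota. Qed.

Lemma blocked_le mk cl c z : blocked mk cl c z <= 2 * size c.
Proof.
apply: leq_trans (count_size _ _) _.
by rewrite size_cat !size_rots size_rev; lia.
Qed.

(** Positional notation: [N - b] is at most [N], hence a digit to base [N + 1], and the two booleans
    are digits to base 2. *)
Lemma score_lex (d1 d2 b1 b2 N : nat) (p1 p2 l1 l2 : bool) :
  b1 <= N -> b2 <= N ->
  ((d1 * 2 + p1) * 2 + l1) * (N + 1) + (N - b1) <=
  ((d2 * 2 + p2) * 2 + l2) * (N + 1) + (N - b2) ->
  [/\ d1 <= d2, d1 = d2 -> p1 -> p2,
      d1 = d2 -> p1 = p2 -> l1 -> l2 &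
      d1 = d2 -> p1 = p2 -> l1 = l2 -> b2 <= b1].
Proof.
move=> h1 h2 h.
have : (d1 * 2 + p1) * 2 + l1 <= (d2 * 2 + p2) * 2 + l2.
  rewrite leqNgt; apply/negP => hlt.
  have : ((d2 * 2 + p2) * 2 + l2 + 1) * (N + 1) <= ((d1 * 2 + p1) * 2 + l1) * (N + 1).
    by rewrite leq_mul2r; apply/orP; right; lia.
  by rewrite mulnDl; lia.
move=> h3; split.
- by lia.
- by move=> e; move: h3; rewrite e; case: (p1) (p2) (l1) (l2) => [] [] [] []; lia.
- by move=> e1 e2; move: h3; rewrite e1 e2; case: (l1) (l2) => [] []; lia.
- by move=> e1 e2 e3; move: h; rewrite e1 e2 e3; lia.
Qed.

(** * Averaging over claimed edges, and good rotations *)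

Lemma mke_inj z : injective (mke z).
Proof. by move=> x y; rewrite /mke; case: leqP => ?; case: leqP => ?; case; lia. Qed.

Lemma count_mke cl a n : uniq cl ->
  \sum_(z <- iota 0 n) (mke z a \in cl) <= cdeg cl a.
Proof.
move=> ucl; rewrite sum_bool -size_filter /cdeg -size_filter.
rewrite -(size_map (mke^~ a)); apply: uniq_leq_size.
  rewrite map_inj_uniq ?filter_uniq ?iota_uniq // => x y.
  by rewrite ![mke _ a]mkeC => /mke_inj.
move=> e /mapP[z]; rewrite !mem_filter => /andP[h _] ->; rewrite h andbT.
by rewrite /mke; case: leqP => _; rewrite eqxx ?orbT.
Qed.

Lemma sum_cdeg cl n : \sum_(u <- iota 0 n) cdeg cl u <= 2 * size cl.
Proof.
elim: cl => [|e cl IH]; first by rewrite big1.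
rewrite /cdeg /= big_split /= mulnS; apply: leq_add => //.
have h a : \sum_(u <- iota 0 n) (a == u) <= 1.
  under eq_bigr do rewrite eq_sym.
  by rewrite sum_bool count_uniq_mem ?iota_uniq ?leq_b1.
apply: (@leq_trans (\sum_(u <- iota 0 n) ((e.1 == u) + (e.2 == u)))).
  by apply: leq_sum => u _; case: (_ == u) (_ == u) => [] [].
by rewrite big_split /=; have := h e.1; have := h e.2; lia.
Qed.

Lemma markov_count (T : Type) (f : T -> nat) (s : seq T) (K : nat) :
  count (fun y => K <= f y) s * K <= \sum_(y <- s) f y.
Proof.
elim: s => [|y s IH]; first by rewrite big_nil.
rewrite big_cons /= mulnDl; apply: leq_add => //.
by case: (leqP K (f y)) => h /=; rewrite ?mul1n ?mul0n.
Qed.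

Lemma size_perm_iota c n : perm_eq c (iota 0 n) -> size c = n.
Proof. by move/perm_size; rewrite size_iota. Qed.

(** Each of the three ways in which a rotation at [x] can be bad is an
    averaging argument; together they exclude fewer than [n - 1] positions. *)
Lemma exists_rotation n cl mk c L :
  perm_eq c (iota 0 n) -> uniq cl -> 2 < n -> 0 < gaps mk c ->
  1000 * size cl <= n * n ->
  (forall u, 0 < need mk c u -> 50 * cdeg cl u < 3 * n) ->
  L \in views c -> gap mk (last 0 L) (head 0 L) ->
  exists k : cand, [/\ k \in cands c, k.1 ++ k.2 = L, feas mk cl k,
    low n cl (head 0 k.2) & 4 * blocked mk cl c (head 0 k.2) <= gaps mk c].
Proof.
move=> pc ucl n2 m0 hcl hend hL hg.
have szL : size L = n by rewrite (perm_size (mem_views hL)) (size_perm_iota pc).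
have pL : perm_eq L (iota 0 n) := perm_trans (mem_views hL) pc.
set x := last 0 L in hg *; set m := gaps mk c in m0 *.
pose P1 := [pred v | mke v x \in cl].
pose P2 := [pred z | n <= 50 * cdeg cl z].
pose P3 := [pred z | m.+1 <= 4 * blocked mk cl c z].
(* The three fractions [3 / 50], [1 / 10] and [24 / 50] add up to [32 / 50], and
   [32 * n / 50 <= n - 1] from [n = 3] on. *)
have c1 : 50 * count P1 L < 3 * n.
  apply: leq_ltn_trans (hend x (need_gap hL hg).1); rewrite leq_mul2l /=.
  by rewrite (permP pL) -sum_bool; apply: count_mke.
have c2 : 10 * count P2 L <= n.
  have h : count P2 (iota 0 n) * n <= 50 * \sum_(u <- iota 0 n) cdeg cl u.
    by rewrite big_distrr; apply: markov_count.
  have := sum_cdeg cl n; rewrite (permP pL); move: h; set S := \sum_(_ <- _) _.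
  set q := count _ _ => h h2; have : (10 * q) * n <= n * n.
    rewrite -mulnA. lia.
  by rewrite leq_pmul2r // (ltn_trans _ n2).
have c3 : 50 * count P3 L <= 24 * n.
  have h : count P3 (iota 0 n) * m.+1
      <= 4 * \sum_(z <- iota 0 n) blocked mk cl c z.
    by rewrite big_distrr; apply: markov_count.
  (* Double counting: summed over [z], the blocked ends are the degrees of the gap ends weighted by
     [need], whose total is [2 * m]. *)
  have hb : 50 * \sum_(z <- iota 0 n) blocked mk cl c z <= 2 * m * (3 * n).
    under eq_bigr => z _ do rewrite (blockedE _ _ _ pc).
    rewrite exchange_big /=.
    apply: (@leq_trans (50 * \sum_(u <- iota 0 n) need mk c u * cdeg cl u)).
      rewrite leq_mul2l /=; apply: leq_sum => u _.
      by rewrite -big_distrr leq_mul2l count_mke ?orbT.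
    rewrite -(gaps_need mk pc) big_distrr big_distrl /=.
    apply: leq_sum => u _; case: (posnP (need mk c u)) => [->|/hend h1].
      by rewrite mul0n muln0.
    by rewrite mulnCA leq_mul2l ltnW ?orbT.
  rewrite (permP pL); move: h; set S := \sum_(_ <- _) _ in hb *.
  set q := count _ _ => h; have : 50 * q * m.+1 <= 24 * n * m.+1.
    rewrite -mulnA [24 * n * _]mulnS -[24 * n * m]mulnA; move: hb; rewrite -mulnA mulnCA; lia.
  by rewrite leq_pmul2r.
pose bad := [pred j | P1 (nth 0 L j) || P2 (nth 0 L j.+1) || P3 (nth 0 L j.+1)].
have hbad : count bad (iota 0 n.-1) < n.-1.
  have e1 (P : pred nat) : count (fun j => P (nth 0 L j)) (iota 0 n.-1) <= count P L.
    rewrite -{2}[L](mkseq_nth 0) /mkseq szL count_map.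
    by rewrite -{2}[n](@prednK n) ?(ltn_trans _ n2) // -addn1 iotaD count_cat leq_addr.
  have e2 (P : pred nat) : count (fun j => P (nth 0 L j.+1)) (iota 0 n.-1) <= count P L.
    rewrite -{2}[L](mkseq_nth 0) /mkseq szL count_map.
    rewrite -{2}[n](@prednK n) ?(ltn_trans _ n2) //=.
    by rewrite (iotaDl 1) count_map leq_addl.
  have := e1 P1; have := e2 P2; have := e2 P3.
  have : count bad (iota 0 n.-1) <= count (fun j => P1 (nth 0 L j)) (iota 0 n.-1)
    + count (fun j => P2 (nth 0 L j.+1)) (iota 0 n.-1)
    + count (fun j => P3 (nth 0 L j.+1)) (iota 0 n.-1).
    rewrite -!sum_bool -!big_split /=; apply: leq_sum => j _.
    by case: (mke _ _ \in _) (n <= _) (m < _) => [] [] [].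
  by lia.
have [j hj] : exists2 j, j \in iota 0 n.-1 & ~~ bad j.
  apply/hasP; rewrite has_count; have := count_predC bad (iota 0 n.-1).
  by rewrite size_iota; move: hbad; set u := count _ _; set v := count _ _; lia.
move=> /= /norP[/norP[b1 b2] b3].
have {}hj : j.+1 < n by move: hj; rewrite mem_iota; lia.
exists (take j.+1 L, drop j.+1 L).
have hh : head 0 (drop j.+1 L) = nth 0 L j.+1 by rewrite (drop_nth 0) ?szL.
have hl : last 0 (take j.+1 L) = nth 0 L j.
  by rewrite -nth_last size_take szL hj /= nth_take.
split => /=; rewrite ?hh.
- apply/candsP; exists L => //; split; rewrite ?cat_take_drop //.
    by rewrite -size_eq0 size_take szL hj.
  by rewrite -size_eq0 size_drop szL; lia.
- by rewrite cat_take_drop.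
- rewrite /feas /= hl; have -> : last 0 (drop j.+1 L) = x.
    by rewrite /x -[in RHS](cat_take_drop j.+1 L) last_cat (drop_nth 0) ?szL.
  have -> : head 0 (take j.+1 L) = head 0 L by case: (L).
  by rewrite hg mkeC.
- by rewrite /low ltnNge.
- by rewrite leqNgt.
Qed.

(** * Danger, threats and the properties of Maker's choice *)

Definition dangerous n cl mk c : bool :=
  has (fun L => gap mk (last 0 L) (head 0 L) && (n <= 25 * cdeg cl (last 0 L)))
    (views c).

(** Counted as edges and not as candidates, so that one Breaker turn destroys at most one. *)
Definition threats cl mk c : seq (nat * nat) :=
  undup [seq mke (last 0 k.2) (last 0 k.1)
        | k <- cands c & feas mk cl k && prog mk k].

Definition claim (k : cand) : nat * nat := mke (last 0 k.2) (last 0 k.1).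

Definition flip (k : cand) : seq nat := rev k.1 ++ k.2.

Lemma dangerous0 n cl mk c L : ~~ dangerous n cl mk c ->
  L \in views c -> gap mk (last 0 L) (head 0 L) -> danger n cl (last 0 L) = 0.
Proof.
move=> /hasPn hn hL hg; move: (hn L hL); rewrite hg /= /danger => /negPf.
by move=> ->.
Qed.

(** [exists_rotation] offers a candidate at every gap end, so the best score attains the maximal
    danger. At the end of the chosen candidate it offers a low, rarely blocked one; if the chosen
    one closes no gap, the two tie in danger and [prog], and the last two digits must be at least as
    good. *)
Lemma maker_choice n cl mk c (k := best n cl mk c) :
  perm_eq c (iota 0 n) -> uniq cl -> 2 < n -> 0 < gaps mk c ->
  1000 * size cl <= n * n ->
  (forall u, 0 < need mk c u -> 50 * cdeg cl u < 3 * n) ->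
  [/\ ~~ nilp k.1, k \in cands c & feas mk cl k] /\
  [/\ forall L, L \in views c -> gap mk (last 0 L) (head 0 L) ->
        danger n cl (last 0 L) <= danger n cl (last 0 k.2),
      ~~ dangerous n cl mk c -> threats cl mk c != [::] -> prog mk k &
      ~~ prog mk k ->
        low n cl (head 0 k.2) /\ 4 * blocked mk cl c (head 0 k.2) <= gaps mk c].
Proof.
move=> pc ucl n2 m0 hcl hend.
have rot_ex L := @exists_rotation n cl mk c L pc ucl n2 m0 hcl hend.
have [b1 b2] := best_spec n cl mk c; rewrite -/k in b1 b2.
have kn : ~~ nilp k.1.
  apply/negP => /b1 hn; have [L hL hg] := gaps_gt0 m0.
  by have [k' [ck _ fk _ _]] := rot_ex L hL hg; move: (hn k' ck); rewrite fk.
have [kc kf kmax] := b2 kn.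
have lex k' : k' \in cands c -> feas mk cl k' -> _ :=
  fun h1 h2 => score_lex (N := 2 * n) (leq_trans (blocked_le mk cl c _)
     (eq_leq (congr1 (muln 2) (size_perm_iota pc))))
     (leq_trans (blocked_le mk cl c _)
     (eq_leq (congr1 (muln 2) (size_perm_iota pc)))) (kmax k' h1 h2).
split; split => //.
- move=> L hL hg; have [k' [ck e fk _ _]] := rot_ex L hL hg.
  have -> : last 0 L = last 0 k'.2.
    by case/candsP: ck => _ _ [_ + _]; rewrite -e last_cat; case: k'.2.
  by have [h _ _ _] := lex k' ck fk.
- move=> nd ht; have [k' ck /andP[fk pk]] :
      exists2 k', k' \in cands c & feas mk cl k' && prog mk k'.
    apply/hasP; rewrite has_filter; apply: contra_neq ht => e.
    by rewrite /threats e.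
  have xv k1 : k1 \in cands c -> feas mk cl k1 -> danger n cl (last 0 k1.2) = 0.
    move=> /candsP[L hL [h1 h2 e]] /andP[hg _].
    have := dangerous0 nd hL; rewrite -e last_cat.
    by case: k1 h1 h2 hg {e} => [[|a A] [|b B]] //= _ _ hg; apply.
  by have [_ h _ _] := lex k' ck fk; apply: h => //; rewrite !xv.
move=> np; case/candsP: (kc) => L hL [A0 B0 e].
have hg : gap mk (last 0 L) (head 0 L).
  case/andP: kf => + _; rewrite -e last_cat.
  by case: (k) A0 B0 => [[|a A] [|b B]].
have [k' [ck e' fk lk bk]] := rot_ex L hL hg.
have ex : last 0 k'.2 = last 0 k.2.
  have -> : last 0 k'.2 = last 0 L.
    by case/candsP: ck => _ _ [_ + _]; rewrite -e' last_cat; case: k'.2.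
  by rewrite -e last_cat; case: k.2 B0.
have [_ hp hl hb] := lex k' ck fk; rewrite ex in hp hl hb.
have pp : prog mk k' = prog mk k.
  by move: (hp erefl); rewrite (negPf np); case: (prog mk k') => // /(_ isT).
have ll : low n cl (head 0 k.2) by apply: hl.
split=> //; apply: leq_trans bk; rewrite leq_mul2l /=; apply: hb => //.
by rewrite lk ll.
Qed.

Lemma gap_cons e mk a b : gap (e :: mk) a b -> gap mk a b.
Proof. by rewrite /gap inE negb_or => /andP[]. Qed.

Lemma cdeg_cons cl a b u :
  cdeg (mke a b :: cl) u = ((a == u) || (b == u)) + cdeg cl u.
Proof. by rewrite /cdeg /= /mke; case: ifP => _ //=; rewrite orbC. Qed.

(** Every Maker move at a vertex of degree at least [n / 25] increases this, and
    after [t] turns it is at most [100 t / n]. *)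
Definition hdeg n cl mk c : nat :=
  \sum_(u <- iota 0 n) (n <= 25 * cdeg cl u) * (2 - need mk c u).

Lemma cdeg_mono cl e u : cdeg cl u <= cdeg (e :: cl) u.
Proof. exact: leq_addl. Qed.

Lemma hdeg_cons n cl mk c e : hdeg n cl mk c <= hdeg n (e :: cl) mk c.
Proof.
apply: leq_sum => u _; rewrite leq_mul2r; apply/orP; right.
have h2 := cdeg_mono cl e u; case: (leqP n (25 * cdeg cl u)) => //= h1.
by have -> : n <= 25 * cdeg (e :: cl) u by lia.
Qed.

Lemma threats_cons cl mk c e :
  size (threats cl mk c) <= (size (threats (e :: cl) mk c)).+1.
Proof.
rewrite -/(size (e :: threats (e :: cl) mk c)); apply: uniq_leq_size.
  exact: undup_uniq.
move=> f; rewrite mem_undup inE => /mapP[k0]; rewrite mem_filter -andbA.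
case/and3P=> /andP[f1 f2] f3 f4 fE; case: (eqVneq f e) => //= fe.
rewrite mem_undup; apply/mapP; exists k0 => //; rewrite mem_filter f3 f4 !andbT.
by rewrite /feas f1 inE negb_or f2 andbT -fE.
Qed.

Lemma dangerous_cons n cl mk c e : dangerous n cl mk c -> dangerous n (e :: cl) mk c.
Proof.
case/hasP => L hL /andP[hg hd]; apply/hasP; exists L => //.
by rewrite hg /=; have := cdeg_mono cl e (last 0 L); lia.
Qed.

Lemma mke_neq x v z u : z != x -> z != v -> mke z u != mke x v.
Proof.
move=> zx zv; rewrite /mke; case: leqP => _; case: leqP => _;
  by rewrite xpair_eqE ?(negPf zx) ?(negPf zv) ?andbF.
Qed.

(** * The effect of one 2-opt move *)

Section TwoOpt.

Variables (n : nat) (cl mk : seq (nat * nat)) (c : seq nat) (k : cand).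
Hypotheses (pc : perm_eq c (iota 0 n)) (mk_cl : {subset mk <= cl}).
Hypotheses (kc : k \in cands c) (kf : feas mk cl k).

Let x := last 0 k.2.
Let x' := head 0 k.1.
Let v := last 0 k.1.
Let z := head 0 k.2.
Let mk' := claim k :: mk.

Lemma two_opt_gaps :
  gaps mk' (flip k) + gap mk v z + 1 <= gaps mk c + gap mk x' z.
Proof.
have gx : gap mk x x' by case/andP: kf.
rewrite -[1]/(true : nat) -gx; apply: csum_two_opt => //.
- by move=> a b; rewrite gapC.
- by move=> a b; rewrite gapC.
- by move=> a b; case h: (gap mk' a b) => //; rewrite (gap_cons h).
- by rewrite /gap inE eqxx.
Qed.

Lemma two_opt_need u :
  need mk' (flip k) u + gap mk v z * ((v == u) + (z == u)) + ((x == u) + (x' == u))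
  <= need mk c u + gap mk x' z * ((x' == u) + (z == u)).
Proof.
have gx : gap mk x x' by case/andP: kf.
rewrite -[(x == u) + _]mul1n -[1]/(true : nat) -gx.
have h0 : gap mk' x v = false by rewrite /gap inE eqxx.
apply: (csum_two_opt (g := fun a b => gap mk a b * ((a == u) + (b == u)))
  (h := fun a b => gap mk' a b * ((a == u) + (b == u)))) => //.
- exact: need_sym.
- exact: need_sym.
- move=> a b; rewrite leq_mul2r; case h: (gap mk' a b); last by rewrite orbT.
  by rewrite (gap_cons h) orbT.
- by rewrite h0.
Qed.

Lemma cand_uniq : uniq (k.1 ++ k.2).
Proof.
case/candsP: kc => L hL [_ _ ->].
by rewrite (perm_uniq (perm_trans (mem_views hL) pc)) iota_uniq.
Qed.

Lemma cand_mem : [/\ x \in k.2, z \in k.2, x' \in k.1 & v \in k.1].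
Proof.
rewrite /x /z /x' /v; case/candsP: kc => _ _ [+ + _].
case: (k) => [[|a A] [|b B]] //= _ _.
by split; rewrite ?mem_last ?mem_head.
Qed.

Lemma cand_neq : [/\ x != v, x != x', z != v & z != x'].
Proof.
have [h1 h2 h3 h4] := cand_mem.
have := cand_uniq; rewrite cat_uniq => /and3P[_ /hasPn hn _].
have h y w : y \in k.2 -> w \in k.1 -> y != w.
  by move=> hy hw; apply: contraNneq (hn _ hy) => ->.
by split; apply: h.
Qed.

Lemma cand_lt : x < n /\ v < n.
Proof.
have [h1 _ _ h4] := cand_mem; case/candsP: kc => L hL [_ _ e].
have h y : y \in k.1 ++ k.2 -> y < n.
  rewrite e (perm_mem (perm_trans (mem_views hL) pc)) mem_iota.
  by case/andP.
by split; apply: h; rewrite mem_cat ?h1 ?h4 ?orbT.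
Qed.

Lemma prog_gaps : prog mk k -> gaps mk' (flip k) < gaps mk c.
Proof.
clear pc mk_cl.
have := two_opt_gaps; rewrite /prog -/v -/z -/x'.
by case: (gap mk v z) (gap mk x' z) => [] [] //=; lia.
Qed.

Lemma gaps_flip : gaps mk' (flip k) <= gaps mk c.
Proof.
clear pc mk_cl.
by have := two_opt_gaps; case: (gap mk v z) (gap mk x' z) => [] []; lia.
Qed.

Lemma prog_need u : prog mk k -> need mk' (flip k) u <= need mk c u.
Proof.
clear pc mk_cl.
have := two_opt_need u; rewrite /prog -/v -/z -/x'.
by case: (gap mk v z) (gap mk x' z) => [] [] //=; lia.
Qed.

Lemma nonprog_need u : ~~ prog mk k ->
  need mk' (flip k) u <= need mk c u + (z == u).
Proof.
clear pc mk_cl.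
have := two_opt_need u; rewrite /prog -/v -/z -/x'.
by case: (gap mk v z) (gap mk x' z) => [] [] //=; lia.
Qed.

(** If [z] were [x], the pair [(v, z)] would be the edge that Maker is about to claim; it would be
    his already, as the move closes no gap, yet unclaimed by feasibility. *)
Lemma nonprog_neq : ~~ prog mk k -> z != x.
Proof.
rewrite /prog -/v -/z negb_or => /andP[+ _]; apply: contra => /eqP ->.
rewrite /gap; apply/negP => /mk_cl; rewrite mkeC => h.
by case/andP: kf => _; rewrite h.
Qed.

Lemma need_flip_x : need mk' (flip k) x < need mk c x.
Proof.
have h := two_opt_need x; have [_ xx' _ _] := cand_neq.
rewrite eqxx [x' == x]eq_sym (negPf xx') in h.
case: (boolP (prog mk k)) => [|np]; last first.
  by move: h; rewrite (negPf (nonprog_neq np)) !addn0 muln0 addn1; lia.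
move: h; rewrite /prog -/v -/z -/x'.
by case: (gap mk v z) (gap mk x' z) => [] [] //=; lia.
Qed.

(** Only the new end [z] of a rotation can gain a gap, and it is low, hence not counted by [hdeg];
    on the other hand [x] loses a gap. *)
Lemma hdeg_flip : prog mk k || low n cl z ->
  hdeg n cl mk c + (n <= 25 * cdeg cl x) <=
    hdeg n (claim k :: cl) mk' (flip k).
Proof.
move=> pl; have [xn _] := cand_lt.
have -> : (n <= 25 * cdeg cl x : nat) =
    \sum_(u <- iota 0 n) (n <= 25 * cdeg cl x) * (u == x).
  rewrite -big_distrr /= sum_bool (count_uniq_mem x (iota_uniq 0 n)).
  by rewrite mem_iota xn muln1.
rewrite -big_split /=; apply: leq_sum => u _.
have := cdeg_mono cl (claim k) u; set d := cdeg cl u; set d' := cdeg _ u => dd.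
have uc : uniq c by rewrite (perm_uniq pc) iota_uniq.
have nu := need_le2 mk u uc.
case: (leqP n (25 * d)) => hd /=; last first.
  rewrite mul0n add0n; case: eqVneq => [e|_]; last by rewrite muln0.
  by rewrite -e -/d [n <= 25 * d]leqNgt hd.
have -> : n <= 25 * d' by lia.
rewrite !mul1n; case: (eqVneq u x) => [e|ux].
  by move: need_flip_x nu; rewrite e; case: (n <= _); lia.
rewrite muln0 addn0; apply: leq_sub2l.
have [p|np] := boolP (prog mk k); first exact: prog_need.
have := nonprog_need u np; case: eqVneq => [e|_]; last by rewrite addn0.
by move: pl hd; rewrite (negPf np) /= /low /d e; lia.
Qed.

(** This reading of the new cycle begins at [x'] and ends at [z], so it is cut at the new pair
    [(x', z)]. *)
Lemma flip_view : k.1 ++ rev k.2 \in views (flip k).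
Proof.
rewrite /views mem_cat; apply/orP; right; rewrite /rots.
have -> : rev (flip k) = rev k.2 ++ k.1 by rewrite /flip rev_cat revK.
apply/mapP; exists (size (rev k.2)); last by rewrite rot_size_cat.
rewrite mem_iota size_cat size_rev add0n /=.
by case/candsP: kc => _ _ [+ _ _]; case: (k.1) => //= a A _; lia.
Qed.

(** After a rotation every other gap, and the new gap itself, offers Maker an
    edge at the fresh end [z]; only the blocked ones are lost. *)
Lemma threats_flip : ~~ prog mk k ->
  maxn 1 (gaps mk' (flip k)).-1 <=
    size (threats (claim k :: cl) mk' (flip k)) + blocked mk cl c z.
Proof.
move=> np; set m' := gaps mk' (flip k).
pose L := k.1 ++ rev k.2.
have hL : L \in views (flip k) := flip_view.
have [A0 B0] : k.1 != [::] /\ k.2 != [::] by case/candsP: kc => L0 _ [].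
have lL : last 0 L = z.
  by rewrite /L /z last_cat; case: (k.2) B0 => // b B _; rewrite rev_cons last_rcons.
have hhL : head 0 L = x' by rewrite /L /x'; case: (k.1) A0.
have pf : perm_eq (flip k) (iota 0 n) := perm_trans (perm_cands kc) pc.
have pL : perm_eq L (iota 0 n) := perm_trans (mem_views hL) pf.
have szL : size L = n := size_perm_iota pL.
have uL : uniq L by rewrite (perm_uniq pL) iota_uniq.
have n2 : 1 < n.
  rewrite -szL size_cat size_rev; case: (k.1) (k.2) A0 B0 => [|? ?] [|? ?] //= _ _.
  by rewrite addnS.
have [h1 h2 h3 h4] := cand_neq.
have zx := nonprog_neq np.
(* Index 0 stands for the edge [z x'], which closes the new gap itself and provides a threat even
   when no other gap is left. The gaps along the path number at least [m' - 1], as only the pair at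
   the cut is left out. *)
pose I := [seq i <- iota 0 n.-1 | (i == 0) || gap mk' (nth 0 L i) (nth 0 L i.+1)].
pose S := [seq nth 0 L i | i <- I].
have hI i : i \in I -> i.+1 < n.
  by rewrite mem_filter mem_iota add0n ltn_predRL => /andP[_].
have uS : uniq S.
  rewrite map_inj_in_uniq ?filter_uniq ?iota_uniq // => i j /hI hi /hI hj e.
  by apply/eqP; rewrite -(nth_uniq 0 _ _ uL) ?szL ?e ?(ltnW hi) ?(ltnW hj).
have sS : maxn 1 m'.-1 <= size S.
  rewrite size_map geq_max; apply/andP; split.
    apply: (@leq_trans (size [:: 0])) => //; apply: uniq_leq_size => // i.
    by rewrite inE => /eqP->; rewrite mem_filter mem_iota add0n ltn_predRL.
  have -> : m' = csum (fun a b => gap mk' a b : nat) L.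
    by rewrite /m' /gaps (csum_views _ hL) // => a b; rewrite gapC.
  rewrite csumE ?(views_neq0 hL) //.
  have -> : pathsum (fun a b => gap mk' a b : nat) L =
      count (fun i => gap mk' (nth 0 L i) (nth 0 L i.+1)) (iota 0 n.-1).
    rewrite -sum_bool; case: (L) szL => [|a s] /= sz.
      by rewrite -sz big_nil.
    by rewrite psum_nth -sz /= /index_iota subn0.
  have : count (fun i => gap mk' (nth 0 L i) (nth 0 L i.+1)) (iota 0 n.-1) <= size I.
    by rewrite size_filter; apply: sub_count => i /= ->; rewrite orbT.
  by move=> hc; rewrite -subn1 leq_subLR addnC; apply: leq_add; rewrite ?leq_b1.
have Sneed w : w \in S -> [/\ 0 < need mk c w, w != z & w < n].
  case/mapP=> i iI ->; have hi := hI _ iI.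
  have wz : nth 0 L i != z.
    rewrite -lL -nth_last nth_uniq ?szL ?(ltnW hi) ?ltn_predL ?(ltnW n2) //.
    by rewrite ltn_eqF // ltn_predRL.
  have wn : nth 0 L i < n.
    have : nth 0 L i \in L by rewrite mem_nth // szL ltnW.
    by rewrite (perm_mem pL) mem_iota => /andP[].
  split=> //; move: iI; rewrite mem_filter => /andP[/orP[/eqP ->|hg] _].
    rewrite nth0 hhL; have := two_opt_need x'.
    case/candsP: (kc) => L0 hL0 [_ _ e].
    have := @need_gap mk c L0 hL0; rewrite -e last_cat.
    have -> : last (last 0 k.1) k.2 = x by rewrite /x; case: (k.2) B0.
    have -> : head 0 (k.1 ++ k.2) = x' by rewrite /x'; case: (k.1) A0.
    by case/andP: kf => hg _ /(_ hg) [].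
  have := nonprog_need (nth 0 L i) np; rewrite eq_sym (negPf wz) addn0.
  apply: leq_trans.
  suff : 0 < need mk' L (nth 0 L i).
    by rewrite /need (csum_views _ hL) //; apply: need_sym.
  have hr : rot i.+1 L \in views L.
    by rewrite mem_cat; apply/orP; left; apply/mapP; exists i.+1;
       rewrite ?mem_iota ?szL.
  have [e1 e2] := @rots_head_last L i (leq_trans hi (eq_leq (esym szL))).
  by have := need_gap (mk := mk') hr; rewrite e1 e2 => /(_ hg) [].
pose bl := [pred w | mke z w \in cl].
have hbl : count bl S <= blocked mk cl c z.
  rewrite (blockedE _ _ _ pc).
  apply: (@leq_trans (\sum_(u <- S) need mk c u * (mke z u \in cl))).
    rewrite -sum_bool [leqLHS]big_seq [leqRHS]big_seq; apply: leq_sum => w /Sneed[nw _ _].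
    by rewrite /=; case: (_ \in cl); rewrite ?muln0 ?muln1.
  have -> : \sum_(u <- iota 0 n) need mk c u * (mke z u \in cl) =
      \sum_(u <- S ++ [seq u <- iota 0 n | u \notin S]) need mk c u * (mke z u \in cl).
    apply: perm_big; apply: uniq_perm; rewrite ?iota_uniq //.
      rewrite cat_uniq uS filter_uniq ?iota_uniq // andbT.
      by apply/hasPn => w; rewrite mem_filter => /andP[].
    move=> w; rewrite mem_cat mem_filter mem_iota /=.
    by case: (boolP (w \in S)) => // /Sneed [_ _ ->].
  by rewrite big_cat leq_addr.
have hth : size [seq w <- S | ~~ bl w] <= size (threats (claim k :: cl) mk' (flip k)).
  rewrite -(size_map (mke z)); apply: uniq_leq_size.
    by rewrite (map_inj_uniq (@mke_inj z)) filter_uniq.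
  move=> f /mapP[w]; rewrite mem_filter => /andP[/= nb /mapP[i iI wE]] ->.
  have hi := hI _ iI; have [_ wz _] := Sneed _ (map_f _ iI); rewrite -wE in wz.
  rewrite mem_undup; apply/mapP; exists (take i.+1 L, drop i.+1 L); last first.
    rewrite /= wE; congr mke; last by rewrite -nth_last size_take szL hi /= nth_take.
    by rewrite -lL -[in LHS](cat_take_drop i.+1 L) last_cat (drop_nth 0) ?szL.
  rewrite mem_filter; apply/andP; split; last first.
    apply/candsP; exists L => //; split; rewrite ?cat_take_drop //.
      by rewrite -size_eq0 size_take szL hi.
    by rewrite -size_eq0 size_drop szL subn_eq0 -ltnNge.
  have e1 : last 0 (take i.+1 L) = w by rewrite -nth_last size_take szL hi /= nth_take.
  have e2 : head 0 (drop i.+1 L) = nth 0 L i.+1 by rewrite (drop_nth 0) ?szL.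
  have e3 : last 0 (drop i.+1 L) = z.
    by rewrite -lL -[in RHS](cat_take_drop i.+1 L) last_cat (drop_nth 0) ?szL.
  have e4 : head 0 (take i.+1 L) = x' by rewrite -hhL; case: (L).
  rewrite /feas /prog /= e1 e2 e3 e4.
  have gzx : gap mk' z x'.
    have : gap mk x' z by move: np; rewrite /prog negb_or negbK => /andP[].
    by rewrite gapC /gap inE negb_or => ->; rewrite andbT mke_neq.
  rewrite gzx inE negb_or nb andbT /=.
  apply/andP; split.
    exact: mke_neq.
  move: iI; rewrite mem_filter => /andP[/orP[/eqP i0|hg] _].
    (* At index 0 the first part of the candidate is the single vertex [x'], so the two alternatives
       of [prog] concern the same pair and one of them holds. *)
    rewrite i0 wE i0 nth0 hhL; case: (gap mk' x' _) => //.
  by rewrite wE hg.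
apply: leq_trans sS _; rewrite -(count_predC bl S) addnC; apply: leq_add => //.
by rewrite -size_filter.
Qed.

End TwoOpt.

End Cycles.

(** * The potential *)

Local Open Scope ring_scope.

Arguments cdeg : simpl never.

(** The origin of [wt]: the surviving threats number at least [(m + 4) / 8]. The 1 in [maxn] is what
    saves the case of a single gap. *)
Lemma threat_arith (m b T : nat) :
  (0 < m)%N -> (4 * b <= m)%N -> (maxn 1 m.-1 <= T + b)%N -> (m + 4 <= 8 * T)%N.
Proof. by lia. Qed.

Lemma danger_arith (m d k : nat) :
  (k * 50 <= m)%N -> (m <= 25 * d)%N -> (k + k <= d)%N.
Proof. by lia. Qed.

Lemma expR_le1D2x (R : realType) (y : R) : 0 <= y <= 2^-1 -> expR y <= 1 + 2 * y.
Proof.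
move=> /andP[y0 y1]; have h := expR_ge1Dx (- y).
rewrite -[expR y]invrK -expRN.
have h2 : 0 < 1 + - y by lra.
apply: le_trans (_ : (1 + - y)^-1 <= _).
  by rewrite lef_pV2 // posrE (lt_le_trans h2).
rewrite -[(1 + - y)^-1]mul1r ler_pdivrMr //; nra.
Qed.

(** Divided by [X * L] and multiplied by [m + 4], Maker's turn saves [4 * p] and Breaker's turn
    costs [4 * q * (1 - p)]; as [q <= p], the balance is favourable. *)
Lemma levels_arith (R : realFieldType) (p q X X1 X2 L L' m w : R) :
  0 < q -> q <= p -> p <= 1 -> 0 < X -> 1 <= L -> 0 <= L' ->
  X1 <= X -> X2 <= X * (1 + q / 2 * w) -> w * (m + 4) = 8 -> 0 < m + 4 ->
  L' * (m + 4) <= L * m -> p * (X1 * L') + (1 - p) * (X2 * L) <= X * L.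
Proof.
move=> q0 qp p1 x0 L0 L1 e1 e2 wE mp l1.
have p0 : 0 <= p by lra.
have hX1 : p * (X1 * L') <= p * (X * L') by rewrite ler_wpM2l // ler_wpM2r.
have hX2 : (1 - p) * (X2 * L) <= (1 - p) * (X * (1 + q / 2 * w) * L).
  by rewrite ler_wpM2l ?subr_ge0 // ler_wpM2r // (le_trans ler01).
apply: le_trans (lerD hX1 hX2) _.
have -> : p * (X * L') + (1 - p) * (X * (1 + q / 2 * w) * L) =
  X * (p * L' + (1 - p) * (1 + q / 2 * w) * L) by ring.
rewrite ler_wpM2l ?(ltW x0) // -(ler_pM2r mp).
have -> : (p * L' + (1 - p) * (1 + q / 2 * w) * L) * (m + 4) =
   p * (L' * (m + 4)) + (1 - p) * ((m + 4) + q / 2 * (w * (m + 4))) * L by ring.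
rewrite wE.
have h1 : p * (L' * (m + 4)) <= p * (L * m) by rewrite ler_wpM2l.
have h2 : 0 <= L * (p * 4 - (1 - p) * (q / 2 * 8)).
  have pq : 0 <= p * q by rewrite mulr_ge0 // ltW.
  have -> : p * 4 - (1 - p) * (q / 2 * 8) = 4 * (p - q) + 4 * (p * q) by field.
  by apply: mulr_ge0; lra.
by lra.
Qed.

Section Potential.

Variables (R : realType) (q : R) (n N : nat).

Definition lam : R := 1 + q / 8.
(** The unit of degree: a low vertex has at most one unit, a gap end that is not dangerous at most
    two and one edge more, and no gap end reaches three while [pot3] is below 1. *)
Definition cutoff : nat := (n %/ 50)%N.

Definition Phi (cl mk : seq (nat * nat)) (c : seq nat) : R :=
  \sum_(u <- iota 0 n) (need mk c u)%:R * lam ^+ cdeg cl u.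

(** Keeps Maker's number of turns from falling far behind [q t]. *)
Definition pot1 (cl mk : seq (nat * nat)) : R :=
  (1 + q / 2) ^+ (size cl - size mk) * 2^-1 ^+ size mk / n%:R.

(** The weight makes the threats after a rotation at [m] gaps worth at least 1,
    and [levels m] pays for it: [levels (m - 1) = (1 - wt m / 2) * levels m]. *)
Definition wt (m : nat) : R := 8 / (m%:R + 4).

(** The cap 1 limits what a Maker turn can lose. The value 1 in dangerous positions keeps Breaker
    from lowering [pending] by making an end dangerous, and danger persists on his turns. *)
Definition pending (cl mk : seq (nat * nat)) (c : seq nat) : R :=
  if dangerous n cl mk c then 1
  else Num.min 1 ((size (threats cl mk c))%:R * wt (gaps mk c)).

(** Each Maker move is a move at a crowded end, closes a gap, or is a rotation that
    starts a new set of threats; hence only the threats that Breaker removes can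
    increase this, each by at most [wt m]. *)
Definition excess (cl mk : seq (nat * nat)) (c : seq nat) : R :=
  (size mk)%:R - 2 * (n%:R - (gaps mk c)%:R) - 2 * (hdeg n cl mk c)%:R
  - pending cl mk c.

(** The exponential of a harmonic sum in closed form: the ratios [m / (m + 4)] telescope, so the
    growth is only of degree 4. *)
Definition levels (m : nat) : R :=
  (m%:R + 1) * (m%:R + 2) * (m%:R + 3) * (m%:R + 4).

(** The divisor makes the initial value [O(n ^ -2)], while [pot2 < 1] still forces
    [excess < 24 * ln n / q], which is a small fraction of [n]. *)
Definition pot2 (cl mk : seq (nat * nat)) (c : seq nat) : R :=
  expR (q / 4 * excess cl mk c) * levels (gaps mk c) / n%:R ^+ 6.

(** Below 1, it keeps the degrees of all gap ends below [3 * cutoff]. *)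
Definition pot3 (cl mk : seq (nat * nat)) (c : seq nat) : R :=
  (Phi cl mk c + 2 * lam ^+ cutoff.*2.+1 * (N%:R - (size cl)%:R)) / lam ^+ (3 * cutoff).

Definition pot (s : gstate) : R :=
  pot1 s.1.1 s.1.2 + pot2 s.1.1 s.1.2 s.2 + pot3 s.1.1 s.1.2 s.2.

Hypotheses (q0 : 0 < q) (q1 : q <= 2^-1) (n2 : (2 < n)%N).

Lemma natD4_gt0 (m : nat) : 0 < m%:R + 4 :> R.
Proof. by rewrite ltr_wpDl ?ler0n. Qed.

Lemma n_gt0 : 0 < n%:R :> R. Proof. by rewrite ltr0n (ltn_trans _ n2). Qed.

Lemma lam_ge1 : 1 <= lam. Proof. by rewrite /lam; move: q0; lra. Qed.

Lemma lam_gt0 : 0 < lam. Proof. exact: lt_le_trans lam_ge1. Qed.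

Lemma lamX_mono i j : (i <= j)%N -> lam ^+ i <= lam ^+ j.
Proof. by move=> ij; apply: ler_weXn2l => //; exact: lam_ge1. Qed.

Lemma lamX_gt0 i : 0 < lam ^+ i. Proof. exact: exprn_gt0 lam_gt0. Qed.

Lemma Phi_ge0 cl mk c : 0 <= Phi cl mk c.
Proof.
by apply: sumr_ge0 => u _; rewrite mulr_ge0 ?ler0n // ltW // lamX_gt0.
Qed.

Lemma pot1_ge0 cl mk : 0 <= pot1 cl mk.
Proof.
apply: divr_ge0; last exact: ltW n_gt0.
by apply: mulr_ge0; apply: exprn_ge0; [move: q0; lra | rewrite invr_ge0].
Qed.

Lemma levels_ge1 m : 1 <= levels m.
Proof.
rewrite /levels; have := ler0n R m; move: m%:R => x x0.
by do 3?[apply: mulr_ege1]; lra.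
Qed.

Lemma levels_mono m m' : (m <= m')%N -> levels m <= levels m'.
Proof.
rewrite -(ler_nat R) /levels; have := ler0n R m; move: m%:R m'%:R => x y x0 xy.
by do 3?[apply: ler_pM]; rewrite ?mulr_ge0 //; lra.
Qed.

Lemma levels_ge0 m : 0 <= levels m.
Proof. exact: le_trans (levels_ge1 m). Qed.

Lemma pot2_ge0 cl mk c : 0 <= pot2 cl mk c.
Proof.
apply: divr_ge0; last by rewrite exprn_ge0 // ltW // n_gt0.
by rewrite mulr_ge0 ?levels_ge0 // expR_ge0.
Qed.

Lemma pot3_ge0 cl mk c : (size cl <= N)%N -> 0 <= pot3 cl mk c.
Proof.
move=> h; apply: divr_ge0; last by rewrite ltW // lamX_gt0.
rewrite addr_ge0 ?Phi_ge0 // mulr_ge0 ?subr_ge0 ?ler_nat //.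
by rewrite mulr_ge0 // ltW // lamX_gt0.
Qed.

Lemma pot1_step p cl mk e e' : q <= p <= 1 -> (size mk <= size cl)%N ->
  p * pot1 (e :: cl) (e :: mk) + (1 - p) * pot1 (e' :: cl) mk <= pot1 cl mk.
Proof.
move=> /andP[qp p1] h; rewrite /pot1 /= subSS subSn // !exprS.
set a := _ ^+ (_ - _); set b := _ ^+ size mk; set i := n%:R^-1.
have h0 : 0 <= a * b * i.
  rewrite !mulr_ge0 ?invr_ge0 ?ler0n // exprn_ge0 //; first by move: q0; lra.
have -> : p * (a * (2^-1 * b) * i) + (1 - p) * ((1 + q / 2) * a * b * i) =
  (p / 2 + (1 - p) * (1 + q / 2)) * (a * b * i) by ring.
rewrite ler_piMl //; move: q0; nra.
Qed.

Lemma pending_ge0 cl mk c : 0 <= pending cl mk c.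
Proof.
rewrite /pending; case: ifP => // _; rewrite le_min ler01 /= mulr_ge0 // /wt.
by rewrite divr_ge0 // ltW // natD4_gt0.
Qed.

Lemma pending_le1 cl mk c : pending cl mk c <= 1.
Proof. by rewrite /pending; case: ifP => // _; rewrite ge_min lexx. Qed.

Lemma pot2_le cl mk c cl' mk' c' :
  excess cl' mk' c' <= excess cl mk c -> (gaps mk' c' <= gaps mk c)%N ->
  pot2 cl' mk' c' <= pot2 cl mk c.
Proof.
move=> he hm; rewrite ler_wpM2r ?invr_ge0 ?exprn_ge0 //.
apply: ler_pM; rewrite ?expR_ge0 ?levels_ge0 ?levels_mono //.
by rewrite ler_expR ler_wpM2l // divr_ge0 // ltW.
Qed.

Lemma convex_le p (x y z : R) :
  0 <= p <= 1 -> x <= z -> y <= z -> p * x + (1 - p) * y <= z.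
Proof. by move=> /andP[p0 p1]; nra. Qed.

(** * One turn: the three potentials do not increase on average *)

Section Step.

Variables (p : R) (cl mk : seq (nat * nat)) (c : seq nat).
Let k := best n cl mk c.
Let x := last 0%N k.2.
Let z := head 0%N k.2.
Hypotheses (qp : q <= p) (p1 : p <= 1).
Hypotheses (pc : perm_eq c (iota 0 n)) (ucl : uniq cl) (mk_cl : {subset mk <= cl}).
Hypotheses (m0 : (0 < gaps mk c)%N) (hcl : (1000 * size cl <= n * n)%N).
Hypothesis hend : forall u, (0 < need mk c u)%N -> (50 * cdeg cl u < 3 * n)%N.

Let choice := maker_choice pc ucl n2 m0 hcl hend.

Lemma best_cand : k \in cands c. Proof. by case: choice => -[]. Qed.
Lemma best_feas : feas mk cl k. Proof. by case: choice => -[]. Qed.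

Lemma prog_or_low : prog mk k || low n cl z.
Proof.
by case: choice => _ [_ _ h]; case: (boolP (prog mk k)) => //= /h[].
Qed.

Lemma dangerous_high : dangerous n cl mk c -> (n <= 25 * cdeg cl x)%N.
Proof.
case: choice => _ [h _ _] /hasP[L hL /andP[hg hd]].
have := h L hL hg; rewrite /danger hd -/k -/x.
by case: ifP => // _; rewrite leqn0 => /eqP h0; move: n2 hd; rewrite h0; case: (n).
Qed.

Lemma dangerous_max u : dangerous n cl mk c -> (0 < need mk c u)%N ->
  (cdeg cl u <= cdeg cl x)%N.
Proof.
move=> /dangerous_high hx /need_gt0[L [hL hg <-]].
case: choice => _ [h _ _]; have := h L hL hg.
rewrite /danger -/k -/x hx.
case: ifP => // /negbT; rewrite -ltnNge => hl _.
by have := leq_trans hl hx; rewrite ltn_mul2l => /andP[_ /ltnW].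
Qed.

(** The factors 2 in [excess] pay for Maker's turn and for a loss of [pending], each at most 1. A
    rotation that keeps the number of gaps takes [pending] from 0 to 1, which pays for the turn. *)
Lemma excess_step :
  excess (claim k :: cl) (claim k :: mk) (flip k) <= excess cl mk c.
Proof.
have h1 := hdeg_flip pc mk_cl best_cand best_feas prog_or_low.
have h2 := gaps_flip best_cand best_feas.
rewrite /excess; set m := gaps mk c in h2 *; set m' := gaps _ (flip k) in h2 *.
set H := hdeg n cl mk c in h1 *; set H' := hdeg _ _ _ (flip k) in h1 *.
have f0 := pending_ge0 (claim k :: cl) (claim k :: mk) (flip k).
have f1 := pending_le1 cl mk c.
rewrite -(ler_nat R) in h2; rewrite [size (_ :: _)]/= -[(size mk).+1]addn1 natrD.
case: (boolP (dangerous n cl mk c)) => nd.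
  move: h1; rewrite (dangerous_high nd) -(ler_nat R) natrD /=; lra.
rewrite -(ler_nat R) natrD in h1; have hb := ler0n R (n <= 25 * cdeg cl x)%N.
case: (boolP (prog mk k)) => pk.
  have := prog_gaps best_cand best_feas pk; rewrite -/m -/m' -(ler_nat R) -addn1 natrD.
  move: h1 hb f0 f1; lra.
have t0 : threats cl mk c = [::].
  case: choice => _ [_ h _]; apply/eqP; apply: contraNT pk => /h; exact.
have -> : pending cl mk c = 0.
  by rewrite /pending (negPf nd) t0 mul0r; apply: min_r.
have [mm|mm] := eqVneq m' m; last first.
  have : (m' < m)%N by rewrite ltn_neqAle mm -(ler_nat R).
  by rewrite -(ler_nat R) -addn1 natrD; move: h1 hb f0; lra.
suff -> : pending (claim k :: cl) (claim k :: mk) (flip k) = 1.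
  by rewrite mm; move: h1 hb; lra.
rewrite /pending; case: ifP => // _; rewrite -/m' mm; apply: min_l.
have := threats_flip pc mk_cl best_cand best_feas pk; rewrite -/m' mm.
case: choice => _ [_ _ h]; have [_ hb4] := h pk; move: hb4.
rewrite -/k -/z -/m; set T := size _; set b := blocked _ _ _ _ => hb4 hT.
have : (m + 4 <= 8 * T)%N by apply: threat_arith hb4 hT; exact: m0.
rewrite -(ler_nat R) natrD natrM /wt => h8.
by rewrite mulrA ler_pdivlMr ?mul1r; [move: h8; lra | exact: natD4_gt0].
Qed.

(** Breaker can raise [pot2] only by destroying a threat while no end is dangerous; but in such a
    position Maker's turn would close a gap, and the drop of [levels] compensates. *)
Lemma pot2_step (e' : nat * nat) :
  p * pot2 (claim k :: cl) (claim k :: mk) (flip k)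
    + (1 - p) * pot2 (e' :: cl) mk c <= pot2 cl mk c.
Proof.
have hm := gaps_flip best_cand best_feas.
have p01 : 0 <= p <= 1 by rewrite p1 andbT (le_trans (ltW q0)).
have hH : (hdeg n cl mk c)%:R <= (hdeg n (e' :: cl) mk c)%:R :> R.
  by rewrite ler_nat hdeg_cons.
have easy : pending cl mk c <= pending (e' :: cl) mk c ->
  p * pot2 (claim k :: cl) (claim k :: mk) (flip k)
    + (1 - p) * pot2 (e' :: cl) mk c <= pot2 cl mk c.
  move=> hp; apply: convex_le => //; apply: pot2_le => //; first exact: excess_step.
  by rewrite /excess; lra.
case: (boolP (dangerous n cl mk c)) => nd.
  by apply: easy; rewrite /pending nd dangerous_cons.
case: (eqVneq (threats cl mk c) [::]) => [t0|t0].
  apply: easy; rewrite [X in X <= _]/pending (negPf nd) t0 mul0r.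
  by rewrite (min_r ler01) pending_ge0.
have pk : prog mk k by case: choice => _ [_ h _]; apply: h.
have hm1 := prog_gaps best_cand best_feas pk.
have he := excess_step; set m := gaps mk c in hm hm1 *.
set E := excess cl mk c in he *.
have w0 : 0 < wt m by rewrite /wt divr_gt0 // natD4_gt0.
have hB : excess (e' :: cl) mk c <= E + wt m.
  suff : pending cl mk c <= pending (e' :: cl) mk c + wt m.
    by rewrite /E /excess; lra.
  rewrite {1}/pending (negPf nd) /pending -/m; case: ifP => _.
    by rewrite ge_min lerDl ltW.
  have := threats_cons cl mk c e'; rewrite -(ler_nat R) -addn1 natrD.
  set T := (size _)%:R; set T' := (size _)%:R => hT.
  have : T * wt m <= T' * wt m + wt m.
    by rewrite -[X in _ + X]mul1r -mulrDl ler_wpM2r // ltW.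
  by move=> h; rewrite addr_minl le_min !ge_min lerDl (ltW w0) h orbT.
rewrite /pot2 -/m -/E !mulrA -mulrDl ler_wpM2r ?invr_ge0 ?exprn_ge0 //.
have m0' : 1 <= m%:R :> R by rewrite ler1n.
have wE : wt m * (m%:R + 4) = 8 by rewrite /wt mulfVK // gt_eqF // natD4_gt0.
have e1 : expR (q / 4 * excess (claim k :: cl) (claim k :: mk) (flip k)) <= expR (q / 4 * E).
  by rewrite ler_expR ler_wpM2l // divr_ge0 // ltW.
have e2 : expR (q / 4 * excess (e' :: cl) mk c) <= expR (q / 4 * E) * (1 + q / 2 * wt m).
  apply: (@le_trans _ _ (expR (q / 4 * (E + wt m)))).
    by rewrite ler_expR ler_wpM2l // divr_ge0 // ltW.
  rewrite mulrDr expRD ler_wpM2l ?expR_ge0 //.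
  have -> : 1 + q / 2 * wt m = 1 + 2 * (q / 4 * wt m) by field.
  apply: expR_le1D2x; apply/andP; split; first by rewrite mulr_ge0 ?ltW // divr_gt0.
  have : wt m <= 8 / 5 by rewrite /wt ler_wpM2l // lef_pV2 ?posrE ?natD4_gt0 //; lra.
  by move: q0 q1; nra.
have l1 : levels (gaps (claim k :: mk) (flip k)) * (m%:R + 4) <= levels m * m%:R.
  apply: (@le_trans _ _ (levels m.-1 * (m%:R + 4))).
    by rewrite ler_wpM2r ?addr_ge0 // levels_mono // -ltnS prednK.
  have mE : m.-1%:R = m%:R - 1 :> R by rewrite -subn1 natrB.
  by rewrite /levels mE le_eqVlt; apply/orP; left; apply/eqP; ring.
have := levels_arith q0 qp p1 (expR_gt0 (q / 4 * E)) (levels_ge1 m)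
  (levels_ge0 _) e1 e2 wE (natD4_gt0 m) l1.
by rewrite !mulrA.
Qed.

Lemma sum_pred1 (w : nat) (a : R) : 0 <= a ->
  \sum_(u <- iota 0 n) (w == u)%:R * a <= a.
Proof.
move=> a0; rewrite -mulr_suml -[leRHS]mul1r ler_wpM2r // -natr_sum (ler_nat R _ 1).
under eq_bigr do rewrite eq_sym.
by rewrite sum_bool count_uniq_mem ?iota_uniq ?leq_b1.
Qed.

(** The edge has two ends; at each, [need] is at most 2 and the weight grows by the factor
    [1 + q / 8], so the increase is at most [2 * 2 * q / 8 * X]. *)
Lemma Phi_breaker i j X :
  (forall u, (0 < need mk c u)%N -> lam ^+ cdeg cl u <= X) -> 0 <= X ->
  Phi (mke i j :: cl) mk c <= Phi cl mk c + q / 2 * X.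
Proof.
move=> hX X0; have qX : 0 <= q / 4 * X by rewrite mulr_ge0 // divr_ge0 // ltW.
apply: (@le_trans _ _ (Phi cl mk c + \sum_(u <- iota 0 n) (i == u)%:R * (q / 4 * X)
    + \sum_(u <- iota 0 n) (j == u)%:R * (q / 4 * X))).
  rewrite /Phi -!big_split /=; apply: ler_sum => u _; rewrite cdeg_cons exprD.
  have nu : (need mk c u)%:R <= 2 :> R.
    by rewrite (ler_nat R _ 2) need_le2 // (perm_uniq pc) iota_uniq.
  have hq : (need mk c u)%:R * (q / 8 * lam ^+ cdeg cl u) <= q / 4 * X.
    case: (posnP (need mk c u)) => [->|/hX h]; first by rewrite mul0r.
    have -> : q / 4 * X = 2 * (q / 8 * X) by field.
    apply: ler_pM => //; first by rewrite mulr_ge0 ?divr_ge0 // ltW // lamX_gt0.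
    by rewrite ler_wpM2l // divr_ge0 // ltW.
  have -> : lam ^+ ((i == u) || (j == u)) = 1 + ((i == u) || (j == u))%:R * (q / 8).
    by case: (_ || _); rewrite ?expr1 ?expr0 ?mul1r ?mul0r ?addr0.
  by case: (i == u); case: (j == u) => /=; lra.
by have := sum_pred1 i qX; have := sum_pred1 j qX; lra.
Qed.

(** The degree of [v] grows, which costs [q / 4 * X]. At [x] the degree grows too, but one gap is
    lost, and as [need] is at most 2 this saves at least [1 - q / 8] times its weight. The last term
    is the price of a new end [z], which is low. *)
Lemma Phi_maker X :
  (forall u, (0 < need mk c u)%N -> lam ^+ cdeg cl u <= X) -> 0 <= X ->
  Phi (claim k :: cl) (claim k :: mk) (flip k) <=
    Phi cl mk c + q / 4 * X - (1 - q / 8) * lam ^+ cdeg cl x + lam ^+ cutoff.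
Proof.
move=> hX X0; have qX : 0 <= q / 4 * X by rewrite mulr_ge0 // divr_ge0 // ltW.
set v := last 0%N k.1; set Y := lam ^+ cdeg cl x; set K := lam ^+ cutoff.
have [xv _ zv _] := cand_neq pc best_cand.
have [xn _] := cand_lt pc best_cand.
have Y0 : 0 < Y := lamX_gt0 _.
have K0 : 0 < K := lamX_gt0 _.
have hx1 : \sum_(u <- iota 0 n) (x == u)%:R * ((1 - q / 8) * Y) = (1 - q / 8) * Y.
  rewrite -mulr_suml -natr_sum.
  under eq_bigr do rewrite eq_sym.
  by rewrite sum_bool count_uniq_mem ?iota_uniq // mem_iota xn mul1r.
apply: (@le_trans _ _ (Phi cl mk c + \sum_(u <- iota 0 n) (v == u)%:R * (q / 4 * X)
    - \sum_(u <- iota 0 n) (x == u)%:R * ((1 - q / 8) * Y)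
    + \sum_(u <- iota 0 n) (z == u)%:R * K)); last first.
  have := sum_pred1 v qX; have := sum_pred1 z (ltW K0); rewrite hx1; lra.
rewrite -sumrN /Phi -!big_split /=; apply: ler_sum => u _.
rewrite cdeg_cons -/x -/v exprD.
set P := lam ^+ cdeg cl u; have P0 : 0 < P := lamX_gt0 _.
have nu : (need mk c u)%:R <= 2 :> R.
  by rewrite (ler_nat R _ 2) need_le2 // (perm_uniq pc) iota_uniq.
case: (eqVneq x u) => [xu|xu].
  have vu : (v == u) = false by rewrite -xu eq_sym; apply: negbTE.
  rewrite vu /= expr1 mul0r addr0 mul1r.
  have h := need_flip_x pc mk_cl best_cand best_feas; rewrite -/x xu -(ler_nat R) -addn1 natrD in h.
  have PY : P = Y by rewrite /P /Y xu.
  have zK : 0 <= (z == u)%:R * K by rewrite mulr_ge0 // ltW.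
  rewrite PY.
  have : (need (claim k :: mk) (flip k) u)%:R * (lam * Y) <= ((need mk c u)%:R - 1) * (lam * Y).
    apply: ler_wpM2r; last by lra.
    by rewrite mulr_ge0 ?ltW // lam_gt0.
  have : ((need mk c u)%:R - 1) * (q / 8 * Y) <= 1 * (q / 8 * Y).
    apply: ler_wpM2r; last by lra.
    by rewrite mulr_ge0 ?(ltW Y0) // divr_ge0 // ltW.
  by rewrite /lam; lra.
rewrite [false || _]/= mul0r oppr0 addr0.
have [zu|zu] := eqVneq z u.
  have vu : (v == u) = false by rewrite -zu eq_sym; apply: negbTE.
  rewrite vu expr0 !mul1r mul0r addr0.
  have := prog_or_low; case: (boolP (prog mk k)) => pk /= lowz.
    have h := prog_need best_cand best_feas u pk; rewrite -(ler_nat R) in h.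
    have : (need (claim k :: mk) (flip k) u)%:R * P <= (need mk c u)%:R * P.
      by rewrite ler_wpM2r // ltW.
    by move: K0; lra.
  have h := nonprog_need best_cand best_feas u pk; rewrite -/z zu eqxx addn1 -(ler_nat R) in h.
  rewrite -natr1 in h.
  have PK : P <= K.
    apply: lamX_mono; rewrite /cutoff -zu; move: lowz; rewrite /low /=.
    by move=> hl; rewrite leq_divRL // mulnC ltnW.
  have : (need (claim k :: mk) (flip k) u)%:R * P <= ((need mk c u)%:R + 1) * P.
    by rewrite ler_wpM2r // ltW.
  by move: PK; lra.
have hn : ((need (claim k :: mk) (flip k) u)%:R <= (need mk c u)%:R :> R).
  rewrite ler_nat; case: (boolP (prog mk k)) => pk; first exact: (prog_need best_cand best_feas).
  by have := nonprog_need best_cand best_feas u pk; rewrite -/z (negPf zu) addn0.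
rewrite mul0r addr0.
case: (v == u) => /=; last first.
  by rewrite expr0 mul1r mul0r addr0 ler_wpM2r // ltW.
rewrite expr1 mul1r.
have hq : (need mk c u)%:R * (q / 8 * P) <= q / 4 * X.
  case: (posnP (need mk c u)) => [->|/hX h]; first by rewrite mul0r.
  have -> : q / 4 * X = 2 * (q / 8 * X) by field.
  apply: ler_pM => //; first by rewrite mulr_ge0 ?divr_ge0 // ltW.
  by rewrite ler_wpM2l // divr_ge0 // ltW.
have : (need (claim k :: mk) (flip k) u)%:R * (lam * P) <= (need mk c u)%:R * (lam * P).
  by rewrite ler_wpM2r // mulr_ge0 ?ltW // lam_gt0.
by rewrite /lam; lra.
Qed.

(** Without a dangerous end a turn adds at most a constant, which the decreasing summand of [pot3]
    pays. With one, the maximal weight [X] is at least [lam ^+ cutoff.*2], hence four times the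
    price of a new end; then Maker's turn saves [X / 2] and Breaker's costs at most [q / 2 * X],
    which suffices as [q <= p]. *)
Lemma Phi_step i j : 4 <= lam ^+ cutoff ->
  p * Phi (claim k :: cl) (claim k :: mk) (flip k)
    + (1 - p) * Phi (mke i j :: cl) mk c <= Phi cl mk c + 2 * lam ^+ cutoff.*2.+1.
Proof.
move=> h4; have p01 : 0 <= p <= 1 by rewrite p1 andbT (le_trans (ltW q0)).
set W := lam ^+ cutoff.*2.+1; have W0 : 0 < W := lamX_gt0 _.
have KW : lam ^+ cutoff <= W by apply: lamX_mono; rewrite -addnn leqW ?leq_addr.
(* The odd exponent absorbs the rounding in [cutoff]: a degree below [n / 25] is below
   [2 * cutoff.+1]. *)
have nE : (n < 50 * cutoff.+1)%N by rewrite mulnC ltn_ceil.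
case: (boolP (dangerous n cl mk c)) => nd; last first.
  have hX u : (0 < need mk c u)%N -> lam ^+ cdeg cl u <= W.
    case/need_gt0 => L [hL hg <-]; apply: lamX_mono.
    have := hasPn nd L hL; rewrite hg /= -ltnNge => hd.
    by rewrite -ltnS -doubleS -mul2n -(@ltn_pmul2l 25) // mulnA (leq_trans hd) // ltnW.
  have hM := Phi_maker hX (ltW W0).
  have hB := Phi_breaker i j hX (ltW W0).
  have Y0 : 0 <= (1 - q / 8) * lam ^+ cdeg cl x.
    by apply: mulr_ge0; [move: q0 q1; lra | exact: ltW (lamX_gt0 _)].
  have qW : q * W <= 2^-1 * W by rewrite ler_wpM2r // ltW.
  by apply: convex_le => //; lra.
have hX u : (0 < need mk c u)%N -> lam ^+ cdeg cl u <= lam ^+ cdeg cl x.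
  by move=> hu; apply: lamX_mono; apply: dangerous_max.
set X := lam ^+ cdeg cl x in hX; have X0 : 0 < X := lamX_gt0 _.
have hM := Phi_maker hX (ltW X0); rewrite -/X in hM.
have hB := Phi_breaker i j hX (ltW X0).
have hK : 4 * lam ^+ cutoff <= X.
  apply: (@le_trans _ _ (lam ^+ (cutoff + cutoff))).
    by rewrite exprD ler_wpM2r // ltW // lamX_gt0.
  apply: lamX_mono; have := dangerous_high nd.
  by apply: danger_arith; exact: leq_divM.
have qX : q * X <= 2^-1 * X by rewrite ler_wpM2r // ltW.
have qX0 : 0 <= q * X by rewrite mulr_ge0 ?ltW.
have hM' : Phi (claim k :: cl) (claim k :: mk) (flip k) <= Phi cl mk c - X / 2.
  by lra.
have pM : p * Phi (claim k :: cl) (claim k :: mk) (flip k) <= p * (Phi cl mk c - X / 2).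
  by rewrite ler_wpM2l //; case/andP: p01.
have pB : (1 - p) * Phi (mke i j :: cl) mk c <= (1 - p) * (Phi cl mk c + q / 2 * X).
  by rewrite ler_wpM2l // subr_ge0.
have pX : q * X <= p * X by rewrite ler_wpM2r // ltW.
have pqX : 0 <= p * (q * X) by rewrite mulr_ge0 //; case/andP: p01.
by lra.
Qed.

Lemma pot_step i j : 4 <= lam ^+ cutoff -> (size mk <= size cl)%N ->
  p * pot (turn n (cl, mk, c) (true, maker_move n cl mk c))
    + (1 - p) * pot (turn n (cl, mk, c) (false, mke i j)) <= pot (cl, mk, c).
Proof.
move=> h4 sM.
have kn : ~~ nilp k.1 by case: choice => -[].
have mE : maker_move n cl mk c = claim k by rewrite /maker_move -/k (negPf kn).
have cE : new_cycle n cl mk c = flip k by rewrite /new_cycle -/k (negPf kn).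
rewrite /turn /pot /= mE cE.
have pq : q <= p <= 1 by rewrite qp.
have h1 := pot1_step (claim k) (mke i j) pq sM.
have h2 := pot2_step (mke i j).
have h3 := Phi_step i j h4.
suff : p * pot3 (claim k :: cl) (claim k :: mk) (flip k) +
    (1 - p) * pot3 (mke i j :: cl) mk c <= pot3 cl mk c by move: h1 h2; lra.
have L0 : 0 < lam ^+ (3 * cutoff) := lamX_gt0 _.
rewrite /pot3 !mulrA -mulrDl ler_wpM2r ?invr_ge0 ?(ltW L0) //=.
rewrite -[(size cl).+1]addn1 natrD; move: h3.
set W := lam ^+ cutoff.*2.+1; lra.
Qed.

End Step.

(** * What a potential below 1 guarantees *)

Lemma pot3_end cl mk (c : seq nat) u : perm_eq c (iota 0 n) -> (size cl <= N)%N ->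
  pot3 cl mk c < 1 -> (0 < need mk c u)%N -> (50 * cdeg cl u < 3 * n)%N.
Proof.
move=> pc tN; have L0 : 0 < lam ^+ (3 * cutoff) := lamX_gt0 _.
rewrite /pot3 ltr_pdivrMr // mul1r => h hu.
have W0 : 0 <= 2 * lam ^+ cutoff.*2.+1 * (N%:R - (size cl)%:R).
  rewrite mulr_ge0 ?subr_ge0 ?ler_nat // mulr_ge0 //; exact: ltW (lamX_gt0 _).
have un : u \in iota 0 n.
  case/need_gt0: hu => L [hL _ <-]; rewrite -(perm_mem pc) -(perm_mem (mem_views hL)).
  by case: L hL => [/views_neq0//|a L _]; rewrite /= mem_last.
have hP : lam ^+ cdeg cl u <= Phi cl mk c.
  rewrite /Phi (bigD1_seq u) ?iota_uniq //=; apply: ler_wpDr.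
    by apply: sumr_ge0 => w _; rewrite mulr_ge0 // ltW // lamX_gt0.
  by rewrite ler_peMl ?ler1n // ltW // lamX_gt0.
have {}h : lam ^+ cdeg cl u < lam ^+ (3 * cutoff) by lra.
have {}h : (cdeg cl u < 3 * cutoff)%N.
  by rewrite ltnNge; apply: contraTN h => /lamX_mono; rewrite leNgt.
by have := leq_divM n 50; rewrite -/cutoff; lia.
Qed.

Lemma hdeg_le cl mk c : (hdeg n cl mk c * n <= 100 * size cl)%N.
Proof.
have h : (hdeg n cl mk c <= 2 * count (fun u => n <= 25 * cdeg cl u) (iota 0 n))%N.
  rewrite -sum_bool big_distrr /=; apply: leq_sum => u _.
  by rewrite mulnC leq_mul2r leq_subr orbT.
have h2 := markov_count (fun u => 25 * cdeg cl u)%N (iota 0 n) n.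
rewrite -big_distrr /= in h2.
have h3 := sum_cdeg cl n.
apply: leq_trans (leq_mul h (leqnn n)) _; rewrite -mulnA.
apply: (@leq_trans (2 * (25 * (2 * size cl)))%N); last by lia.
by rewrite leq_mul2l /=; apply: leq_trans h2 _; rewrite leq_mul2l.
Qed.

(** The bounds are circular: [t] is bounded through [M], [M] through [H], and [H] through [t]. The
    circle closes because [q * t / 4] is [100 * 100 * l * t / x], which outweighs the [400 * t / x]
    that returns through [H]. There remains [t <= 9 / 9600 * x ^ 2]; this is where the size of
    [200 * 200] is needed. *)
Lemma time_arith (l t M H m F x : R) :
  1 <= l -> l <= x -> 0 <= M -> 0 <= t -> 0 <= m -> 0 <= H -> F <= 1 -> 1 <= x ->
  q * x = 200 * (200 * l) -> H * x <= 100 * t ->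
  q / 4 * (t - M) - M < l -> q / 4 * (M - 2 * (x - m) - 2 * H - F) < 6 * l ->
  1000 * t <= x * x.
Proof.
move=> l1 lx M0 t0 m0 H0 F1 x1 qx Hx h1 h2.
have E : M - 2 * (x - m) - 2 * H - F < x.
  rewrite ltNge; apply/negP => h3.
  have : q * x <= q * (M - 2 * (x - m) - 2 * H - F) by rewrite ler_wpM2l // ltW.
  by move: h2 l1; rewrite qx; lra.
have M1 : M <= 3 * x + 1 + 2 * H by lra.
have qM : q * M <= 2^-1 * M by rewrite ler_wpM2r.
have h4 : q / 4 * t < l + 6 * x + 2 + 4 * H by lra.
have h5 : (q / 4 * t) * x <= (l + 6 * x + 2 + 4 * H) * x.
  by rewrite ler_wpM2r ?ltW // (lt_le_trans ltr01).
have h6 : 100 * (100 * (l * t)) <= (l + 6 * x + 2) * x + 400 * t.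
  have e : (q / 4 * t) * x = 100 * (100 * (l * t)).
    have -> : (q / 4 * t) * x = (q * x) / 4 * t by ring.
    by rewrite qx; field.
  by move: h5; rewrite e; lra.
have x0 : 0 <= x by lra.
have h7 : (l + 6 * x + 2) * x <= (9 * l * x) * x.
  rewrite ler_wpM2r //.
  have : l <= l * x by rewrite ler_peMr //; lra.
  have : x <= l * x by rewrite ler_peMl.
  by lra.
have h8 : t <= l * t by rewrite ler_peMl.
have h9 : 96 * (100 * (l * t)) <= 9 * (l * (x * x)) by lra.
have l0 : 0 < l by lra.
by rewrite -(ler_pM2l l0); lra.
Qed.

Lemma pot12_time cl mk (c : seq nat) l : n%:R = expR l -> 1 <= l -> l <= n%:R ->
  q * n%:R = 200 * (200 * l) -> (size mk <= size cl)%N ->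
  pot1 cl mk < 1 -> pot2 cl mk c < 1 -> (1000 * size cl <= n * n)%N.
Proof.
move=> nE l1 ln qn sM h1 h2.
have n1 : 1 <= n%:R :> R by rewrite ler1n (ltn_trans _ n2).
have H : (hdeg n cl mk c)%:R * n%:R <= 100 * (size cl)%:R :> R.
  by rewrite -!natrM ler_nat hdeg_le.
rewrite -(ler_nat R) !natrM.
apply: (time_arith (l := l) (M := (size mk)%:R) (H := (hdeg n cl mk c)%:R)
  (m := (gaps mk c)%:R) (F := pending cl mk c)) => //.
- exact: pending_le1.
(* To take logarithms in [pot1 < 1], the two powers are compared with exponentials by
   [exp (q / 4) <= 1 + q / 2] and [exp (- 1) <= 1 / 2]. *)
- rewrite -ltr_expR -nE; apply: le_lt_trans _ (_ : (1 + q / 2) ^+ (size cl - size mk)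
    * 2^-1 ^+ size mk < n%:R); last first.
    by move: h1; rewrite /pot1 ltr_pdivrMr ?n_gt0 // mul1r.
  rewrite expRB -natrB // [q / 4 * _]mulrC expRM_natl.
  have e2 : 2 <= expR 1 :> R by apply: le_trans (expR_ge1Dx 1); lra.
  apply: ler_pM; rewrite ?exprn_ge0 ?expR_ge0 ?invr_ge0 ?expR_ge0 //.
    apply: lerXn2r; rewrite ?nnegrE ?expR_ge0 //; first by move: q0; lra.
    have -> : q / 2 = 2 * (q / 4) by field.
    by apply: expR_le1D2x; move: q0 q1; lra.
  rewrite -[X in expR X]mulr1 expRM_natl -exprVn; apply: lerXn2r.
  - by rewrite nnegrE invr_ge0 expR_ge0.
  - by rewrite nnegrE invr_ge0.
  - by rewrite lef_pV2 ?posrE ?expR_gt0.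
rewrite -ltr_expR; have n6 : 0 < n%:R ^+ 6 :> R by rewrite exprn_gt0 // n_gt0.
have -> : expR (6 * l) = n%:R ^+ 6 by rewrite nE -expRM_natl.
move: h2; rewrite /pot2 ltr_pdivrMr // mul1r; apply: le_lt_trans.
by rewrite ler_peMr ?expR_ge0 // levels_ge1.
Qed.

End Potential.

Local Close Scope ring_scope.

(** * The game in terms of pairs of numbers *)

Lemma mke_lt n u v : u != v -> u < n -> v < n -> (mke u v).1 < (mke u v).2 < n.
Proof.
move=> uv un vn; rewrite /mke; case: (leqP u v) => h; apply/andP; split => //=.
by rewrite ltn_neqAle uv.
Qed.

Section Encoding.

Variable n : nat.

Definition epair (e : {set 'I_n}) : nat * nat :=
  let s := [seq val i | i <- enum e] in (head 0 s, head 0 (behead s)).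

Definition eset (e : nat * nat) : {set 'I_n} :=
  [set i | (val i == e.1) || (val i == e.2)].

Lemma enum_eset i j : i < j < n -> [seq val k | k <- enum (eset (i, j))] = [:: i; j].
Proof.
move=> /andP[ij jn]; apply: (@irr_sorted_eq _ ltn) => //.
- exact: ltn_trans.
- exact: ltnn.
- apply: (subseq_sorted ltn_trans _ (iota_ltn_sorted 0 n)).
  rewrite -val_enum_ord; apply: map_subseq; rewrite [X in subseq _ X]enumT.
  exact: filter_subseq.
- by rewrite /= ij.
move=> k; rewrite !inE; apply/mapP/idP => [[u]|].
  by rewrite mem_enum inE => hu ->.
move=> hk; have kn : k < n by case/orP: hk => /eqP->; rewrite ?jn // (ltn_trans ij).
by exists (Ordinal kn) => //; rewrite mem_enum inE.
Qed.

Lemma epairK i j : i < j < n -> epair (eset (i, j)) = (i, j).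
Proof. by move=> h; rewrite /epair enum_eset. Qed.

Lemma Kn_edgeP (e : {set 'I_n}) : e \in Kn_edges n ->
  exists i j, [/\ i < j < n, e = eset (i, j) & epair e = (i, j)].
Proof.
rewrite inE => /cards2P[u [v [uv ->]]].
wlog lt_uv : u v uv / u < v.
  move=> h; case: (ltngtP u v) => huv; first exact: h.
    by rewrite finset.setUC; apply: h => //; rewrite eq_sym.
  by rewrite (val_inj huv) eqxx in uv.
have hE : [set u; v] = eset (val u, val v).
  by apply/setP => w; rewrite !inE.
have h : val u < val v < n by rewrite lt_uv ltn_ord.
by exists (val u), (val v); rewrite hE epairK.
Qed.

Lemma eset_Kn i j : i < j < n -> eset (i, j) \in Kn_edges n.
Proof.
by move=> h; rewrite inE cardE -(size_map val) enum_eset.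
Qed.

Lemma epair_inj : {in Kn_edges n &, injective epair}.
Proof.
move=> e f /Kn_edgeP[i [j [_ -> ->]]] /Kn_edgeP[i' [j' [_ -> ->]]].
by case=> -> ->.
Qed.

Definition nat_history (h : history n) : seq (bool * (nat * nat)) :=
  [seq (x.1, epair x.2) | x <- h].

Definition state (h : history n) : gstate := replay n (nat_history h).

Lemma state_rcons h (x : bool * {set 'I_n}) : state (rcons h x) = turn n (state h) (x.1, epair x.2).
Proof. by rewrite /state /nat_history map_rcons /replay foldl_rcons. Qed.

Lemma state_claimed h : (state h).1.1 = rev [seq epair e | e <- claimed h].
Proof.
elim/last_ind: h => // h x IH.
by rewrite state_rcons /= IH /claimed !map_rcons rev_rcons.
Qed.

Lemma state_cycle h : perm_eq (state h).2 (iota 0 n).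
Proof.
elim/last_ind: h => [|h x IH]; first exact: perm_refl.
rewrite state_rcons /=; case: (x.1) => //.
exact: perm_trans (perm_new_cycle _ _ _ _) IH.
Qed.

Lemma mem_state_maker h e :
  (e \in (state h).1.2) = ((true, e) \in nat_history h).
Proof.
elim/last_ind: h => // h [b f] IH.
rewrite state_rcons /nat_history map_rcons mem_rcons inE -/(nat_history h) /=.
by rewrite xpair_eqE; case: b => //=; rewrite inE IH.
Qed.

Lemma size_state_maker h : size (state h).1.2 <= size (state h).1.1.
Proof.
elim/last_ind: h => // h [b f] IH; rewrite state_rcons /=.
by case: b => //=; apply: ltnW.
Qed.

Lemma state_maker_sub h : {subset (state h).1.2 <= (state h).1.1}.
Proof.
elim/last_ind: h => // h [b f] IH e; rewrite state_rcons /= inE.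
case: b => /=; first by rewrite inE => /orP[->//|/IH->]; rewrite orbT.
by move=> /IH ->; rewrite orbT.
Qed.

Lemma size_state_claimed h : size (state h).1.1 = size h.
Proof. by rewrite state_claimed size_rev !size_map. Qed.

Lemma state_uniq h : valid h -> uniq (state h).1.1.
Proof.
case/andP=> uh /allP hh; rewrite state_claimed rev_uniq map_inj_in_uniq //.
by move=> e f /hh he /hh hf; apply: epair_inj.
Qed.

Definition strategy_act (h : history n) : {set 'I_n} :=
  let s := state h in eset (maker_move n s.1.1 s.1.2 s.2).

Lemma mem_all_edges e : (e \in all_edges n) = (e.1 < e.2 < n).
Proof.
case: e => i j; apply/flatten_mapP/idP => [[a]|/= /andP[ij jn]].
  by rewrite mem_iota => _ /mapP[b]; rewrite mem_filter mem_iota => /andP[ab bn] [-> ->] /=; rewrite ab.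
exists i; first by rewrite mem_iota (ltn_trans ij).
by apply/mapP; exists j; rewrite ?mem_filter ?mem_iota ?ij.
Qed.

Lemma last_mem (T : eqType) (d : T) (s : seq T) : s != [::] -> last d s \in s.
Proof. by case: s => // a s _; rewrite /= mem_last. Qed.

Lemma maker_moveP h : valid h -> unclaimed h != finset.set0 ->
  let s := state h in let e := maker_move n s.1.1 s.1.2 s.2 in
  e.1 < e.2 < n /\ e \notin s.1.1.
Proof.
move=> vh /finset.set0Pn[f]; rewrite inE => /andP[fK fc] /=.
rewrite /maker_move; case: ifPn => [_|kn].
  set s := [seq _ <- _ | _]; have : last (0, 0) s \in s.
    apply: last_mem; rewrite -has_filter; apply/hasP; exists (epair f).
      by rewrite mem_all_edges; have [i [j [ij _ ->]]] := Kn_edgeP fK.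
    rewrite state_claimed mem_rev; apply: contra fc => /mapP[g gc /epair_inj -> //].
    by case/andP: vh => _ /allP/(_ _ gc).
  by rewrite mem_filter mem_all_edges => /andP[-> ->].
have [kc kf _] := (best_spec n (state h).1.1 (state h).1.2 (state h).2).2 kn.
have [xv _ _ _] := cand_neq (state_cycle h) kc.
have [xn vn] := cand_lt (state_cycle h) kc.
by case/andP: kf => _ ->; split=> //; apply: mke_lt.
Qed.

Lemma strategy_act_legal : legal strategy_act.
Proof.
move=> h vh uh; have [] := maker_moveP vh uh.
rewrite /strategy_act /=; set e := maker_move _ _ _ _; case: e => i j /= ij ec.
rewrite inE eset_Kn //=; apply: contra ec => hc.
by rewrite state_claimed mem_rev -(epairK ij) map_f.
Qed.

Lemma epair_strategy_act h : valid h -> unclaimed h != finset.set0 ->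
  epair (strategy_act h) = maker_move n (state h).1.1 (state h).1.2 (state h).2.
Proof.
move=> vh uh; have [+ _] := maker_moveP vh uh.
by rewrite /strategy_act /=; case: (maker_move _ _ _ _) => i j /epairK.
Qed.

Definition raw_history (h : history n) : seq (bool * seq nat) :=
  [seq (x.1, [seq val i | i <- enum x.2]) | x : bool * {set 'I_n} <- h].

Lemma encode_history h : enc_history h = encode (raw_history h).
Proof. by elim: h => //= x h ->. Qed.

Lemma strategy_answer h : valid h -> unclaimed h != finset.set0 ->
  enc_edge (strategy_act h) =
    encode (answer (n, raw_history h)).
Proof.
move=> vh uh; have [+ _] := maker_moveP vh uh.
rewrite /strategy_act /answer /= -map_comp -/(nat_history h) -/(state h).
by case: (maker_move _ _ _ _) => i j /= /enum_eset; rewrite /enc_edge => ->.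
Qed.

Lemma gaps0_cycle mk (c : seq nat) : c != [::] -> gaps mk c = 0 ->
  cycle (fun u v => mke u v \in mk) c.
Proof.
case: c => // a s _; rewrite /gaps csumE //= => /eqP.
rewrite addn_eq0 eqb0 negbK rcons_path => /andP[hs ->]; rewrite andbT.
elim: s a hs => //= b s IH a; rewrite addn_eq0 eqb0 negbK => /andP[-> h].
exact: IH.
Qed.

Lemma hamiltonian_gaps0 h : valid h -> 2 < n ->
  gaps (state h).1.2 (state h).2 = 0 -> hamiltonian (maker_edges h).
Proof.
move=> vh n2 g0; set c := (state h).2 in g0; set mk := (state h).1.2 in g0.
have pc : perm_eq c (iota 0 n) := state_cycle h.
have [d dE] : exists d : seq 'I_n, [seq val i | i <- d] = c.
  exists (pmap insub c); rewrite pmap_filter; last exact: insubK.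
  apply/all_filterP/allP => u; rewrite (perm_mem pc) mem_iota isSome_insub.
  by case/andP.
have szd : size d == n by rewrite -(size_map val) dE (size_perm_iota pc).
rewrite /hamiltonian n2; apply/existsP; exists (Tuple szd) => /=.
have -> : uniq d by rewrite -(map_inj_uniq val_inj) dE (perm_uniq pc) iota_uniq.
have : cycle (fun u v => mke u v \in mk) [seq val i | i <- d].
  rewrite dE; apply: gaps0_cycle g0; rewrite -size_eq0 (size_perm_iota pc).
  by case: (n) n2.
rewrite cycle_map; apply: sub_cycle => u v /=.
rewrite mem_state_maker => /mapP[[b e] he] [bE eE].
have eK : e \in Kn_edges n.
  by case/andP: vh => _ /allP; apply; apply/mapP; exists (b, e).
rewrite !inE; suff -> : [set u; v] = e by rewrite bE.
have [i [j [_ eS e2]]] := Kn_edgeP eK; move: eE; rewrite /= e2 eS /mke => eE.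
by apply/setP => w; rewrite !inE; case: ifP eE => _ [<- <-] //=; rewrite orbC.
Qed.

End Encoding.

Local Open Scope ring_scope.

(** * The probability of losing *)

Lemma sum_tuple_cons (R : realType) k (F : k.+1.-tuple bool -> R) :
  \sum_w F w = \sum_(w : k.-tuple bool) F [tuple of true :: w]
             + \sum_(w : k.-tuple bool) F [tuple of false :: w].
Proof.
pose f (x : bool * k.-tuple bool) : k.+1.-tuple bool := [tuple of x.1 :: x.2].
rewrite (reindex f) /=; last first.
  exists (fun w => (thead w, [tuple of behead w])) => [[b w] _|w _].
    by rewrite /f /= theadE; congr (_, _); apply/val_inj.
  by rewrite /f [RHS]tuple_eta.
rewrite -(pair_bigA _ (fun b (w : k.-tuple bool) => F [tuple of b :: w])) /=.
by rewrite big_bool.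
Qed.

Lemma turns_prob_cons (R : realType) (p : R) k b (w : k.-tuple bool) :
  turns_prob p [tuple of b :: w] = (if b then p else 1 - p) * turns_prob p w.
Proof. by rewrite /turns_prob big_cons. Qed.

Lemma turns_prob_ge0 (R : realType) (p : R) k (w : k.-tuple bool) :
  0 <= p <= 1 -> 0 <= turns_prob p w.
Proof.
by move=> /andP[p0 p1]; apply: prodr_ge0 => b _; case: b; rewrite ?subr_ge0.
Qed.

Lemma sum_turns_prob (R : realType) (p : R) k :
  \sum_(w : k.-tuple bool) turns_prob p w = 1.
Proof.
elim: k => [|k IH].
  rewrite (eq_bigr (fun=> 1)) => [|w _]; last by rewrite /turns_prob tuple0 big_nil.
  by rewrite sumr_const card_tuple expn0.
rewrite sum_tuple_cons.
under eq_bigr do rewrite turns_prob_cons.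
under [X in _ + X]eq_bigr do rewrite turns_prob_cons.
by rewrite -!mulr_sumr IH /= !mulr1 addrC subrK.
Qed.

Lemma card_Kn n : #|Kn_edges n| = 'C(n, 2).
Proof. by rewrite card_draws card_ord. Qed.

Lemma card_Kn_bounds n : (2 * #|Kn_edges n| <= n * n)%N /\
  ((2 < n)%N -> (n * n < 1000 * #|Kn_edges n|)%N).
Proof.
rewrite card_Kn; have : ('C(n, 2) * 2 = n * n.-1)%N.
  by rewrite bin2 muln2 even_halfK // oddM; case: n => //= n; case: odd.
move: 'C(n, 2) => b hb; split; first by nia.
by case: n hb => // -[|m] hb m2; nia.
Qed.

Lemma claimed_Kn n (h : history n) : valid h -> {subset claimed h <= Kn_edges n}.
Proof. by case/andP => _ /allP. Qed.

Lemma unclaimed_neq0 n (h : history n) :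
  (size h < #|Kn_edges n|)%N -> unclaimed h != finset.set0.
Proof.
move=> sh; apply: contraTneq sh => u0; rewrite -leqNgt.
rewrite -(size_map snd h) -/(claimed h); apply: leq_trans (card_size _).
apply: subset_leq_card; apply/fintype.subsetP => e eK.
have : e \notin unclaimed h by rewrite u0 inE.
by rewrite inE eK /= negbK.
Qed.

Lemma valid_rcons n (h : history n) b (e : {set 'I_n}) :
  valid h -> e \in unclaimed h -> valid (rcons h (b, e)).
Proof.
case/andP=> uh ah; rewrite inE => /andP[eK eh].
by rewrite /valid /claimed map_rcons rcons_uniq all_rcons /= eh eK uh.
Qed.

Lemma size_valid n (h : history n) : valid h -> (size h <= n * n)%N.
Proof.
move=> vh; case/andP: (vh) => uh _.
rewrite -(size_map snd h) -/(claimed h) -(card_uniqP uh).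
apply: (@leq_trans #|Kn_edges n|).
  by apply: subset_leq_card; apply/fintype.subsetP; apply: claimed_Kn.
by apply: leq_trans (card_Kn_bounds n).1; rewrite leq_pmull.
Qed.

(** * Backward induction over the remaining turns *)

Section Losing.

Variables (R : realType) (n : nat) (p : R) (B : strategy n).
Hypotheses (p01 : 0 <= p <= 1) (legalB : legal B).

Definition play_from (h : history n) (w : seq bool) : history n :=
  foldl (fun h b => rcons h (b, if b then strategy_act h else B h)) h w.

Definition loss (h : history n) (k : nat) : R :=
  \sum_(w : k.-tuple bool)
    turns_prob p w * (~~ hamiltonian (maker_edges (play_from h w)))%:R.

Lemma loss_le1 h k : loss h k <= 1.
Proof.
rewrite -(sum_turns_prob p k); apply: ler_sum => w _.
by rewrite ler_piMr ?turns_prob_ge0 // lern1 leq_b1.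
Qed.

Lemma lossS h k : loss h k.+1 = p * loss (rcons h (true, strategy_act h)) k
  + (1 - p) * loss (rcons h (false, B h)) k.
Proof.
rewrite /loss sum_tuple_cons !mulr_sumr; congr (_ + _); apply: eq_bigr => w _;
  by rewrite turns_prob_cons mulrA.
Qed.

Lemma hamiltonian_rcons (h : history n) (x : bool * {set 'I_n}) :
  hamiltonian (maker_edges h) -> hamiltonian (maker_edges (rcons h x)).
Proof.
case/andP=> n2 /existsP[c /andP[uc hc]]; apply/andP; split=> //.
apply/existsP; exists c; rewrite uc /=; apply: sub_cycle hc => u v.
by rewrite !inE mem_rcons inE => ->; rewrite orbT.
Qed.

Lemma loss_hamiltonian h k : hamiltonian (maker_edges h) -> loss h k = 0.
Proof.
move=> hh; rewrite /loss big1 // => w _.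
suff -> : hamiltonian (maker_edges (play_from h w)) by rewrite mulr0.
rewrite /play_from; elim: (w : seq bool) h hh => //= b s IH h hh.
by apply: IH; apply: hamiltonian_rcons.
Qed.

Variables (q l : R).
Hypotheses (q0 : 0 < q) (q1 : q <= 2^-1) (qp : q <= p) (n2 : (2 < n)%N).
Hypotheses (nE : n%:R = expR l) (l1 : 1 <= l) (ln : l <= n%:R).
Hypothesis (qn : q * n%:R = 200 * (200 * l)).
Hypothesis (h4 : 4 <= lam q ^+ cutoff n).

Let N := #|Kn_edges n|.

(** The three summands are nonnegative, so each is below 1: the first two bound the time, the third
    the degrees of the gap ends. *)
Lemma pot_lt1 (h : history n) : valid h -> (size h <= N)%N -> pot q n N (state h) < 1 ->
  (1000 * size h <= n * n)%N /\
  forall u, (0 < need (state h).1.2 (state h).2 u)%N ->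
    (50 * cdeg (state h).1.1 u < 3 * n)%N.
Proof.
move=> vh; rewrite -(size_state_claimed h) => sN; rewrite /pot => P1.
have A1 := pot1_ge0 q0 n2 (state h).1.1 (state h).1.2.
have A2 := pot2_ge0 q n (state h).1.1 (state h).1.2 (state h).2.
have A3 := pot3_ge0 n q0 (state h).1.2 (state h).2 sN.
split.
  apply: (pot12_time q0 q1 n2 nE l1 ln qn (size_state_maker h)
    (c := (state h).2)); by lra.
move=> u; apply: (pot3_end q0 q1 n2 (state_cycle h) sN).
by lra.
Qed.

(** Where [pot] is at least 1 the bound is trivial, and without gaps the loss is 0. Otherwise
    [pot_lt1] supplies the hypotheses of [pot_step], and the induction hypothesis applies to both
    outcomes of the toss. *)
Lemma loss_le_pot (h : history n) k : valid h -> (size h + k = N)%N ->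
  loss h k <= pot q n N (state h).
Proof.
elim: k h => [|k IH] h vh hN; have sN : (size h <= N)%N by rewrite -hN leq_addr.
all: have pot0 : 0 <= pot q n N (state h)
  by rewrite /pot !addr_ge0 ?pot1_ge0 ?pot2_ge0 ?pot3_ge0 ?size_state_claimed.
all: case: (lerP 1 (pot q n N (state h))) => P1;
  first exact: le_trans (loss_le1 _ _) P1.
all: have [g0|g0] := posnP (gaps (state h).1.2 (state h).2);
  first by rewrite loss_hamiltonian ?(hamiltonian_gaps0 vh n2).
all: have [hcl hend] := pot_lt1 vh sN P1.
  (* With no turn left, more than [n ^ 2 / 1000] edges have been claimed, against the time bound. *)
  by move: hcl; rewrite -[size h]addn0 hN leqNgt (card_Kn_bounds n).2.
have uh : unclaimed h != finset.set0.
  by apply: unclaimed_neq0; rewrite -/N -hN addnS ltnS leq_addr.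
have vM := valid_rcons true vh (strategy_act_legal vh uh).
have vB := valid_rcons false vh (legalB vh uh).
have [i [j [ij _ eB]]] : exists i j, [/\ (i < j < n)%N, B h = eset n (i, j)
    & epair (B h) = (i, j)].
  by apply: Kn_edgeP; move: (legalB vh uh); rewrite inE => /andP[].
case/andP: p01 => p0 p1.
rewrite -(size_state_claimed h) in hcl.
have step := pot_step N q0 q1 n2 qp p1 (state_cycle h) (state_uniq vh)
  (@state_maker_sub n h) g0 hcl hend i j h4 (size_state_maker h).
rewrite lossS.
have eM := epair_strategy_act vh uh.
have eij : mke i j = epair (B h).
  by rewrite eB /mke; case/andP: ij => /ltnW ->.
rewrite -eM eij -!surjective_pairing in step; apply: le_trans _ step.
apply: lerD; apply: ler_wpM2l; rewrite ?subr_ge0 //.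
  by have := IH _ vM; rewrite state_rcons; apply; rewrite size_rcons addSnnS.
by have := IH _ vB; rewrite state_rcons; apply; rewrite size_rcons addSnnS.
Qed.

End Losing.

Lemma cutoff_arith m k : (m < k.+1 * 50)%N -> (1000 <= m)%N ->
  (m <= 100 * k.-1)%N.
Proof. by lia. Qed.

Lemma doubleS_pred_le k : (0 < k)%N -> (k.*2.+1 + k.-1 <= 3 * k)%N.
Proof. by lia. Qed.

(** * The potential at the start of the game *)

Section Start.

Variables (R : realType) (n : nat) (q l : R).
Hypotheses (nE : n%:R = expR l) (l_big : 8 * (200 * 200) <= l).
Hypothesis (qn : q * n%:R = 200 * (200 * l)).

Lemma l_sqr_le : l * l <= 4 * n%:R.
Proof.
have h := expR_ge1Dx (l / 2); have e : n%:R = expR (l / 2) * expR (l / 2).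
  by rewrite nE -expRD; congr expR; field.
rewrite e; have l0 : 0 <= l by move: l_big; lra.
have : (1 + l / 2) * (1 + l / 2) <= expR (l / 2) * expR (l / 2).
  by apply: ler_pM => //; lra.
by lra.
Qed.

Lemma n_big : 1000 <= n%:R :> R.
Proof.
have h : 8 * (200 * 200) * l <= l * l by rewrite ler_wpM2r //; move: l_big; lra.
by have := l_sqr_le; move: l_big; lra.
Qed.

Lemma n_nat_big : (1000 <= n)%N. Proof. by have := n_big; rewrite ler_nat. Qed.

Lemma q_gt0 : 0 < q.
Proof.
have n0 : 0 < n%:R :> R by have := n_big; lra.
by rewrite -(pmulr_lgt0 _ n0) qn; move: l_big; lra.
Qed.

(** The bound on [l] is tailored to this: [200 * 200 * l <= l * l / 8 <= n / 2]. *)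
Lemma q_le_half : q <= 2^-1.
Proof.
have n0 : 0 < n%:R :> R by have := n_big; lra.
rewrite -(ler_pM2r n0) qn; have := l_sqr_le.
have : 8 * (200 * 200) * l <= l * l by rewrite ler_wpM2r //; move: l_big; lra.
by lra.
Qed.

Lemma l_le_n : l <= n%:R.
Proof. by rewrite nE; apply: le_trans (expR_ge1Dx l); lra. Qed.

(** The exponent is the distance from [cutoff.*2.+1] to [3 * cutoff], so this power must beat the
    factor of order [n ^ 2] in the numerator of [pot3]. It does, being at least
    [exp (q * n / 1600) = exp (25 * l)]. *)
Lemma lamX_big : n%:R ^+ 4 <= lam q ^+ (cutoff n).-1.
Proof.
have q0 := q_gt0; have q1 := q_le_half.
have h : expR (q / 16) <= lam q.
  apply: le_trans (expR_le1D2x _) _; first by apply/andP; split; lra.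
  by rewrite /lam; lra.
apply: (@le_trans _ _ (expR (q / 16) ^+ (cutoff n).-1)); last first.
  by apply: lerXn2r; rewrite ?nnegrE ?expR_ge0 // ltW // lam_gt0.
rewrite nE -!expRM_natl ler_expR.
have hk : n%:R <= 100 * ((cutoff n).-1)%:R :> R.
  rewrite -natrM ler_nat; apply: cutoff_arith n_nat_big; exact: ltn_ceil.
have : q / 16 * n%:R <= q / 16 * (100 * (cutoff n).-1%:R).
  by rewrite ler_wpM2l // divr_ge0 // ltW.
have -> : q / 16 * n%:R = 50 * (50 * l).
  by rewrite mulrAC qn; field.
by move: l_big; lra.
Qed.

Lemma lamX_ge4 : 4 <= lam q ^+ cutoff n.
Proof.
apply: (@le_trans _ _ (n%:R ^+ 4)).
  have n1 := n_big; apply: (@le_trans _ _ (n%:R ^+ 1)); first by rewrite expr1; lra.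
  by rewrite ler_weXn2l //; lra.
apply: (le_trans lamX_big); apply: lamX_mono; [exact: q_gt0 | exact: leq_pred].
Qed.

Lemma pot_start N : (2 * N <= n * n)%N ->
  pot q n N ([::], [::], iota 0 n) <= 20 / n%:R.
Proof.
move=> hN; have n1 := n_big; have n0 : 0 < n%:R :> R by lra.
have q0 := q_gt0.
have gn : (gaps [::] (iota 0 n) <= n)%N.
  rewrite -[leqRHS](size_iota 0) -(size_rots (iota 0 n)) -sum1_size.
  by apply: leq_sum => L _; rewrite leq_b1.
have P1 : pot1 q n [::] [::] = 1 / n%:R by rewrite /pot1 !expr0 mul1r.
have P2 : pot2 q n [::] [::] (iota 0 n) <= 16 / n%:R.
  rewrite /pot2; have he : expR (q / 4 * excess R n [::] [::] (iota 0 n)) <= 1.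
    rewrite -expR0 ler_expR mulr_ge0_le0 ?divr_ge0 ?(ltW q0) // /excess.
    have := pending_ge0 R n [::] [::] (iota 0 n).
    have := ler0n R (hdeg n [::] [::] (iota 0 n)).
    by move: gn; rewrite -(ler_nat R) /=; lra.
  have hl : levels R (gaps [::] (iota 0 n)) <= 16 * n%:R ^+ 4.
    apply: le_trans (levels_mono R gn) _; rewrite /levels.
    have -> : 16 * n%:R ^+ 4 = (2 * n%:R) * (2 * n%:R) * (2 * n%:R) * (2 * n%:R) :> R.
      by ring.
    by do 3?[apply: ler_pM]; rewrite ?mulr_ge0 //; lra.
  have h : expR (q / 4 * excess R n [::] [::] (iota 0 n)) *
      levels R (gaps [::] (iota 0 n)) <= 1 * (16 * n%:R ^+ 4).
    by apply: ler_pM; rewrite ?expR_ge0 ?levels_ge0.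
  rewrite mul1r in h; have n6 : 0 < n%:R ^+ 6 :> R by rewrite exprn_gt0.
  rewrite ler_pdivrMr //; apply: le_trans h _.
  have -> : 16 / n%:R * n%:R ^+ 6 = 16 * (n%:R ^+ 4 * n%:R) :> R.
    by field; rewrite gt_eqF.
  by rewrite ler_wpM2l // ler_peMr ?exprn_ge0 //; lra.
have P3 : pot3 q n N [::] [::] (iota 0 n) <= 2 / n%:R.
  rewrite /pot3 /= subr0.
  have hPhi : Phi q n [::] [::] (iota 0 n) <= 2 * n%:R.
    rewrite /Phi; under eq_bigr do rewrite /cdeg /= expr0 mulr1.
    by rewrite -natr_sum gaps_need // -natrM ler_nat leq_mul2l.
  set W := lam q ^+ (cutoff n).*2.+1; set D := lam q ^+ (3 * cutoff n).
  have W1 : 1 <= W by apply: exprn_ege1; apply: lam_ge1.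
  have D0 : 0 < D by apply: lamX_gt0.
  have WD : W * n%:R ^+ 4 <= D.
    apply: (@le_trans _ _ (W * lam q ^+ (cutoff n).-1)).
      by rewrite ler_wpM2l ?lamX_big //; lra.
    rewrite -exprD; apply: lamX_mono => //.
    apply: doubleS_pred_le; rewrite /cutoff divn_gt0 //.
    exact: leq_trans n_nat_big.
  have hN' : 2 * N%:R <= n%:R * n%:R :> R by rewrite -!natrM ler_nat.
  have n40 : 0 < n%:R ^+ 4 :> R by rewrite exprn_gt0.
  apply: (@le_trans _ _ (2 * (n%:R * n%:R) * W / D)).
    rewrite ler_wpM2r ?invr_ge0 ?(ltW D0) //.
    have h1 : 2 * W * N%:R <= n%:R * n%:R * W.
      have -> : 2 * W * N%:R = (2 * N%:R) * W by ring.
      by rewrite ler_wpM2r //; lra.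
    have h2 : 2 * n%:R <= n%:R * n%:R * W.
      apply: (@le_trans _ _ (n%:R * n%:R)); first by rewrite ler_wpM2r //; lra.
      by rewrite ler_peMr // mulr_ge0 // ltW.
    by lra.
  rewrite ler_pdivrMr //.
  apply: (@le_trans _ _ (2 / n%:R * (W * n%:R ^+ 4))); last first.
    by rewrite ler_wpM2l // divr_ge0 // ltW.
  have -> : 2 / n%:R * (W * n%:R ^+ 4) = 2 * (n%:R * n%:R) * W * n%:R.
    by field; rewrite gt_eqF.
  by rewrite ler_peMr ?mulr_ge0 ?(ltW n0) //; lra.
rewrite /pot /= P1.
have -> : 20 / n%:R = 1 / n%:R + 16 / n%:R + 2 / n%:R + 1 / n%:R :> R by field; rewrite gt_eqF.
have : 0 <= 1 / n%:R :> R by rewrite divr_ge0 // ltW.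
by move: P2 P3; lra.
Qed.

End Start.

(** * Randomized opponents, running time and conclusion *)

Section Strategy.

Variables (R : realType) (n : nat).

Lemma unit_weight_ge0 (s : unit) : 0 <= 1 :> R. Proof. exact: ler01. Qed.

Lemma unit_weight_sum : \sum_(s : unit) 1 = 1 :> R.
Proof. by rewrite sumr_const card_unit. Qed.

Definition maker_strategy : rstrategy R n :=
  RStrategy unit_weight_ge0 unit_weight_sum (fun=> @strategy_act_legal n).

(** A randomized Breaker is a mixture of deterministic ones, and the bound on the loss is uniform
    over these. *)
Lemma win_prob_ge (p v : R) (B : rstrategy R n) :
  (forall b : strategy n, legal b -> loss p b [::] #|Kn_edges n| <= v) ->
  1 - v <= maker_win_prob p maker_strategy B.
Proof.
move=> hv; rewrite /maker_win_prob exchange_big /= big_const card_unit /= addr0.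
rewrite exchange_big /=.
have hr (r : seed B) : (1 - v) * weight r <= \sum_(w : #|Kn_edges n|.-tuple bool)
    turns_prob p w * 1 * weight r *
      (hamiltonian (maker_edges (play (@strategy_act n) (act r) w)))%:R.
  rewrite mulrC; under eq_bigr do rewrite mulr1 mulrAC.
  rewrite -mulr_suml [leRHS]mulrC ler_wpM2l ?weight_ge0 //.
  have := hv _ (@act_legal _ _ B r).
  rewrite /loss.
  have -> : \sum_(w : #|Kn_edges n|.-tuple bool) turns_prob p w *
      (~~ hamiltonian (maker_edges (play_from (act r) [::] w)))%:R =
    \sum_(w : #|Kn_edges n|.-tuple bool) turns_prob p w -
    \sum_(w : #|Kn_edges n|.-tuple bool) turns_prob p w *
      (hamiltonian (maker_edges (play (@strategy_act n) (act r) w)))%:R.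
    rewrite -sumrB; apply: eq_bigr => w _; rewrite /play_from /play.
    by case: (hamiltonian _); rewrite ?mulr1 ?mulr0 ?subrr ?subr0.
  by rewrite sum_turns_prob; lra.
apply: le_trans (ler_sum _ (fun r _ => hr r)).
by rewrite -mulr_sumr weight_sum1 mulr1.
Qed.

Lemma win_prob_le1 (p : R) (M B : rstrategy R n) : 0 <= p <= 1 ->
  maker_win_prob p M B <= 1.
Proof.
move=> p01; rewrite -(sum_turns_prob p #|Kn_edges n|); apply: ler_sum => w _.
rewrite [leRHS](_ : _ =
    \sum_(s : seed M) \sum_(r : seed B) turns_prob p w * weight s * weight r); last first.
  under eq_bigr do rewrite -mulr_sumr weight_sum1 mulr1.
  by rewrite -mulr_sumr weight_sum1 mulr1.
apply: ler_sum => s _; apply: ler_sum => r _; rewrite ler_piMr ?lern1 ?leq_b1 //.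
by rewrite !mulr_ge0 ?weight_ge0 ?turns_prob_ge0.
Qed.

End Strategy.

Lemma sz_raw_history n (h : history n) : valid h ->
  (sz (n, raw_history h) <= 20 * n.+1 ^ 3)%N.
Proof.
move=> vh; have hs := size_valid vh.
have : (sz (raw_history h) <= size h * (4 * n + 12) + 1)%N.
  have : {subset claimed h <= Kn_edges n} by case/andP: vh => _ /allP.
  elim: h {vh hs} => [|[b e] h IH] hK //.
  have {}IH := IH (fun f hf => hK f (mem_behead (s := claimed (_ :: _)) hf)).
  rewrite /raw_history /= sz_cons sz_pair -/(raw_history h).
  have [|i [j [ij eE _]]] := Kn_edgeP (hK e _); first by rewrite inE eqxx.
  rewrite eE enum_eset // !sz_cons sz_nil !sz_nat; have := sz_bool b.
  case/andP: ij => ij jn; move: IH; rewrite mulSn; lia.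
rewrite sz_pair sz_nat => h1.
have : (size h * (4 * n + 12) <= n * n * (4 * n + 12))%N by rewrite leq_mul2r hs orbT.
by rewrite !expnS expn0 muln1; move: h1; move: (sz _) (size h * _)%N => a b; nia.
Qed.

Lemma poly_time_maker (R : realType) : poly_time (maker_strategy R).
Proof.
have [_ [c [w [T [w0 [a0 [k0 hT]] hr]]]]] := ptime_answer.
(* The first assignment drops the coins and keeps [n] with the history; it costs 7 units, the 7 in
   the additive constant. *)
exists (CSeq (CAssign 0 (ECons (EHd (EVar 0)) (EHd (ETl (EVar 0))))) c).
exists (a0 * 20 ^ k0 * 2 ^ (3 * k0) + a0 * 20 ^ k0 + 7)%N, (3 * k0)%N => n b.
exists (fun=> tt); split=> [[]|r h vh uh].
  rewrite (eq_card (B := predT)) => [|x]; last by rewrite !inE.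
  by rewrite card_tuple card_bool natrX divff // expf_neq0 // pnatr_eq0.
pose x := (n, raw_history h).
have hx : update (update (fun=> Defs.Nil) 0 (enc_input h r)) 0 (encode x) 0 = encode x.
  by [].
have [t [s' [e1 v1 _ l1]]] := hr x _ hx.
exists (7 + t)%N, s'; split.
- apply: ExecSeq e1.
  have -> : encode x = Defs.eval (ECons (EHd (EVar 0)) (EHd (ETl (EVar 0))))
      (update (fun=> Defs.Nil) 0 (enc_input h r)).
    by rewrite /= /update /= encode_history.
  exact: ExecAssign.
- by rewrite v1 /x -strategy_answer.
have h1 : (T x <= a0 * 20 ^ k0 * n.+1 ^ (3 * k0))%N.
  apply: leq_trans (hT x) _; rewrite -mulnA leq_mul2l; apply/orP; right.
  rewrite expnM -expnMn.
  by case: (k0) => // k; rewrite leq_exp2r // sz_raw_history.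
(* For positive [n] this is [n.+1 <= 2 * n]; the case [n = 0] is left to the additive constant. *)
have h2 : (n.+1 ^ (3 * k0) <= 2 ^ (3 * k0) * n ^ (3 * k0) + 1)%N.
  case: (posnP n) => [->|n0]; first by rewrite exp1n leq_addl.
  rewrite -expnMn; apply: leq_trans (leq_addr _ _).
  by case: (3 * k0)%N => // j; rewrite leq_exp2r // mul2n -addnn -addn1 leq_add2l.
have h3 : (T x <= a0 * 20 ^ k0 * (2 ^ (3 * k0) * n ^ (3 * k0) + 1))%N.
  by apply: leq_trans h1 _; rewrite leq_mul2l h2 orbT.
rewrite /b; move: l1 h3; rewrite mulnDr muln1 mulnA !mulnDl.
set A := (a0 * 20 ^ k0 * 2 ^ _ * _)%N; lia.
Qed.

Import numFieldNormedType.Exports.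
Local Open Scope classical_set_scope.

Theorem theorem1p6 (R : realType) :
  exists2 C2 : R, 0 < C2 &
    forall p : nat -> R,
      (forall n, 0 <= p n <= 1) ->
      (\forall n \near \oo, C2 * ln n%:R / n%:R <= p n) ->
      exists S : forall n, rstrategy R n,
        poly_time S /\
        forall B : forall n, rstrategy R n,
          maker_win_prob (p n) (S n) (B n) @[n --> \oo] --> (1 : R).
Proof.
exists (200 * 200); first by rewrite mulr_gt0.
move=> p p01 hp; exists (maker_strategy R); split; first exact: poly_time_maker.
move=> B; apply/cvgrPdist_le => eps eps0; near=> n.
have n_ge : expR (8 * (200 * 200)) <= n%:R :> R by near: n; exact: nbhs_infty_ger.
have n_eps : 20 / eps <= n%:R by near: n; exact: nbhs_infty_ger.
have qp : 200 * 200 * ln n%:R / n%:R <= p n by near: n.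
have n0 : 0 < n%:R :> R := lt_le_trans (expR_gt0 _) n_ge.
set l := ln n%:R in qp; have nE : n%:R = expR l by rewrite /l lnK.
have l_big : 8 * (200 * 200) <= l by rewrite -ler_expR -nE.
set q := 200 * 200 * l / n%:R in qp.
have qn : q * n%:R = 200 * (200 * l) by rewrite /q divfK ?gt_eqF // mulrA.
have n_nat := n_nat_big nE l_big.
have hN := (card_Kn_bounds n).1.
have hw : 1 - 20 / n%:R <= maker_win_prob (p n) (maker_strategy R n) (B n).
  apply: win_prob_ge => b legal_b.
  apply: le_trans (pot_start nE l_big qn hN).
  apply: (loss_le_pot (p01 n) legal_b (q_gt0 nE l_big qn) (q_le_half nE l_big qn) qp
    (leq_trans _ n_nat) nE _ (l_le_n nE) qn (lamX_ge4 nE l_big qn)) => //.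
  by move: l_big; lra.
rewrite ger0_norm ?subr_ge0 ?win_prob_le1 //.
have : 20 / n%:R <= eps by rewrite ler_pdivrMr // mulrC -ler_pdivrMr.
by lra.
Unshelve. all: by end_near. Qed.
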